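(* Let $\mathbb{F}$ be a perfect field with $\mathbb{F}\neq\mathbb{F}_2$, and let $A$ be a unital associative algebraic $\mathbb{F}$-algebra. 1. The group of units $A^\times$ is bounded Engel if and only if $A$ is bounded Engel. In this case, $\mathcal{N}(A)$ is a locally nilpotent ideal of $A$ such that $A=\mathcal{Z}(A)+\mathcal{N}(A)$. 2. The group of units $A^\times$ is nilpotent if and only if $A$ is Lie nilpotent. Furthermore, in this case the nilpotency class of the group $A^\times$ and the nilpotency class of $A$ as a Lie algebra coincide.
   Context: $\mathbb{F}_2$ is the field with two elements. $A^\times$ is the group of multiplicative units of $A$, $\mathcal{Z}(A)$ is the center of $A$, and $\mathcal{N}(A)$ is the set of all nilpotent elements of $A$. An algebra is algebraic if each of its elements is algebraic over $\mathbb{F}$. An associative algebra is regarded as a Lie algebra via $[a,b]=ab-ba$; $A$ is Lie nilpotent if it is nilpotent as a Lie algebra, and bounded Engel if, for some fixed $n\ge1$, it satisfies the (left-normed) Lie identity $[x,y,\ldots,y]=0$ with $n$ occurrences of $y$. For group elements, $(x,y)=x^{-1}y^{-1}xy$; a group is bounded Engel if, for some fixed $n\ge 1$, it satisfies the (left-normed) group identity $(x,y,\ldots,y)=1$ with $n$ occurrences of $y$. A (not necessarily unital) algebra is locally nilpotent if every finitely generated (not necessarily unital) subalgebra of it is nilpotent. *)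

(* Defs.v *)
From HB Require Import structures.
From mathcomp Require Import all_boot all_order all_fingroup all_algebra.
From mathcomp Require Import separable.

Set Implicit Arguments.
Unset Strict Implicit.
Unset Printing Implicit Defensive.

Import GRing.Theory.
Local Open Scope ring_scope.

Definition perfect_field (F : fieldType) : Prop :=
  forall p : {poly F}, irreducible_poly p -> separable_poly p.

Definition algebraic_algebra (F : fieldType) (A : algType F) : Prop :=
  forall a : A, exists2 p : {poly F}, p != 0 & horner_alg a p = 0.

(* [{unit R}] of [finalg] is only available for finite rings. *)
Section UnitGroup.
Variable R : unitRingType.

Record units := Units { uval : R; uvalP : uval \is a GRing.unit }.

HB.instance Definition _ := [isSub for uval].
HB.instance Definition _ := [Choice of units by <:].

Lemma units_mul_subproof (u v : units) : uval u * uval v \is a GRing.unit.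
Proof. by rewrite unitrMl ?uvalP. Qed.

Lemma units_inv_subproof (u : units) : (uval u)^-1 \is a GRing.unit.
Proof. by rewrite unitrV uvalP. Qed.

Definition units_one : units := Units (unitr1 R).
Definition units_mul (u v : units) : units := Units (units_mul_subproof u v).
Definition units_inv (u : units) : units := Units (units_inv_subproof u).

Fact units_mulA : associative units_mul.
Proof. by move=> u v w; apply: val_inj; rewrite /= mulrA. Qed.

Fact units_mul1u : left_id units_one units_mul.
Proof. by move=> u; apply: val_inj; rewrite /= mul1r. Qed.

Fact units_mulu1 : right_id units_one units_mul.
Proof. by move=> u; apply: val_inj; rewrite /= mulr1. Qed.

Fact units_mulVu : left_inverse units_one units_inv units_mul.
Proof. by move=> u; apply: val_inj; rewrite /= mulVr ?uvalP. Qed.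

Fact units_muluV : right_inverse units_one units_inv units_mul.
Proof. by move=> u; apply: val_inj; rewrite /= divrr ?uvalP. Qed.

HB.instance Definition _ :=
  isGroup.Build units units_mulA units_mul1u units_mulu1 units_mulVu units_muluV.

End UnitGroup.

Section GroupConditions.
Variable G : groupType.
Local Open Scope group_scope.

Definition bounded_engel_group : Prop :=
  exists2 n, (0 < n)%N & forall x y : G, iter n (fun z => [~ z, y]) x = 1.

Inductive subgroup_gen (S : G -> Prop) : G -> Prop :=
| subgroup_gen_mem x of S x : subgroup_gen S x
| subgroup_gen1 : subgroup_gen S 1
| subgroup_genM x y of subgroup_gen S x & subgroup_gen S y :
    subgroup_gen S (x * y)
| subgroup_genV x of subgroup_gen S x : subgroup_gen S x^-1.

(* Indexed from 0: [group_lcs 0] is [G], [group_lcs 1] its derived subgroup. *)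
Fixpoint group_lcs (c : nat) : G -> Prop :=
  if c is c'.+1 then
    subgroup_gen (fun z => exists2 x, group_lcs c' x & exists y, z = [~ x, y])
  else fun=> True.

Definition group_class_le (c : nat) : Prop := forall x, group_lcs c x -> x = 1.

Definition nilpotent_group : Prop := exists c, group_class_le c.

Definition group_nilpotency_class (c : nat) : Prop :=
  group_class_le c /\ forall d, group_class_le d -> (c <= d)%N.

End GroupConditions.

Section LieConditions.
Variables (F : fieldType) (A : algType F).

Definition lie_bracket (a b : A) : A := a * b - b * a.

Definition bounded_engel_algebra : Prop :=
  exists2 n, (0 < n)%N & forall x y : A, iter n (fun z => lie_bracket z y) x = 0.

Inductive subspace_gen (S : A -> Prop) : A -> Prop :=
| subspace_gen_mem x of S x : subspace_gen S x
| subspace_gen0 : subspace_gen S 0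
| subspace_genD x y of subspace_gen S x & subspace_gen S y :
    subspace_gen S (x + y)
| subspace_genZ k x of subspace_gen S x : subspace_gen S (k *: x).

Fixpoint lie_lcs (c : nat) : A -> Prop :=
  if c is c'.+1 then
    subspace_gen
      (fun z => exists2 x, lie_lcs c' x & exists y, z = lie_bracket x y)
  else fun=> True.

Definition lie_class_le (c : nat) : Prop := forall x, lie_lcs c x -> x = 0.

Definition lie_nilpotent : Prop := exists c, lie_class_le c.

Definition lie_nilpotency_class (c : nat) : Prop :=
  lie_class_le c /\ forall d, lie_class_le d -> (c <= d)%N.

End LieConditions.

Section Nilpotents.
Variables (F : fieldType) (A : algType F).

Definition central (z : A) : Prop := forall a, z * a = a * z.

Definition nilpotent_elt (a : A) : Prop := exists n, a ^+ n = 0.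

Definition two_sided_ideal (I : A -> Prop) : Prop :=
  [/\ I 0,
      forall x y, I x -> I y -> I (x + y),
      forall (k : F) x, I x -> I (k *: x)
    & forall a x, I x -> I (a * x) /\ I (x * a)].

Inductive nonunital_subalg_gen (S : A -> Prop) : A -> Prop :=
| nonunital_subalg_gen_mem x of S x : nonunital_subalg_gen S x
| nonunital_subalg_gen0 : nonunital_subalg_gen S 0
| nonunital_subalg_genD x y of
    nonunital_subalg_gen S x & nonunital_subalg_gen S y :
    nonunital_subalg_gen S (x + y)
| nonunital_subalg_genZ k x of nonunital_subalg_gen S x :
    nonunital_subalg_gen S (k *: x)
| nonunital_subalg_genM x y of
    nonunital_subalg_gen S x & nonunital_subalg_gen S y :
    nonunital_subalg_gen S (x * y).

Definition nilpotent_subalg (B : A -> Prop) : Prop :=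
  exists2 n, (0 < n)%N &
    forall f : 'I_n -> A, (forall i, B (f i)) -> \prod_(i < n) f i = 0.

Definition locally_nilpotent (B : A -> Prop) : Prop :=
  forall s : seq A, (forall x, x \in s -> B x) ->
    nilpotent_subalg (nonunital_subalg_gen (fun x => x \in s)).

End Nilpotents.

(* Main.v *)
From HB Require Import structures.
Require Import Defs.
From mathcomp Require Import all_boot all_order all_fingroup all_algebra.
From mathcomp Require Import separable finfield ring zify.
From mathcomp Require boolp.
From mathcomp Require Import functions.
From Stdlib Require Ncring Ncring_initial Ncring_tac.
From Stdlib Require Import Classical.

(* Nilpotent elements are controlled through the Levitzki radical L, the largest
   locally nilpotent two-sided ideal; it is semiprime, and Levitzki's theorem on
   right ideals that are nil of bounded index, applied to the right ideals aA,
   shows that a Lie Engel identity, or over a finite field an Engel identity on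
   units, puts every nilpotent element into L.  In the Lie case all brackets also
   lie in L, and over a perfect field the semisimple part of an algebraic element
   is central, so A = Z(A) + N(A).

   Lie to group: the Engel identity passes to the ring of sequences in A, which
   makes the nilpotency of the products of basic brackets [s, u], [s, u, s], ...
   uniform; a commutator of units is 1 modulo the ideal they generate in a
   two-generated subalgebra, and each further n commutators gain one power of it.

   Group to Lie: over an infinite field one reads off the first-order coefficient
   in t of the identity on 1 + tc.  Over a finite field idempotents are central
   and A/L is reduced and periodic, hence commutative: the operators
   x |-> xa - a^(p^j) x reduce this to pairs with ba = a^(p^j) b, which generate a
   finite subring, where Wedderburn's little theorem applies.  Then commutators
   of units are unipotent, which makes some p^K-th power of every unit central,
   and [x, y^(p^K)] is an iterated bracket in characteristic p.

   For the classes, u - 1 and u lie in the corresponding terms of the upper central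
   series of A and of its unit group; from group to algebra this uses that A has a
   scalar other than 0 and 1. *)

Set Implicit Arguments.
Unset Strict Implicit.
Unset Printing Implicit Defensive.

Import GRing.Theory.
Local Open Scope ring_scope.

(** Nilpotent elements are not known to be closed under sums, so no quotient by them is available.
    The structural arguments are therefore congruences modulo an ideal that is semiprime by
    construction, and the Engel hypothesis first shows that an element whose square lies in it
    belongs to it. Uniformity is the second difficulty: the two-generated subalgebras that occur are
    nilpotent without a common bound, whereas a group identity needs one length. A bound common to
    all pairs is found for words in the basic brackets; the nilpotence of the individual pair then
    only serves to end a chain of ideal powers that is already constant. The terms of the upper
    central series are not ideals, which is why products such as [r * bracket a w * c] need an
    argument of their own. The scalar other than 0 and 1 acts three times: as an eigenvalue that
    makes idempotents central, in a polarisation, and as a unit that excludes a trivial unit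
    group. *)

#[global] Instance nc_ops (R : pzRingType) :
  @Ncring.Ring_ops R 0 1 +%R *%R (fun x y => x - y) -%R eq := {}.
#[global] Instance nc_ring (R : pzRingType) :
  @Ncring.Ring R 0 1 +%R *%R (fun x y => x - y) -%R eq (nc_ops R).
Proof.
split; rewrite /Algebra_syntax.equality /Algebra_syntax.addition
  /Algebra_syntax.multiplication /Algebra_syntax.subtraction
  /Algebra_syntax.opposite /Algebra_syntax.zero /Algebra_syntax.one
  /Ncring.eq_notation /Ncring.add_notation /Ncring.mul_notation
  /Ncring.sub_notation /Ncring.opp_notation /Ncring.zero_notation
  /Ncring.one_notation.
- exact: RelationClasses.eq_equivalence.
- by move=> x y -> ? ? ->.
- by move=> x y -> ? ? ->.
- by move=> x y -> ? ? ->.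
- by move=> x y ->.
- exact: add0r.
- exact: addrC.
- exact: addrA.
- exact: mul1r.
- exact: mulr1.
- exact: mulrA.
- exact: mulrDl.
- by move=> x y z; exact: mulrDr.
- by [].
- exact: subrr.
Qed.
Ltac nc_ring := Ncring_tac.non_commutative_ring.

(** * Locally nilpotent ideals and Levitzki's theorem *)

Section Ideals.
Variable R : pzRingType.
Implicit Types (I J P : R -> Prop) (s w : seq R).

Record ideal I : Prop := Ideal {
  ideal0 : I 0;
  idealD : forall x y, I x -> I y -> I (x + y);
  idealMl : forall x a, I a -> I (x * a);
  idealMr : forall a x, I a -> I (a * x) }.

Lemma idealN I a : ideal I -> I a -> I (- a).
Proof. by move=> iI Ia; rewrite -mulN1r; apply: idealMl. Qed.

Lemma idealB I a b : ideal I -> I a -> I b -> I (a - b).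
Proof. by move=> iI Ia Ib; apply: idealD => //; apply: idealN. Qed.

Lemma ideal_eqv I a b : ideal I -> I (a - b) -> I b -> I a.
Proof. by move=> iI Iab Ib; rewrite -(subrK b a); apply: idealD. Qed.

Lemma ideal_eqv_sym I a b : ideal I -> I (a - b) -> I (b - a).
Proof. by move=> iI /(idealN iI); rewrite opprB. Qed.

Lemma ideal_eqv_trans I a b c : ideal I -> I (a - b) -> I (b - c) -> I (a - c).
Proof.
by move=> iI Iab Ibc; rewrite -(subrK b a) -addrA; apply: idealD.
Qed.

Lemma ideal_eqvM I a b c d : ideal I ->
  I (a - b) -> I (c - d) -> I (a * c - b * d).
Proof.
move=> iI Iab Icd; have -> : a * c - b * d = (a - b) * c + b * (c - d) by nc_ring.
by apply: idealD => //; [apply: idealMr | apply: idealMl].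
Qed.

Lemma ideal_eqvX I a b n : ideal I -> I (a - b) -> I (a ^+ n - b ^+ n).
Proof.
move=> iI Iab; elim: n => [|n IHn]; first by rewrite subrr; apply: ideal0.
by rewrite !exprS; apply: ideal_eqvM.
Qed.

Definition nil_words s := exists m, forall w, size w = m ->
  {subset w <= s} -> \prod_(x <- w) x = 0.

Definition lnil_ideal I :=
  ideal I /\ forall s, (forall x, x \in s -> I x) -> nil_words s.

Fixpoint words s m : seq (seq R) :=
  if m is m'.+1 then [seq x :: w | x <- s, w <- words s m'] else [:: [::]].

Lemma wordsP s m w :
  reflect (size w = m /\ {subset w <= s}) (w \in words s m).
Proof.
elim: m w => [|m IHm] w /=.
  apply: (iffP idP) => [|[/size0nil ->]]; last by rewrite mem_head.
  by rewrite inE => /eqP ->.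
apply: (iffP allpairsP) => [[[x v] /= [xs vw ->]]|].
  have [sv vs] := IHm _ vw; split=> [|y]; first by rewrite /= sv.
  by rewrite inE => /predU1P[->|/vs].
case: w => [|x w] [] //= [sw] ws; exists (x, w) => /=; split=> //.
  by apply: ws; rewrite mem_head.
by apply/IHm; split=> // y yw; apply: ws; rewrite inE yw orbT.
Qed.

(** A word of length [k * m] splits into [k] blocks of length [m], and each block is one of finitely
    many elements of [P]. *)
Lemma lnil_ideal_words P s m : lnil_ideal P ->
  (forall w, size w = m -> {subset w <= s} -> P (\prod_(x <- w) x)) ->
  nil_words s.
Proof.
move=> [iP nP] Pw; pose t := [seq \prod_(x <- w) x | w : seq R <- words s m].
have [|k tk] := nP t; first by move=> x /mapP[w /wordsP[? ?] ->]; apply: Pw.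
exists (k * m)%N => w sw ws.
suff [v [sv vt ->]] : exists v, [/\ size v = k, {subset v <= t}
    & \prod_(x <- w) x = \prod_(x <- v) x] by exact: tk.
elim: k {tk} w sw ws => [|k IHk] w sw ws.
  by exists [::]; rewrite (size0nil sw); split.
have [|x /mem_drop/ws //|v [sv vt ev]] := IHk (drop m w).
  by rewrite size_drop sw mulSn addKn.
exists (\prod_(x <- take m w) x :: v); split; first by rewrite /= sv.
  move=> y; rewrite inE => /predU1P[->|/vt //]; apply/map_f/wordsP.
  by split=> [|z /mem_take/ws //]; rewrite size_takel // sw mulSn leq_addr.
by rewrite big_cons -ev -big_cat cat_take_drop.
Qed.

Lemma seq_choice (Q : R -> R -> Prop) s :
  (forall x, x \in s -> exists y, Q x y) ->
  exists f, forall x, x \in s -> Q x (f x).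
Proof.
elim: s => [|x s IHs] Qs; first by exists id.
have [|f Qf] := IHs; first by move=> y ys; apply: Qs; rewrite inE ys orbT.
have [y Qxy] := Qs x (mem_head _ _).
exists (fun z => if z == x then y else f z) => z.
by case: eqP => [-> _ //|zx]; rewrite inE => /predU1P[//|/Qf].
Qed.

(** Modulo [J] each listed element may be replaced by its component in [I]. Long words in these
    components vanish, so long words in the list fall into [J], and the block argument applies. *)
Lemma lnil_idealD I J : lnil_ideal I -> lnil_ideal J ->
  lnil_ideal (fun x => exists a b, [/\ I a, J b & x = a + b]).
Proof.
move=> [iI nI] [iJ nJ]; split.
  split.
  - by exists 0, 0; rewrite addr0; split=> //; exact: ideal0.
  - move=> _ _ [a [b [Ia Jb ->]]] [c [d [Ic Jd ->]]]; exists (a + c), (b + d).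
    by rewrite addrACA; split=> //; exact: idealD.
  - move=> x _ [a [b [Ia Jb ->]]]; exists (x * a), (x * b).
    by rewrite mulrDr; split=> //; exact: idealMl.
  - move=> _ x [a [b [Ia Jb ->]]]; exists (a * x), (b * x).
    by rewrite mulrDl; split=> //; exact: idealMr.
move=> s IJs.
have [|f If] := @seq_choice (fun x y => I y /\ J (x - y)) s.
  by move=> x /IJs[a [b [Ia Jb ->]]]; exists a; rewrite addrAC subrr add0r.
have [|m fm] := nI (map f s); first by move=> _ /mapP[x /If[? _] ->].
apply: (@lnil_ideal_words J s m); first by split.
move=> w sw ws; rewrite -[X in J X]subr0 -(fm (map f w)) ?size_map //; last first.
  by move=> _ /mapP[x /ws xs ->]; apply: map_f.
rewrite big_map; elim: w ws {sw} => [|x w IHw] ws.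
  by rewrite !big_nil subrr; apply: ideal0.
rewrite !big_cons; apply: ideal_eqvM => //.
  by have [] := If x (ws _ (mem_head _ _)).
by apply: IHw => y yw; apply: ws; rewrite inE yw orbT.
Qed.

Definition levitzki_radical (a : R) := exists I, lnil_ideal I /\ I a.
Local Notation L := levitzki_radical.

(** Adding up the witnesses puts a finite list inside a single ideal; this is why the union defining
    the radical is again a locally nilpotent ideal. *)
Lemma levitzki_radical_seq s : (forall x, x \in s -> L x) ->
  exists I, lnil_ideal I /\ forall x, x \in s -> I x.
Proof.
elim: s => [|x s IHs] Ls.
  exists (eq^~ 0); split=> //; split=> [|s s0].
    by split=> // [x y -> ->|x a ->|a x ->]; rewrite ?addr0 ?mulr0 ?mul0r.
  exists 1 => [[|x [|y w]]] //= _ ws.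
  by rewrite big_seq1; apply/s0/ws/mem_head.
have [|I [nI Is]] := IHs; first by move=> y ys; apply: Ls; rewrite inE ys orbT.
have [J [nJ Jx]] := Ls x (mem_head _ _).
exists (fun x => exists a b, [/\ I a, J b & x = a + b]); split.
  exact: lnil_idealD.
move=> y; rewrite inE => /predU1P[->|/Is Iy].
  by exists 0, x; rewrite add0r; split=> //; apply: ideal0; case: nI.
by exists y, 0; rewrite addr0; split=> //; apply: ideal0; case: nJ.
Qed.

Lemma lnil_levitzki_radical : lnil_ideal L.
Proof.
split; last by move=> s /levitzki_radical_seq[I [[_ nI] /nI]].
split.
- have [x|I [[iI nI] _]] := @levitzki_radical_seq [::]; first by rewrite in_nil.
  by exists I; split=> //; apply: ideal0.
- move=> x y Lx Ly; have [|I [[iI nI] Ixy]] := @levitzki_radical_seq [:: x; y].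
    by move=> z; rewrite !inE => /orP[] /eqP ->.
  by exists I; split=> //; apply: idealD => //; apply: Ixy; rewrite !inE eqxx ?orbT.
- by move=> x a [I [[iI nI] Ia]]; exists I; split=> //; apply: idealMl.
- by move=> a x [I [[iI nI] Ia]]; exists I; split=> //; apply: idealMr.
Qed.

Definition semiprime_ideal P :=
  ideal P /\ forall b, (forall x, P (b * x * b)) -> P b.

Inductive levitzki_adjoin b : R -> Prop :=
| LevitzkiAdjoinL l of L l : levitzki_adjoin b l
| LevitzkiAdjoinM x y : levitzki_adjoin b (x * b * y)
| LevitzkiAdjoinD u v of levitzki_adjoin b u & levitzki_adjoin b v :
  levitzki_adjoin b (u + v).

(** If every [b * x * b] lies in [L], then the ideal [L + RbR], encoded by [levitzki_adjoin], has
    its square inside [L]. It is therefore locally nilpotent and belongs to the union that defines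
    [L]. *)
Lemma semiprime_levitzki_radical : semiprime_ideal L.
Proof.
have [iL nL] := lnil_levitzki_radical; split=> // b Lb.
pose K := levitzki_adjoin b.
suff nK : lnil_ideal K.
  by exists K; split=> //; rewrite -[X in K X]mulr1 -[X in K (X * _)]mul1r;
    apply: LevitzkiAdjoinM.
have KM u v : K u -> K v -> L (u * v).
  move=> + Kv; elim=> {u} [l Ll|x y|u1 u2 _ IH1 _ IH2]; first exact: idealMr.
    elim: Kv => {v} [l Ll|x' y'|v1 v2 _ IH1 _ IH2]; first exact: idealMl.
      have -> : x * b * y * (x' * b * y') = x * (b * (y * x') * b) * y' by nc_ring.
      by apply: idealMr => //; apply: idealMl.
    by rewrite mulrDr; apply: idealD.
  by rewrite mulrDl; apply: idealD.
split; last first.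
  move=> s Ks; apply: (@lnil_ideal_words L s 2) => //.
  case=> [|x [|y []]] //= _ ws; rewrite big_cons big_seq1.
  by apply: KM; apply/Ks/ws; rewrite !inE eqxx ?orbT.
split.
- by apply: LevitzkiAdjoinL; exact: (ideal0 iL).
- by move=> x y; apply: LevitzkiAdjoinD.
- move=> z a; elim=> {a} [l Ll|x y|u v _ Ku _ Kv].
  + by apply: LevitzkiAdjoinL; apply: idealMl.
  + by rewrite !mulrA; apply: LevitzkiAdjoinM.
  + by rewrite mulrDr; apply: LevitzkiAdjoinD.
- move=> a z; elim=> {a} [l Ll|x y|u v _ Ku _ Kv].
  + by apply: LevitzkiAdjoinL; apply: idealMr.
  + by rewrite -!mulrA mulrA; apply: LevitzkiAdjoinM.
  + by rewrite mulrDl; apply: LevitzkiAdjoinD.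
Qed.

Lemma levitzki_radical_nil a : L a -> exists n, a ^+ n = 0.
Proof.
have [_ nL] := lnil_levitzki_radical => La.
have [|m am] := nL [:: a]; first by move=> x; rewrite inE => /eqP ->.
exists m; rewrite -(am (nseq m a)) ?size_nseq //; last first.
  by move=> x; rewrite mem_nseq inE => /andP[].
by elim: m {am} => [|m IHm] /=; rewrite ?big_nil // big_cons exprS IHm.
Qed.

Definition right_ideal (S : R -> Prop) :=
  (forall a b, S a -> S b -> S (a + b)) /\ (forall a x, S a -> S (a * x)).

(* Levitzki: a semiprime ring has no nonzero right ideal that is nil of
   bounded index; here everything is read modulo [P]. *)
Lemma levitzki_bounded P (S : R -> Prop) m : semiprime_ideal P -> right_ideal S ->
  (forall v c : R, S v -> S c -> P (v ^+ m * c)) -> forall c, S c -> P c.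
Proof.
move=> [iP sP]; elim: m S => [|m IHm] S [SD SM] Sm c Sc.
  by rewrite -(mul1r c) -(expr0 c); apply: Sm.
case: m IHm Sm => [|[|m]] IHm Sm.
- by apply: sP => x; rewrite -(expr1 (c * x)); apply: Sm => //; apply: SM.
- have wxwc (w : R) x c' : S w -> S x -> S c' -> P (w * x * w * c').
    move=> Sw Sx Sc'.
    have -> : w * x * w * c' = (w + w * x) ^+ 2 * c' - w ^+ 2 * c'
       - (w * x) ^+ 2 * c' - w ^+ 2 * x * c' by rewrite !expr2; nc_ring.
    apply: idealB => //; last by apply: idealMr => //; apply: Sm.
    have Swx : S (w * x) by apply: SM.
    apply: idealB => //; last exact: Sm.
    by apply: idealB; [|apply: Sm => //; apply: SD|apply: Sm].
  apply: IHm Sc => // w c' Sw Sc'; rewrite expr1; apply: sP => y.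
  have -> : w * c' * y * (w * c') = w * (c' * y) * w * c' by nc_ring.
  by apply: wxwc => //; apply: SM.
(* The right ideal [b S] has index at most [m.+2] modulo [P]: in powers of [(1 + r) * b] every
   [b * b] disappears, which puts [(1 + r) * Y] into [P]. Then [Y] is congruent to [(- r) ^+ k * Y]
   for all [k], and a high power of [r] in [S] kills it. *)
have key b : S b -> P (b * b) -> forall c', S c' -> P (b * c').
  move=> Sb Pbb c' Sc'.
  apply: (IHm (fun x => exists2 d, S d & x = b * d)) => [| |]; last by exists c'.
    split=> [_ _ [d Sd ->] [d' Sd' ->]|_ x [d Sd ->]].
      by exists (d + d'); rewrite ?mulrDr //; apply: SD.
    by exists (d * x); rewrite ?mulrA //; apply: SM.
  move=> _ _ [r Sr ->] [d Sd ->].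
  have Pb k : P ((b * (1 + r)) ^+ k * b - (b * r) ^+ k * b).
    elim: k => [|k IHk]; first by rewrite subrr; apply: ideal0.
    rewrite exprSr [in X in _ - X]exprSr.
    have -> : (b * (1 + r)) ^+ k * (b * (1 + r)) * b - (b * r) ^+ k * (b * r) * b
       = (b * (1 + r)) ^+ k * (b * b) + ((b * (1 + r)) ^+ k * b - (b * r) ^+ k * b) * (r * b)
      by nc_ring.
    by apply: idealD => //; [apply: idealMl | apply: idealMr].
  set Y := (b * r) ^+ m.+2 * (b * d).
  have PY : P (Y + r * Y).
    have W : ((1 + r) * b) ^+ m.+3 = (1 + r) * ((b * (1 + r)) ^+ m.+2 * b).
      elim: (m.+2) => [|k IHk]; first by rewrite expr0 expr1 mul1r.
      by rewrite exprS IHk exprS; nc_ring.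
    have -> : Y + r * Y = ((1 + r) * b) ^+ m.+3 * d
      - (1 + r) * ((b * (1 + r)) ^+ m.+2 * b - (b * r) ^+ m.+2 * b) * d.
      by rewrite W /Y; nc_ring.
    apply: idealB => //; last by apply: idealMr => //; apply: idealMl.
    by apply: Sm => //; rewrite mulrDl mul1r; apply: SD => //; apply: SM.
  have PrY k : P (Y - (- r) ^+ k * Y).
    elim: k => [|k IHk]; first by rewrite expr0 mul1r subrr; apply: ideal0.
    have -> : Y - (- r) ^+ k.+1 * Y = (Y - (- r) ^+ k * Y) + (- r) ^+ k * (Y + r * Y).
      by rewrite exprSr; nc_ring.
    by apply: idealD => //; apply: idealMl.
  apply: (ideal_eqv iP (PrY m.+4)); apply: idealMr => //.
  by rewrite exprNn; apply: idealMl => //; rewrite exprSr; apply: Sm.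
have SX (w : R) k : S w -> S (w ^+ k.+1) by move=> Sw; rewrite exprS; apply: SM.
apply: IHm Sc => // w c' Sw Sc'; apply: key => //; first exact: SX.
rewrite -exprD !addSnnS exprD.
by apply: idealMl => //; rewrite exprSr; apply: Sm.
Qed.
End Ideals.

(** * Lie Engel rings modulo a semiprime ideal *)

(** The binomial theorem for two commuting operators, stated for an array on which [D] acts as the
    sum of the two shifts. It serves both for [(a + b) ^+ p] and for iterates of
    [z |-> z * y - c * z]. *)
Lemma iter_binomial (V : zmodType) (D : V -> V) (g : nat -> nat -> V) m :
  (forall u v, D (u + v) = D u + D v) ->
  (forall i j, D (g i j) = g i j.+1 + g i.+1 j) ->
  iter m D (g 0 0)%N = \sum_(i < m.+1) g i (m - i)%N *+ 'C(m, i).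
Proof.
move=> DD Dg; have D0 : D 0 = 0 by apply: (addIr (D 0)); rewrite -DD !add0r.
have Dn u n : D (u *+ n) = D u *+ n.
  by elim: n => [|n IHn]; rewrite ?mulr0n // !mulrS DD IHn.
elim: m => [|m IHm]; first by rewrite big_ord1 bin0.
rewrite iterS IHm (big_morph D DD D0).
have E (i : 'I_m.+1) : D (g i (m - i)%N *+ 'C(m, i)) =
    g i (m.+1 - i)%N *+ 'C(m, i) + g i.+1 (m - i)%N *+ 'C(m, i).
  by rewrite Dn Dg mulrnDl subSn ?leq_ord.
under eq_bigr do rewrite E.
rewrite big_split /= [RHS]big_ord_recl bin0 [in RHS]big_ord_recr /= subn0.
rewrite big_ord_recl bin0 subn0 -!addrA; congr (_ + _).
rewrite [X in _ + X]big_ord_recr /= addrA; congr (_ + _); last first.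
  by rewrite /bump /= !add1n subSS subnn !binn.
rewrite -big_split /=; apply: eq_bigr => i _.
by rewrite /bump /= !add1n subSS binS mulrnDr.
Qed.

Section Brackets.
Variable R : pzRingType.
Implicit Types (P : R -> Prop) (a b c d w x y z : R).

Definition bracket a b := a * b - b * a.
Local Notation ad y := (bracket^~ y).

Lemma bracketDl a b c : bracket (a + b) c = bracket a c + bracket b c.
Proof. by rewrite /bracket; nc_ring. Qed.
Lemma bracketDr a b c : bracket a (b + c) = bracket a b + bracket a c.
Proof. by rewrite /bracket; nc_ring. Qed.
Lemma bracketNl a c : bracket (- a) c = - bracket a c.
Proof. by rewrite /bracket; nc_ring. Qed.
Lemma bracket0l c : bracket 0 c = 0.
Proof. by rewrite /bracket; nc_ring. Qed.
Lemma bracketMl a b c : bracket (a * b) c = a * bracket b c + bracket a c * b.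
Proof. by rewrite /bracket; nc_ring. Qed.
Lemma bracketMr a b c : bracket a (b * c) = bracket a b * c + b * bracket a c.
Proof. by rewrite /bracket; nc_ring. Qed.

Lemma bracketMnl a c m : bracket (a *+ m) c = bracket a c *+ m.
Proof. by rewrite /bracket mulrnAl mulrnAr mulrnBl. Qed.

Lemma bracket_eq0 a b : bracket a b = 0 <-> a * b = b * a.
Proof.
by split=> [/eqP|/eqP]; [rewrite subr_eq0 => /eqP | rewrite -subr_eq0 => /eqP].
Qed.

Definition lie_engel n := forall x y, iter n (ad y) x = 0.

Lemma lie_engel_leq m n : (m <= n)%N -> lie_engel m -> lie_engel n.
Proof.
move=> mn Rm x y; rewrite -(subnK mn) iterD Rm.
by elim: (n - m)%N => //= k ->; rewrite bracket0l.
Qed.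

Lemma ideal_bracketl P a b : ideal P -> P a -> P (bracket a b).
Proof. by move=> iP Pa; apply: idealB => //; [apply: idealMr|apply: idealMl]. Qed.

Lemma ideal_iter_bracket P m a b : ideal P -> P a -> P (iter m (ad b) a).
Proof. by move=> iP Pa; elim: m => //= m; apply: ideal_bracketl. Qed.

Section PrimeCharacteristic.
Variables (p : nat) (p_pr : prime p) (pR0 : p%:R = 0 :> R).

Lemma iter_binomial_prime (D : R -> R) (g : nat -> nat -> R) :
  (forall u v, D (u + v) = D u + D v) ->
  (forall i j, D (g i j) = g i j.+1 + g i.+1 j) ->
  iter p D (g 0 0)%N = g 0%N p + g p 0%N.
Proof.
move=> DD Dg; rewrite (iter_binomial _ DD Dg).
case: p p_pr pR0 (prime_gt0 p_pr) => // q q_pr qR0 _.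
rewrite big_ord_recl big_ord_recr big1 /= => [|i _].
  by rewrite /bump /= !add1n subn0 subnn bin0 binn add0r.
rewrite /bump /= add1n -mulr_natr.
have /dvdnP[k ->] : (q.+1 %| 'C(q.+1, i.+1))%N.
  by apply: prime_dvd_bin => //=; rewrite ltnS ltn_ord.
by rewrite natrM qR0 !mulr0.
Qed.

Lemma exprDn_pchar_comm a b : a * b = b * a -> (a + b) ^+ p = a ^+ p + b ^+ p.
Proof.
move=> ab; have abi i : b * a ^+ i = a ^+ i * b.
  exact/commrX/esym.
have -> : (a + b) ^+ p = iter p ( *%R (a + b)) (a ^+ 0 * b ^+ 0).
  by rewrite mulr1; elim: p => //= m <-; rewrite exprS.
rewrite (@iter_binomial_prime _ (fun i j => a ^+ i * b ^+ j)).
- by rewrite mul1r mulr1 addrC.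
- by move=> u v; rewrite mulrDr.
- by move=> i j; rewrite mulrDl !mulrA abi exprS exprS addrC -!mulrA.
Qed.

Lemma exprDn_pchar_iter a b k :
  a * b = b * a -> (a + b) ^+ (p ^ k) = a ^+ (p ^ k) + b ^+ (p ^ k).
Proof.
move=> ab; elim: k => [|k IHk]; first by rewrite !expn0 !expr1.
rewrite expnSr !exprM IHk exprDn_pchar_comm //.
by apply/commrX/commr_sym/commrX/esym.
Qed.

Lemma exprNn_pchar a : (- a) ^+ p = - a ^+ p.
Proof.
apply/eqP; rewrite -addr_eq0 -exprDn_pchar_comm ?mulrN ?mulNr // addNr.
by rewrite expr0n gtn_eqF ?prime_gt0.
Qed.

Lemma exprNn_pchar_iter a k : (- a) ^+ (p ^ k) = - a ^+ (p ^ k).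
Proof.
by elim: k => [|k IHk]; rewrite ?expn0 ?expr1 // expnSr !exprM IHk exprNn_pchar.
Qed.

Lemma exprBn_pchar_iter a b k :
  a * b = b * a -> (a - b) ^+ (p ^ k) = a ^+ (p ^ k) - b ^+ (p ^ k).
Proof.
by move=> ab; rewrite exprDn_pchar_iter ?exprNn_pchar_iter // mulrN mulNr ab.
Qed.

(** Right multiplication by [y] and left multiplication by [c] commute, so Frobenius applies to
    their difference. *)
Lemma iter_twisted_prime c x y :
  iter p (fun z => z * y - c * z) x = x * y ^+ p - c ^+ p * x.
Proof.
have -> : iter p (fun z => z * y - c * z) x =
    iter p (fun z => z * y - c * z) ((- c) ^+ 0 * (x * y ^+ 0)) by rewrite mul1r mulr1.
rewrite (@iter_binomial_prime _ (fun i j => (- c) ^+ i * (x * y ^+ j))).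
- by rewrite exprNn_pchar !expr0 mul1r mulr1 mulNr.
- by move=> u v; nc_ring.
by move=> i j; rewrite [y ^+ j.+1]exprSr [(- c) ^+ i.+1]exprS; nc_ring.
Qed.

Lemma iter_twisted_pchar k c x y :
  iter (p ^ k) (fun z => z * y - c * z) x = x * y ^+ (p ^ k) - c ^+ (p ^ k) * x.
Proof.
elim: k c x y => [|k IHk] c x y; first by rewrite expn0 !expr1.
rewrite expnS iterM (eq_iter (fun z => IHk c z y)) iter_twisted_prime -!exprM.
by rewrite mulnC.
Qed.

Lemma iter_bracket_pchar k x y : iter (p ^ k) (ad y) x = bracket x (y ^+ (p ^ k)).
Proof. exact: iter_twisted_pchar. Qed.

End PrimeCharacteristic.

Section EngelModuloIdeal.
Variables (n : nat) (Rn : lie_engel n) (P : R -> Prop).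

(** As [a * a] lies in [P], iterated brackets of [a] with [a * x] reduce to [(- (a * x)) ^+ k * a]
    modulo [P]. The Engel identity then bounds the index of the right ideal [a R] by [n]. *)
Lemma engel_semiprime_sq0 a : semiprime_ideal P -> P (a * a) -> P a.
Proof.
move=> sP; have [iP _] := sP => Paa.
apply: (levitzki_bounded (S := fun z => exists x, z = a * x) (m := n) sP).
- split=> [_ _ [x ->] [y ->]|_ x [y ->]]; first by exists (x + y); rewrite mulrDr.
  by exists (y * x); rewrite mulrA.
- move=> _ _ [x ->] [y ->]; rewrite mulrA; apply: idealMr => //.
  have E k : P (iter k (ad (a * x)) a - (- (a * x)) ^+ k * a).
    elim: k => [|k IHk]; first by rewrite mul1r subrr; apply: ideal0.
    rewrite iterS exprS; set u := iter k _ a in IHk *; set v := (- (a * x)) ^+ k in IHk *.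
    have -> : bracket u (a * x) - - (a * x) * v * a
      = (u - v * a) * (a * x) - (a * x) * (u - v * a) + v * (a * a) * x.
      by rewrite /bracket; nc_ring.
    by apply: idealD => //; [apply: ideal_bracketl|apply: idealMr => //; apply: idealMl].
  have := E n; rewrite Rn sub0r => /(idealN iP); rewrite opprK exprNn -mulrA.
  by move=> /(idealMl iP ((-1) ^+ n)); rewrite signrMK.
- by exists 1; rewrite mulr1.
Qed.

Hypotheses (iP : ideal P) (csP : forall a, P (a * a) -> P a).

Lemma completely_semiprime_expr a k : P (a ^+ k) -> P a.
Proof.
move=> Pak; have {Pak} : P (a ^+ (2 ^ k)).
  by rewrite -(subnK (ltnW (ltn_expl k (ltnSn 1)))) exprD; apply: idealMl.
by elim: k => [|k IHk]; rewrite ?expn0 ?expr1 // expnSr exprM expr2 => /csP/IHk.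
Qed.

Lemma completely_semiprimeC a b : P (a * b) -> P (b * a).
Proof.
move=> Pab; apply: csP; have -> : b * a * (b * a) = b * (a * b) * a by nc_ring.
by apply: idealMr => //; apply: idealMl.
Qed.

Lemma completely_semiprime_insert a b x : P (a * b) -> P (a * x * b).
Proof.
move=> /completely_semiprimeC Pba; apply: csP.
have -> : a * x * b * (a * x * b) = a * x * (b * a) * (x * b) by nc_ring.
by apply: idealMr => //; apply: idealMl.
Qed.

Lemma completely_semiprime_mulX a b k : P (a * b ^+ k) -> P (a * b).
Proof.
elim: k => [|k IHk]; first by rewrite mulr1; apply: idealMr.
case: k IHk => // k IHk Pab; apply: IHk; apply: csP.
have -> : a * b ^+ k.+1 * (a * b ^+ k.+1) = a * b ^+ k.+1 * (a * b ^+ k) * b.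
  by rewrite [in X in _ * X = _]exprSr !mulrA.
by apply: completely_semiprime_insert; rewrite -mulrA -exprSr.
Qed.

(** The Kleinecke-Shirokov computation: modulo [P] the bracket with [y] is a derivation killing [d],
    so its [m]-th iterate sends [x ^+ m] to m! times [d ^+ m]. At [m = n] the Engel identity makes
    this vanish, and n! is invertible. *)
Lemma completely_semiprime_bracket_char0 x y :
  (forall m, (0 < m)%N -> exists v, m%:R * v = 1 :> R) ->
  P (bracket (bracket x y) y) -> P (bracket x y).
Proof.
move=> R0; set d := bracket x y => Pd.
(* At [m = 0] the exponent [m.-1] is a default value, harmless because its term has coefficient
   0. *)
have E u m : P (iter m (ad y) (x * u)
    - (x * iter m (ad y) u + d * iter m.-1 (ad y) u *+ m)).
  elim: m => [|m IHm]; first by rewrite mulr0n addr0 subrr; apply: ideal0.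
  rewrite [iter m.+1 _ (x * u)]/=; set v := iter m _ (x * u) in IHm *.
  have -> : bracket v y - (x * iter m.+1 (ad y) u + d * iter m (ad y) u *+ m.+1) =
    bracket (v - (x * iter m (ad y) u + d * iter m.-1 (ad y) u *+ m)) y
    + bracket d y * iter m.-1 (ad y) u *+ m.
    rewrite bracketDl bracketNl bracketDl bracketMnl !bracketMl -/d.
    case: m {IHm} @v => [|m] v /=; first by rewrite !mulr0n mulr1n; nc_ring.
    by rewrite mulrnDl [d * _ *+ m.+2]mulrSr; nc_ring.
  apply: idealD => //; first exact: ideal_bracketl.
  by rewrite -mulr_natr; do 2!apply: idealMr => //.
have Ed m : P (iter m.+1 (ad y) (x ^+ m)) /\ P (iter m (ad y) (x ^+ m) - d ^+ m *+ m`!).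
  elim: m => [|m [IH0 IH1]] /=.
    by rewrite mulr1n subrr /bracket mulr1 mul1r subrr; split; apply: ideal0.
  split.
    have := E (x ^+ m) m.+2; rewrite -exprS /= => /(ideal_eqv iP); apply.
    apply: idealD => //; first by apply: idealMl => //; apply: ideal_bracketl.
    by rewrite -mulr_natr; apply: idealMr => //; apply: idealMl.
  have := E (x ^+ m) m.+1; rewrite -exprS /= => /(ideal_eqv_trans iP); apply.
  rewrite -addrA; apply: idealD => //; first exact: idealMl.
  rewrite factS mulnC exprS mulrnA -mulrnBl -mulrnAr -mulrBr.
  by rewrite -[_ *+ m.+1]mulr_natr; apply: idealMr => //; apply: idealMl.
have /(R0 _)[v nv] := fact_gt0 n.
have := (Ed n).2; rewrite Rn sub0r => /(idealN iP); rewrite opprK.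
rewrite -mulr_natr => /idealMr-/(_ iP v); rewrite -mulrA nv mulr1.
exact: completely_semiprime_expr.
Qed.

(** Factorials may vanish here. The replacement is that all [p ^ n]-th powers are central, since a
    [p ^ n]-fold bracket with [z] is a bracket with [z ^+ (p ^ n)]. *)
Lemma completely_semiprime_bracket_pchar p x y : prime p -> p%:R = 0 :> R ->
  P (bracket (bracket x y) y) -> P (bracket x y).
Proof.
move=> p_pr pR0; set d := bracket x y => Pd.
pose M := (p ^ n)%N; have M_gt0 : (0 < M)%N by rewrite expn_gt0 prime_gt0.
have zM z u : u * z ^+ M = z ^+ M * u.
  apply/bracket_eq0; rewrite -(iter_bracket_pchar p_pr pR0).
  by apply: (lie_engel_leq _ Rn); rewrite ltnW // ltn_expl ?prime_gt1.
have Pdk k : P (bracket (d ^+ k) y).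
  elim: k => [|k IHk]; first by rewrite /bracket mulr1 mul1r subrr; apply: ideal0.
  by rewrite exprS bracketMl; apply: idealD => //; [apply: idealMl|apply: idealMr].
(* Chosen so that [w * y] is congruent to [y * (w + d ^+ M)]. Passing to [M]-th powers, Frobenius
   and the centrality of [w ^+ M] leave [y * d ^+ (M * M)] in [P]. *)
pose w := x * d ^+ M.-1 * y.
have Pw : P (w * y - y * (w + d ^+ M)).
  have -> : w * y - y * (w + d ^+ M) = bracket w y - y * d ^+ M.
    by rewrite /bracket; nc_ring.
  rewrite zM bracketMl /(bracket y y) subrr mulr0 add0r bracketMl -/d.
  rewrite -[in X in _ - X](prednK M_gt0) exprS.
  have -> : (x * bracket (d ^+ M.-1) y + d * d ^+ M.-1) * y - d * d ^+ M.-1 * y =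
    x * bracket (d ^+ M.-1) y * y by nc_ring.
  by apply: idealMr => //; apply: idealMl.
have Pwk k : P (w ^+ k * y - y * (w + d ^+ M) ^+ k).
  elim: k => [|k IHk]; first by rewrite mulr1 mul1r subrr; apply: ideal0.
  rewrite exprSr [in X in _ - X]exprSr.
  have -> : w ^+ k * w * y - y * ((w + d ^+ M) ^+ k * (w + d ^+ M)) =
     w ^+ k * (w * y - y * (w + d ^+ M)) + (w ^+ k * y - y * (w + d ^+ M) ^+ k) * (w + d ^+ M)
     by nc_ring.
  by apply: idealD => //; [apply: idealMl|apply: idealMr].
have := Pwk M; rewrite exprDn_pchar_iter // -zM -exprM.
rewrite mulrDr opprD addrA subrr sub0r => /(idealN iP); rewrite opprK.
move=> /completely_semiprime_mulX Pyd; apply: csP.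
rewrite {1}/d; have -> : bracket x y * d = x * (y * d) - y * x * d.
  by rewrite /bracket; nc_ring.
by apply: idealB => //; [apply: idealMl | apply: completely_semiprime_insert].
Qed.

Lemma completely_semiprime_bracket x y :
  (exists2 p, prime p & p%:R = 0 :> R) \/
  (forall m, (0 < m)%N -> exists v, m%:R * v = 1 :> R) ->
  P (bracket x y).
Proof.
move=> Rchar.
suff E k : P (iter k (ad y) (bracket x y)) -> P (bracket x y).
  by apply: (E n); rewrite Rn; apply: ideal0.
elim: k => // k IHk Pk; apply: IHk; move: Pk; rewrite -!iterSr /= => Pk.
case: Rchar => [[p p_pr pR0]|R0].
  exact: (completely_semiprime_bracket_pchar p_pr pR0 Pk).
exact: (completely_semiprime_bracket_char0 R0 Pk).
Qed.
End EngelModuloIdeal.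
End Brackets.

(** * Upper central series of an algebra and of its unit group *)

Section UnitsValues.
Variable A : unitRingType.
Implicit Types (u v : units A).

Lemma uvalM u v : uval (u * v)%g = uval u * uval v. Proof. by []. Qed.
Lemma uval1 : uval (1%g : units A) = 1. Proof. by []. Qed.
Lemma uvalV u : uval u^-1%g = (uval u)^-1. Proof. by []. Qed.

Lemma uval_inj u v : uval u = uval v -> u = v.
Proof. by move/val_inj. Qed.

Lemma uvalR u v : uval [~ u, v]%g = (uval u)^-1 * ((uval v)^-1 * (uval u * uval v)).
Proof. by []. Qed.

Lemma uvalK u : uval u * (uval u)^-1 = 1. Proof. exact/divrr/uvalP. Qed.
Lemma uvalVK u : (uval u)^-1 * uval u = 1. Proof. exact/mulVr/uvalP. Qed.
End UnitsValues.

Section UpperCentralSeries.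
Variables (F : fieldType) (A : algType F).
Implicit Types (a b c r s v w x : A).

Fixpoint lie_ucs k a : Prop :=
  if k is k'.+1 then forall v, lie_ucs k' (bracket a v) else a = 0.

Lemma lie_ucs0 k : lie_ucs k 0.
Proof. by elim: k => //= k IHk v; rewrite bracket0l. Qed.

Lemma lie_ucsD k a b : lie_ucs k a -> lie_ucs k b -> lie_ucs k (a + b).
Proof.
elim: k a b => /= [a b -> ->|k IHk a b Za Zb v]; first by rewrite addr0.
by rewrite bracketDl; apply: IHk.
Qed.

Lemma lie_ucsZ k t a : lie_ucs k a -> lie_ucs k (t *: a).
Proof.
elim: k a => /= [a ->|k IHk a Za v]; first by rewrite scaler0.
by rewrite /bracket -scalerAl -scalerAr -scalerBr; apply/IHk/Za.
Qed.

Lemma lie_ucsN k a : lie_ucs k a -> lie_ucs k (- a).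
Proof. by rewrite -scaleN1r; apply: lie_ucsZ. Qed.

Lemma lie_ucsB k a b : lie_ucs k a -> lie_ucs k b -> lie_ucs k (a - b).
Proof. by move=> Za Zb; apply/lie_ucsD/lie_ucsN. Qed.

Lemma lie_ucsS k a : lie_ucs k a -> lie_ucs k.+1 a.
Proof.
elim: k a => [a -> v|k IHk a Za v]; first by rewrite bracket0l.
exact/IHk/Za.
Qed.

Lemma lie_ucs_bracket k a v : lie_ucs k a -> lie_ucs k (bracket a v).
Proof. by move=> Za; apply: (lie_ucsS Za). Qed.

Lemma lie_ucs_central k z : central z -> lie_ucs k.+1 z.
Proof.
move=> zC v; have -> : bracket z v = 0 by apply/bracket_eq0/zC.
exact: lie_ucs0.
Qed.

(** The factor [c] is absorbed, as [bracket a w * c = bracket a (w * c)]. Bracketing with [s] then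
    rewrites the left factor [r] through brackets, up to an instance one level lower in which [r]
    and [w] have exchanged roles. *)
Lemma lie_ucs_mul_bracket k a w r c : lie_ucs k.+1 a ->
  r * w = w * r -> c * a = a * c -> lie_ucs k (r * bracket a w * c).
Proof.
elim: k a w r c => [a w r c Za _ _|k IHk a w r c Za rw ca].
  by have /= -> := Za w; rewrite mulr0 mul0r.
move=> s; pose b := bracket a (w * c).
have bE : bracket a w * c = b.
  rewrite /b /bracket mulrBl -!mulrA ca; congr (_ - _).
have Zb : lie_ucs k.+1 b := Za _.
have -> : bracket (r * bracket a w * c) s =
  bracket b (r * s) + bracket b (bracket s r) - bracket (b * s) r.
  by rewrite -mulrA bE /bracket; nc_ring.
apply: lie_ucsB; first by apply: lie_ucsD; apply: Zb.
have -> : bracket (b * s) r = bracket (bracket a (w * c * s)) r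
  - w * bracket (bracket a (c * s)) r * 1.
  have -> : b * s = bracket a (w * c * s) - w * bracket a (c * s).
    by rewrite -bE /bracket !mulrA; nc_ring.
  rewrite bracketDl bracketNl bracketMl (_ : bracket w r = 0) ?mul0r ?addr0 ?mulr1 //.
  exact/bracket_eq0/esym.
apply: lie_ucsB; first exact: (Za (w * c * s)).
by apply: (IHk (bracket a (c * s)) r w 1); rewrite ?mul1r ?mulr1.
Qed.

Lemma bracketZl (t : F) a c : bracket (t *: a) c = t *: bracket a c.
Proof. by rewrite /bracket -scalerAl -scalerAr scalerBr. Qed.
Lemma bracketZr (t : F) a c : bracket c (t *: a) = t *: bracket c a.
Proof. by rewrite /bracket -scalerAl -scalerAr scalerBr. Qed.
End UpperCentralSeries.

Fixpoint group_ucs (G : groupType) k (x : G) : Prop :=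
  if k is k'.+1 then forall y, group_ucs k' [~ x, y]%g else x = 1%g.

Lemma mulr_1Dnil (A : pzRingType) (a : A) m :
  a ^+ m = 0 -> (1 + a) * \sum_(i < m) (- a) ^+ i = 1.
Proof.
move=> am; have := subrX1 (- a) m; rewrite exprNn am mulr0 sub0r => /(congr1 -%R).
by rewrite opprK -mulNr opprB opprK => <-.
Qed.

Lemma unitr_1Dnil (A : unitRingType) (a : A) :
  (exists m, a ^+ m = 0) -> 1 + a \is a GRing.unit.
Proof.
case=> m am; set b := \sum_(i < m) (- a) ^+ i.
have abC : GRing.comm (1 + a) b.
  apply: commr_sum => i _; apply: commrX; apply: commr_sym; apply: commrD.
    exact: commr1.
  by apply: commr_sym; apply: commrN.
by apply/unitrP; exists b; rewrite -abC; have := mulr_1Dnil am.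
Qed.

Section UnitCentralSeries.
Variables (F : fieldType) (A : unitAlgType F).
Implicit Types (a b c r s v w x : A).

Lemma lie_ucs_conj k a v : v \is a GRing.unit ->
  lie_ucs k a -> lie_ucs k (v^-1 * a * v).
Proof.
move=> vU; elim: k a => [a ->|k IHk a Za w]; first by rewrite mulr0 mul0r.
have -> : bracket (v^-1 * a * v) w = v^-1 * bracket a (v * w * v^-1) * v.
  by rewrite /bracket mulrBr mulrBl !mulrA mulrVK // mulVr // mul1r.
exact/IHk/Za.
Qed.

(** With [a = uval u - 1], the commutator minus 1 is a conjugate by [u] of
    [v^-1 * bracket a v * u^-1], the shape covered by [lie_ucs_mul_bracket]. *)
Lemma group_ucs_of_lie k (u : units A) :
  lie_ucs k (uval u - 1) -> group_ucs k u.
Proof.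
elim: k u => [u /eqP|k IHk u Zu v] /=.
  by rewrite subr_eq0 => /eqP u1; apply: uval_inj.
apply: IHk.
have -> : uval [~ u, v]%g - 1 = (uval u)^-1 *
   ((uval v)^-1 * bracket (uval u - 1) (uval v) * (uval u)^-1) * uval u.
  rewrite uvalR -!mulrA uvalVK mulr1.
  have -> : bracket (uval u - 1) (uval v) = bracket (uval u) (uval v).
    by rewrite /bracket; nc_ring.
  by rewrite /bracket !mulrBr (mulrA _ (uval v) (uval u)) uvalVK mul1r uvalVK.
apply: (lie_ucs_conj (uvalP u)); apply: (lie_ucs_mul_bracket Zu).
  by rewrite uvalVK uvalK.
by rewrite mulrBr mulrBl uvalVK uvalK mulr1 mul1r.
Qed.

(** * Conjugation by a unit as a skew derivation *)

Section ConjugationDerivation.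
Variables (u : A) (uU : u \is a GRing.unit) (N : A -> Prop).
Hypotheses (iN : ideal N) (N_unit : forall a, N a -> 1 + a \is a GRing.unit).
Hypothesis A_ZN : forall a, exists2 z, central z & N (a - z).
Variable t : F.
Hypotheses (t0 : t != 0) (t1 : t != 1).

Let S x := u * x * u^-1.
Let D x := S x - x.

Let SM x y : S (x * y) = S x * S y.
Proof. by rewrite /S !mulrA mulrVK. Qed.
Let SD x y : S (x + y) = S x + S y.
Proof. by rewrite /S; nc_ring. Qed.
Let SZ k x : S (k *: x) = k *: S x.
Proof. by rewrite /S -scalerAr -scalerAl. Qed.
Let Scentral z : central z -> S z = z.
Proof. by move=> zC; rewrite /S -zC mulrK. Qed.
Let DD x y : D (x + y) = D x + D y.
Proof. by rewrite /D SD; nc_ring. Qed.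
Let DZ k x : D (k *: x) = k *: D x.
Proof. by rewrite /D SZ scalerBr. Qed.
Let D1 : D 1 = 0.
Proof. by rewrite /D Scentral ?subrr // => a; rewrite mul1r mulr1. Qed.
Let DM x y : D (x * y) = S x * D y + D x * y.
Proof. by rewrite /D SM; nc_ring. Qed.

(** A quadratic map with polar form [alpha]. On a unit [v] it is controlled by the hypothesis on
    [v^-1 * D v], because [beta v = v * bracket (v^-1 * D v) v]. *)
Let beta x := bracket (D x) x.
Let alpha x y := bracket (D x) y + bracket (D y) x.

Let betaD x y : beta (x + y) = beta x + alpha x y + beta y.
Proof. by rewrite /beta DD /alpha /bracket; nc_ring. Qed.

Let gammaD x y : (x + y) * beta (x + y) = x * beta x
  + (x * alpha x y + y * beta x) + (y * alpha x y + x * beta y) + y * beta y.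
Proof. by rewrite betaD; nc_ring. Qed.

Let beta1D x : beta (1 + x) = beta x.
Proof. by rewrite /beta DD D1 /bracket; nc_ring. Qed.

Let alphaZ x y : alpha x (t *: y) = t *: alpha x y.
Proof. by rewrite /alpha DZ bracketZl bracketZr -scalerDr. Qed.

Let betaZ x : beta (t *: x) = t ^+ 2 *: beta x.
Proof. by rewrite /beta DZ bracketZl bracketZr scalerA. Qed.

Variable j : nat.
Hypothesis Dv_ucs : forall v, v \is a GRing.unit -> lie_ucs j.+1 (v^-1 * D v).

(** The hypothesis speaks of units, and [1 + N] is not closed under sums. Polarising [beta] and the
    cubic map produces [bracket (D v * S w) v] for every [w] in [N]; since [S] maps [N] onto itself,
    all multipliers [s] are reached. *)
Lemma lie_ucs_conj_derivation1 v s : N (v - 1) -> N s ->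
   lie_ucs j (bracket (v^-1 * D v * s) v).
Proof.
have U1 x : N (x - 1) -> x \is a GRing.unit.
  by move=> /N_unit; rewrite addrC subrK.
have betaU x : N (x - 1) -> lie_ucs j (beta x) /\ lie_ucs j (x * beta x).
  move=> /U1 xU; have Ze := Dv_ucs xU.
  have -> : beta x = x * bracket (x^-1 * D x) x * 1.
    rewrite mulr1 /beta -{1}(mulVKr xU (D x)) bracketMl.
    by rewrite (_ : bracket x x = 0) ?mul0r ?addr0 // /bracket subrr.
  have -> : x * (x * bracket (x^-1 * D x) x * 1) = x * x * bracket (x^-1 * D x) x * 1.
    by rewrite !mulrA.
  by split; apply: (lie_ucs_mul_bracket Ze); rewrite ?mul1r ?mulr1 ?mulrA.
have betaN x : N x -> lie_ucs j (beta x) /\ lie_ucs j (x * beta x).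
  move=> Nx; have [] := betaU (1 + x); first by rewrite addrC addKr.
  rewrite beta1D mulrDl mul1r => Zb Zxb; split=> //.
  by have := lie_ucsB Zxb Zb; rewrite addrC addKr.
move=> Nv Ns; have vU := U1 _ Nv; set e := v^-1 * D v.
have Ze : lie_ucs j.+1 e := Dv_ucs vU.
have NvZ k w : N w -> N (v + k *: w - 1).
  move=> Nw; rewrite addrAC; apply: idealD => //.
  by rewrite -[w]mul1r scalerAl; apply: idealMl.
(* Polarising the cubic map [x * beta x]; a scalar [t <> 0, 1] separates the two
   mixed terms. *)
have polar w : N w -> lie_ucs j (v * alpha v w + w * beta v).
  move=> Nw; set X := v * alpha v w + w * beta v.
  pose Y := w * alpha v w + v * beta w.
  have Z1 : lie_ucs j (X + Y).
    have -> : X + Y = (v + w) * beta (v + w) - v * beta v - w * beta w.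
      by rewrite gammaD /X /Y; nc_ring.
    have [_ ?] := betaU _ Nv; have [_ ?] := betaN _ Nw.
    have [_ ?] : lie_ucs j (beta (v + w)) /\ lie_ucs j ((v + w) * beta (v + w)).
      by apply: betaU; rewrite -[w]scale1r; apply: NvZ.
    by do 2!apply: lie_ucsB => //.
  have Zt : lie_ucs j (t *: X + t ^+ 2 *: Y).
    have -> : t *: X + t ^+ 2 *: Y = (v + t *: w) * beta (v + t *: w)
       - v * beta v - t ^+ 3 *: (w * beta w).
      rewrite gammaD alphaZ betaZ /X /Y.
      move: (alpha v w) (beta v) (beta w) => al bv bw; rewrite !scalerDr.
      rewrite -!scalerAl -!scalerAr !scalerA -expr2 -exprS.
      by nc_ring.
    have [_ ?] := betaU _ Nv; have [_ ?] := betaN _ Nw.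
    have [_ ?] := betaU _ (NvZ t _ Nw).
    by apply: lie_ucsB; [apply: lie_ucsB|apply: lie_ucsZ].
  have : lie_ucs j ((t ^+ 2 - t) *: X).
    have -> : (t ^+ 2 - t) *: X = t ^+ 2 *: (X + Y) - (t *: X + t ^+ 2 *: Y).
      by clearbody X Y; rewrite scalerBl scalerDr; nc_ring.
    by apply: lie_ucsB => //; apply: lie_ucsZ.
  move=> /(lie_ucsZ (t ^+ 2 - t)^-1); rewrite scalerA mulVf ?scale1r //.
  by rewrite expr2 -[X in _ - X]mulr1 -mulrBr mulf_neq0 // subr_eq0.
have key w : N w -> lie_ucs j (bracket (D v * S w) v).
  move=> Nw; have Nvw : N (v * w) by apply: idealMl.
  have Za : lie_ucs j (alpha v (v * w)).
    have [? _] := betaU _ Nv; have [? _] := betaN _ Nvw.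
    have [? _] : lie_ucs j (beta (v + v * w)) /\ lie_ucs j ((v + v * w) * beta (v + v * w)).
      by apply: betaU; rewrite -[v * w]scale1r; apply: NvZ.
    have -> : alpha v (v * w) = beta (v + v * w) - beta v - beta (v * w).
      by rewrite betaD; nc_ring.
    by do 2!apply: lie_ucsB => //.
  have -> : bracket (D v * S w) v = alpha v (v * w) - (v * alpha v w + w * beta v)
     - bracket (beta v) w.
    have Sw : S w = D w + w by rewrite subrK.
    have Sv : S v = D v + v by rewrite subrK.
    rewrite /alpha DM /beta /bracket; clearbody D S; rewrite Sw Sv.
    by nc_ring.
  have [? _] := betaU _ Nv.
  by apply: lie_ucsB; [apply: lie_ucsB => //; apply: polar|apply: lie_ucs_bracket].
have vs : N (v^-1 * s) by apply: idealMl.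
have -> : bracket (e * s) v = bracket (D v * (v^-1 * s)) v
   + bracket (bracket e (v * (v^-1 * s))) v - v * bracket (bracket e (v^-1 * s)) v * 1.
  rewrite -{1}(mulVKr vU s) -{1}(mulVKr vU (D v)) -/e.
  rewrite mulr1 /bracket; set w := v^-1 * s; clearbody e w.
  by nc_ring.
apply: lie_ucsB; first apply: lie_ucsD.
- have -> : v^-1 * s = S (u^-1 * (v^-1 * s) * u).
    by rewrite /S !mulrA divrr // mul1r mulrK.
  by apply: key; apply: idealMr => //; apply: idealMl.
- exact/lie_ucs_bracket/Ze.
- have := Ze (v^-1 * s); case: (j) => [|j'] Zes.
    by rewrite Zes bracket0l mulr0 mul0r.
  by apply: lie_ucsS; apply: (lie_ucs_mul_bracket Zes); rewrite ?mul1r ?mulr1.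
Qed.

(** [D] kills the centre, so [x] may be moved into [1 + N]. For [D v = v * e], the bracket with [s]
    reduces to brackets of [e] and to [bracket (e * s) v], where [s] is split into a central part
    and a part in [N]. *)
Lemma lie_ucs_conj_derivation x : lie_ucs j.+1 (D x).
Proof.
suff H v : N (v - 1) -> lie_ucs j.+1 (D v).
  have [z zC Nxz] := A_ZN x.
  have -> : D x = D (1 + (x - z)).
    have Dz : D (- z) = 0.
      by rewrite /D Scentral ?subrr // => a; rewrite mulNr mulrN zC.
    by rewrite !DD D1 add0r Dz addr0.
  by apply: H; rewrite addrAC subrr add0r.
move=> Nv s; have vU : v \is a GRing.unit by have := N_unit Nv; rewrite addrC subrK.
have Ze := Dv_ucs vU; set e := v^-1 * D v in Ze.
have -> : bracket (D v) s = bracket e (v * s) + bracket e (bracket s v)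
   - bracket (e * s) v.
  by rewrite -(mulVKr vU (D v)) -/e /bracket; nc_ring.
apply: lie_ucsB; first by apply: lie_ucsD; apply: Ze.
have [z zC Nsz] := A_ZN s.
have -> : bracket (e * s) v = bracket (e * (s - z)) v + z * bracket e v * 1.
  have -> : z * bracket e v = e * z * v - v * (e * z).
    by clearbody e; rewrite /bracket -(zC e) mulrBr (mulrA v) -(zC v) !mulrA.
  by rewrite /bracket; nc_ring.
apply: lie_ucsD; first exact: lie_ucs_conj_derivation1.
by apply: (lie_ucs_mul_bracket Ze); rewrite ?mul1r ?mulr1.
Qed.
End ConjugationDerivation.

(** Conjugated by [u], the commutator of [h] and [v] minus 1 becomes [v^-1 * D v], so the induction
    hypothesis supplies the assumption of [lie_ucs_conj_derivation]. Its conclusion at [x * u] is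
    the bracket of [u - 1] with [x]. *)
Lemma lie_ucs_of_group (N : A -> Prop) (t : F) : ideal N ->
  (forall a, N a -> 1 + a \is a GRing.unit) ->
  (forall a, exists2 z, central z & N (a - z)) -> t != 0 -> t != 1 ->
  forall k (h : units A), group_ucs k h -> lie_ucs k (uval h - 1).
Proof.
move=> iN N_unit A_ZN t0 t1; elim=> [h ->|k IHk h Zh]; first by rewrite subrr.
set u := uval h; have uU : u \is a GRing.unit := uvalP h.
have Dv_ucs v : v \is a GRing.unit -> lie_ucs k (v^-1 * (u * v * u^-1 - v)).
  move=> vU; have uVU : u^-1 \is a GRing.unit by rewrite unitrV.
  have := lie_ucs_conj uVU (IHk _ (Zh (Units vU))); rewrite uvalR -/u /=.
  rewrite invrK mulrBr mulr1 mulrBl divrr // mulVKr // => Z; rewrite mulrBr mulVr //.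
  by rewrite !mulrA in Z *.
have D_ucs x : lie_ucs k (u * x * u^-1 - x).
  (* The skew-derivation lemma starts at level [j.+1]. At level 0, conjugation by [u] fixes all
     units, in particular [1 + N], and it fixes the centre. *)
  case: k {IHk Zh} Dv_ucs => [|j] Dv_ucs; last first.
    exact: (lie_ucs_conj_derivation uU iN N_unit A_ZN t0 t1 Dv_ucs).
  have D0 v : v \is a GRing.unit -> u * v * u^-1 = v.
    move=> vU; have /= /(congr1 ( *%R v)) := Dv_ucs v vU.
    by rewrite mulVKr // mulr0 => /eqP; rewrite subr_eq0 => /eqP.
  have [z zC /N_unit/D0] := A_ZN x; rewrite mulrDr mulrDl mulr1 divrr // => /addrI.
  by rewrite mulrBr mulrBl -zC mulrK // => /addIr -> /=; rewrite subrr.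
move=> x; have -> : bracket (u - 1) x = u * (x * u) * u^-1 - x * u.
  by rewrite mulrA mulrK // /bracket; nc_ring.
exact: D_ucs.
Qed.
End UnitCentralSeries.

Section LowerUpperCentralSeries.
Local Open Scope group_scope.
Variable G : groupType.
Implicit Types x y : G.

Lemma group_ucs1 k : group_ucs k (1 : G).
Proof. by elim: k => [|k IHk] //= y; rewrite comm1g. Qed.

Lemma group_ucsJ k x y : group_ucs k x -> group_ucs k (x ^ y).
Proof.
elim: k x => [x ->|k IHk x Zx z] /=; first by rewrite conj1g.
by rewrite -(conjgKV y z) -conjRg; apply: IHk; apply: Zx.
Qed.

Lemma commMg_conj x y z : [~ x * y, z] = [~ x, z] ^ y * [~ y, z].
Proof. by rewrite /commg /conjg !invMg !mulgA !mulgK. Qed.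

Lemma group_ucsM k x y : group_ucs k x -> group_ucs k y -> group_ucs k (x * y).
Proof.
elim: k x y => [x y -> ->|k IHk x y Zx Zy z] /=; first by rewrite mulg1.
by rewrite commMg_conj; apply: IHk; [apply: group_ucsJ; apply: Zx | apply: Zy].
Qed.

Lemma group_ucsV k x : group_ucs k x -> group_ucs k x^-1.
Proof.
elim: k x => [x ->|k IHk x Zx z] /=; first by rewrite invg1.
have -> : [~ x^-1, z] = [~ x, z]^-1 ^ x^-1.
  apply: (conjg_inj x); apply: (mulIg [~ x, z]).
  by rewrite -commMg_conj mulVg comm1g conjgKV mulVg.
by apply/group_ucsJ/IHk/Zx.
Qed.

(** Moves from generated subgroups to the upper series, where group and algebra are compared element
    by element. The lower term of index [c - i] lies in the upper term of index [i]. *)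
Lemma group_class_le_ucs c : group_class_le G c <-> forall x, group_ucs c x.
Proof.
split=> [Gc x|Zc x].
  suff H i : (i <= c)%N -> forall x, group_lcs (c - i) x -> group_ucs i x.
    by apply: (H c) => //; rewrite subnn.
  elim: i => [_ y|i IHi ic y Ly z]; first by rewrite subn0 => /Gc.
  apply: IHi; first exact: ltnW.
  rewrite -(subnSK ic) /=; apply: subgroup_gen_mem.
  by exists y => //; exists z.
suff H i : (i <= c)%N -> forall x, group_lcs i x -> group_ucs (c - i) x.
  by move=> Lx; have := H c (leqnn c) x Lx; rewrite subnn.
elim: i => [_ y _|i IHi ic y]; first by rewrite subn0.
elim=> {y} [y [x' Lx' [z ->]]||y z _ Zy _ Zz|y _ Zy].
- by have := IHi (ltnW ic) _ Lx'; rewrite -(subnSK ic) => /(_ z).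
- exact: group_ucs1.
- exact: group_ucsM.
- exact: group_ucsV.
Qed.
End LowerUpperCentralSeries.

Lemma lie_class_le_ucs (F : fieldType) (A : algType F) c :
  lie_class_le A c <-> forall a : A, lie_ucs c a.
Proof.
split=> [Ac a|Zc a].
  suff H i : (i <= c)%N -> forall a : A, lie_lcs (c - i) a -> lie_ucs i a.
    by apply: (H c) => //; rewrite subnn.
  elim: i => [_ y|i IHi ic y Ly z]; first by rewrite subn0 => /Ac.
  apply: IHi; first exact: ltnW.
  rewrite -(subnSK ic) /=; apply: subspace_gen_mem.
  by exists y => //; exists z.
suff H i : (i <= c)%N -> forall a : A, lie_lcs i a -> lie_ucs (c - i) a.
  by move=> La; have := H c (leqnn c) a La; rewrite subnn.
elim: i => [_ y _|i IHi ic y]; first by rewrite subn0.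
elim=> {y} [y [x Lx [z ->]]||y z _ Zy _ Zz|k y _ Zy].
- by have := IHi (ltnW ic) _ Lx; rewrite -(subnSK ic) => /(_ z).
- exact: lie_ucs0.
- exact: lie_ucsD.
- exact: lie_ucsZ.
Qed.

(** * Semisimple parts of algebraic elements *)

Section Polynomials.
Variable F : fieldType.
Implicit Types p q g h : {poly F}.

Lemma irreducible_factor p : (1 < size p)%N ->
  exists2 g, irreducible_poly g & g %| p.
Proof.
have [k] := ubnP (size p); elim: k p => // k IHk p; rewrite ltnS => pk p1.
have [irr_p|] := classic (irreducible_poly p); first by exists p.
move=> nirr; have [q [q1 qp npq]] : exists q, [/\ size q != 1%N, q %| p & ~~ (q %= p)].
  apply: NNPP => H; apply: nirr; split=> // q q1 qp; apply/negPn/negP => npq.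
  by apply: H; exists q.
have p0 : p != 0 by rewrite -size_poly_gt0 ltnW.
have q0 : q != 0 by apply: contraTneq qp => ->; rewrite dvd0p.
have qp' : (size q < size p)%N.
  by rewrite ltn_neqAle dvdp_leq // andbT; apply: contra npq; rewrite dvdp_size_eqp.
have [||g irr_g gq] := IHk q.
- exact: leq_trans qp' pk.
- by rewrite ltn_neqAle eq_sym q1 size_poly_gt0.
- by exists g => //; apply: dvdp_trans qp.
Qed.

Lemma separable_polyE p : separable_poly p = coprimep p p^`().
Proof. by rewrite unlock. Qed.

(** An irreducible common factor [g] of [q] and its derivative is separable, hence coprime to its
    own derivative, so [g ^+ 2] divides [q]. Dropping one copy of [g] lowers the size, and [q]
    divides the square of what is left. *)
Lemma separable_radical p : perfect_field F -> p != 0 ->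
  exists q, separable_poly q /\ exists m, p %| q ^+ m.
Proof.
move=> Fp p0.
suff H q m : q != 0 -> p %| q ^+ m ->
    exists q', separable_poly q' /\ exists m', p %| q' ^+ m'.
  by apply: (H p 1%N).
have [k] := ubnP (size q); elim: k q m => // k IHk q m; rewrite ltnS => qk q0 pq.
have [sq|] := boolP (separable_poly q); first by exists q; split=> //; exists m.
rewrite separable_polyE => ncop; have : (1 < size (gcdp q q^`()))%N.
  rewrite ltn_neqAle eq_sym ncop size_poly_gt0 gcdp_eq0 negb_and q0 //.
case/irreducible_factor => g irr_g; rewrite dvdp_gcd => /andP[].
have := Fp g irr_g; rewrite separable_polyE => cop_g /dvdpP[h qE].
rewrite qE derivM dvdp_addr ?dvdp_mulIr // Gauss_dvdpl // => /dvdpP[r hE].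
have [r0 g0] : r != 0 /\ g != 0.
  by move: q0; rewrite qE hE !mulf_eq0 !negb_or -andbA => /and3P[].
have g1 : (1 < size g)%N by case: irr_g.
apply: (IHk (r * g) (m * 2)%N); [|by rewrite mulf_neq0|]; last first.
  apply: (dvdp_trans pq); rewrite mulnC exprM dvdp_exp2r // qE hE expr2.
  by rewrite -(mulrA r g (r * g)) (mulrCA g r g) (mulrA r g g) dvdp_mull.
apply: leq_trans qk; rewrite qE hE [X in (_ < X)%N]size_mul ?mulf_neq0 //.
by case: (size g) g1 => // [] [|s] // _; rewrite addnS /= addnS ltnS leq_addr.
Qed.

Lemma comp_poly_taylor q g h : exists r : {poly F},
  q \Po (g + h) = q \Po g + h * (q^`() \Po g) + h ^+ 2 * r.
Proof.
elim/poly_ind: q => [|q c [r IHq]].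
  by exists 0; rewrite deriv0 !comp_poly0 !mulr0 !addr0.
exists (r * (g + h) + (q^`() \Po g)); rewrite derivMXaddC.
rewrite !comp_polyD !comp_polyM !comp_polyC !comp_polyX IHq.
by ring.
Qed.

(** Newton iteration for a root of [q] starting at ['X]: Bezout makes [v \Po g] an inverse of the
    derivative at [g] modulo [q \Po g], and each correction gains at least one power of [q]. *)
Lemma newton_lift q k : separable_poly q ->
  exists g, q %| g - 'X /\ q ^+ k.+1 %| q \Po g.
Proof.
rewrite separable_polyE => /Bezout_eq1_coprimepP[[u v] /= uv1].
elim: k => [|k [g [qg qkg]]].
  by exists 'X; rewrite subrr dvdp0 comp_polyXr expr1 dvdpp.
pose h := - ((v \Po g) * (q \Po g)); exists (g + h).
have qqg : q %| q \Po g by apply: dvdp_trans qkg; rewrite exprS dvdp_mulr.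
split.
  by rewrite addrAC dvdp_addl // dvdpNr dvdp_mull.
have [r ->] := comp_poly_taylor q g h.
have uvg : (u \Po g) * (q \Po g) + (v \Po g) * (q^`() \Po g) = 1.
  by rewrite -!comp_polyM -comp_polyD uv1 comp_polyC.
have -> : q \Po g + h * (q^`() \Po g) + h ^+ 2 * r =
  (q \Po g) * (q \Po g) * ((u \Po g) + (v \Po g) ^+ 2 * r).
  rewrite /h -[in X in X + _ + _](mulr1 (q \Po g)) -{1}uvg; ring.
by apply: dvdp_mulr; rewrite exprSr dvdp_mul.
Qed.
End Polynomials.

Lemma algebra_char_dichotomy (F : fieldType) (A : algType F) :
  (exists2 p, prime p & p%:R = 0 :> A) \/
  (forall m, (0 < m)%N -> exists v : A, m%:R * v = 1).
Proof.
have [[p]|F0] := classic (exists p, p \in [pchar F]).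
  by case/andP=> p_pr /eqP p0; left; exists p => //; rewrite -scaler_nat p0 scale0r.
right=> m m0; exists ((m%:R : F)^-1%:A).
rewrite mulr_natl -scaler_nat scalerA mulfV ?scale1r //.
have /pcharf0P -> : [pchar F] =i pred0; last by rewrite -lt0n.
by move=> p; apply/negP=> pF; apply: F0; exists p.
Qed.

Section AlgebraicElements.
Variables (F : fieldType) (A : algType F).
Implicit Types (a s x : A) (p q g : {poly F}).

Lemma horner_alg_comp a q g :
  horner_alg a (q \Po g) = horner_alg (horner_alg a g) q.
Proof.
elim/poly_ind: q => [|q c IHq]; first by rewrite comp_poly0 !rmorph0.
by rewrite comp_poly_MXaddC !rmorphD !rmorphM /= IHq !horner_algC horner_algX.
Qed.

Lemma horner_alg_comm a b p : a * b = b * a ->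
  horner_alg a p * b = b * horner_alg a p.
Proof.
move=> ab; elim/poly_ind: p => [|p c IHp]; first by rewrite rmorph0 mul0r mulr0.
rewrite rmorphD rmorphM /= horner_algX horner_algC mulrDl mulrDr.
by rewrite -mulrA ab mulrA IHp mulrA -scalerAl -scalerAr mul1r mulr1.
Qed.

(** For a separable [q] with [q(a)] nilpotent, the Newton lift [g] makes [s = g(a)] an exact root of
    [q], while [a - s] is a multiple of [q(a)]. *)
Lemma jordan_decomposition a : perfect_field F ->
  (exists2 p, p != 0 & horner_alg a p = 0) ->
  exists s q, [/\ separable_poly q, horner_alg s q = 0,
    (exists m, (a - s) ^+ m = 0) & a * s = s * a].
Proof.
move=> F_perfect [p p0 pa].
have [q [sep_q [m pqm]]] := separable_radical F_perfect p0.
have [g [qg qmg]] := newton_lift m sep_q.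
have hz u v : u %| v -> horner_alg a u = 0 -> horner_alg a v = 0.
  by move=> /dvdpP[w ->]; rewrite rmorphM /= => ->; rewrite mulr0.
have qm0 : horner_alg a (q ^+ m) = 0 by apply: hz pa.
exists (horner_alg a g), q; split=> //.
- rewrite -horner_alg_comp; apply: (hz _ _ qmg).
  by rewrite exprS rmorphM /= qm0 mulr0.
- exists m; rewrite -{1}(horner_algX a) -rmorphB -rmorphXn /=.
  by apply: hz qm0; apply: dvdp_exp2r; rewrite -opprB dvdpNr.
- by rewrite horner_alg_comm.
Qed.

Lemma bracket_horner_alg s x p : bracket x s * s = s * bracket x s ->
  bracket x (horner_alg s p) = bracket x s * horner_alg s p^`().
Proof.
move=> xs; elim/poly_ind: p => [|p c IHp].
  by rewrite deriv0 !rmorph0 mulr0 /bracket mulr0 mul0r subrr.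
rewrite derivMXaddC !rmorphD !rmorphM /= horner_algX horner_algC.
rewrite bracketDr bracketMr IHp (_ : bracket x _%:A = 0); last first.
  by rewrite /bracket -scalerAl -scalerAr mul1r mulr1 subrr.
by rewrite addr0 addrC (horner_alg_comm p (esym xs)) [RHS]mulrDr mulrA.
Qed.

(** To first order, bracketing [x] with [q(s) = 0] gives [bracket x s] times [q'(s)], and
    separability makes [q'(s)] invertible. An Engel chain on such an [s] thus collapses from its
    end. *)
Lemma separable_bracket0 s x q : separable_poly q -> horner_alg s q = 0 ->
  bracket (bracket x s) s = 0 -> bracket x s = 0.
Proof.
rewrite separable_polyE => /Bezout_eq1_coprimepP[[u v] /= uv1] qs /bracket_eq0 xs.
have := bracket_horner_alg q xs; rewrite qs {1}/bracket mulr0 mul0r subrr => E.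
rewrite -[bracket x s]mulr1 -(rmorph1 (horner_alg s)) -uv1 rmorphD !rmorphM /=.
rewrite qs mulr0 add0r [horner_alg s v * _]horner_alg_comm ?mulrA -?E ?mul0r //.
by rewrite horner_alg_comm.
Qed.

Lemma engel_separable_central n s q : lie_engel A n ->
  separable_poly q -> horner_alg s q = 0 -> central s.
Proof.
move=> An sep_q qs x; apply/esym/bracket_eq0; move: (An x s).
elim: n {An} => [|n IHn] in x *; first by move=> /= ->; rewrite bracket0l.
rewrite iterSr => /IHn; exact: separable_bracket0 sep_q qs.
Qed.

Lemma engel_central_nilpotent n a : perfect_field F -> algebraic_algebra A ->
  lie_engel A n -> exists z, central z /\ nilpotent_elt (a - z).
Proof.
move=> F_perfect A_alg An.
have [s [q [sep_q qs nil_as _]]] := jordan_decomposition F_perfect (A_alg a).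
by exists s; split=> //; apply: engel_separable_central qs.
Qed.

Section EngelRadical.
Variable n : nat.
Hypothesis An : lie_engel A n.
Local Notation L := (@levitzki_radical A).

Let csL a : L (a * a) -> L a.
Proof. by apply: (engel_semiprime_sq0 An); apply: semiprime_levitzki_radical. Qed.
Let iL : ideal L.
Proof. by have [] := @lnil_levitzki_radical A. Qed.

Lemma engel_nilpotent_levitzki a : nilpotent_elt a <-> L a.
Proof.
split=> [[k ak]|/levitzki_radical_nil //].
by apply: (completely_semiprime_expr iL csL (k := k)); rewrite ak; apply: ideal0.
Qed.

End EngelRadical.
End AlgebraicElements.

(** * Uniform nilpotence *)

Section WordSpans.
Variables (F : fieldType) (A : algType F).
Implicit Types (s w : seq A) (x y z : A).

Lemma subspace_gen_monotone (S S' : A -> Prop) x :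
  (forall y, S y -> subspace_gen S' y) -> subspace_gen S x -> subspace_gen S' x.
Proof.
move=> SS'; elim=> {x} [x /SS' //||x y _ Sx _ Sy|k x _ Sx].
- exact: subspace_gen0.
- exact: subspace_genD.
- exact: subspace_genZ.
Qed.

Lemma subspace_genN (S : A -> Prop) x : subspace_gen S x -> subspace_gen S (- x).
Proof. by rewrite -scaleN1r; apply: subspace_genZ. Qed.

Lemma subspace_gen_linear (S S' : A -> Prop) (f : A -> A) x :
  f 0 = 0 -> (forall y z, f (y + z) = f y + f z) ->
  (forall k y, f (k *: y) = k *: f y) ->
  (forall y, S y -> subspace_gen S' (f y)) ->
  subspace_gen S x -> subspace_gen S' (f x).
Proof.
move=> f0 fD fZ SS'; elim=> {x} [x /SS' //||x y _ Sx _ Sy|k x _ Sx].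
- by rewrite f0; apply: subspace_gen0.
- by rewrite fD; apply: subspace_genD.
- by rewrite fZ; apply: subspace_genZ.
Qed.

Definition word_span s m := subspace_gen
  (fun x : A => exists w, [/\ (m <= size w)%N, {subset w <= s} & x = \prod_(y <- w) y]).

Lemma word_spanM s m n x y :
  word_span s m x -> word_span s n y -> word_span s (m + n) (x * y).
Proof.
move=> Wx Wy; apply: (subspace_gen_linear (f := *%R^~ y)) Wx => /=.
- by rewrite mul0r.
- by move=> a b; rewrite mulrDl.
- by move=> k a; rewrite scalerAl.
move=> _ [w [mw ws ->]]; apply: (subspace_gen_linear (f := *%R _)) Wy => /=.
- by rewrite mulr0.
- by move=> a b; rewrite mulrDr.
- by move=> k a; rewrite scalerAr.
move=> _ [v [nv vs ->]]; apply: subspace_gen_mem; exists (w ++ v); split.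
- by rewrite size_cat leq_add.
- by move=> z; rewrite mem_cat => /orP[/ws|/vs].
- by rewrite big_cat.
Qed.

Lemma word_span_leq s m n x : (m <= n)%N -> word_span s n x -> word_span s m x.
Proof.
move=> mn; apply: subspace_gen_monotone => y [w [nw ws ->]].
by apply: subspace_gen_mem; exists w; split=> //; apply: leq_trans nw.
Qed.

Lemma word_span_mem s x : x \in s -> word_span s 1 x.
Proof.
move=> xs; apply: subspace_gen_mem; exists [:: x]; split=> //.
  by move=> y; rewrite inE => /eqP ->.
by rewrite big_seq1.
Qed.

Lemma word_span1 s : word_span s 0 1.
Proof. by apply: subspace_gen_mem; exists [::]; rewrite big_nil. Qed.

Lemma nil_words_span s : nil_words s ->
  exists m, forall x, word_span s m x -> x = 0.
Proof.
case=> m s0; exists m => x; elim=> {x} [_ [w [mw ws ->]]|//|x y _ -> _ ->|k x _ ->].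
- rewrite -(cat_take_drop m w) big_cat /= s0 ?mul0r ?size_takel //.
  by move=> y /mem_take/ws.
- by rewrite addr0.
- by rewrite scaler0.
Qed.

Lemma nonunital_subalg_word_span s x :
  nonunital_subalg_gen (fun y => y \in s) x -> word_span s 1 x.
Proof.
elim=> {x} [x|||k x _|x y _ Wx _ Wy]; first exact: word_span_mem.
- exact: subspace_gen0.
- by move=> x y _ ? _ ?; apply: subspace_genD.
- exact: subspace_genZ.
- by apply: (@word_span_leq s 1 (1 + 1)) => //; apply: word_spanM.
Qed.

Lemma nil_words_nilpotent_subalg s : nil_words s ->
  nilpotent_subalg (nonunital_subalg_gen (fun y => y \in s)).
Proof.
move=> /nil_words_span[m s0]; exists m.+1 => // f Bf; apply: s0.
apply: (@word_span_leq s m m.+1) => //.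
elim: m.+1 f Bf => [|k IHk] f Bf; first by rewrite big_ord0; apply: word_span1.
have Wk := IHk (fun i => f (widen_ord (leqnSn k) i)) (fun i => Bf _).
have := word_spanM Wk (nonunital_subalg_word_span (Bf ord_max)).
by rewrite addn1 big_ord_recr.
Qed.

Lemma engel_nilpotents n : lie_engel A n ->
  two_sided_ideal (@nilpotent_elt F A) /\ locally_nilpotent (@nilpotent_elt F A).
Proof.
move=> An; have NL a := engel_nilpotent_levitzki An a.
have [iL nL] := lnil_levitzki_radical A; split.
  split.
  - by exists 1%N; rewrite expr1.
  - by move=> x y /NL Lx /NL Ly; apply/NL; apply: idealD.
  - move=> k x /NL Lx; apply/NL; rewrite -[x]mul1r scalerAl; exact: idealMl.
  - by move=> a x /NL Lx; split; apply/NL; [apply: idealMl|apply: idealMr].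
by move=> s Ns; apply/nil_words_nilpotent_subalg/nL => x /Ns/NL.
Qed.
End WordSpans.

Section UniformNilpotence.
Variables (F : fieldType) (A : algType F) (n : nat).
Hypothesis An : lie_engel A n.

(** Longer iterations vanish by the Engel identity, so both counters stop at [n], and the list has a
    length independent of [s] and [u]. *)
Definition basic_brackets (R : pzRingType) (s u : R) :=
  [seq iter j ((@bracket R)^~ u) (iter i ((@bracket R)^~ s) (bracket s u)) |
    i <- iota 0 n, j <- iota 0 n].

Local Notation sequences := [the pzRingType of (nat -> A)%type].

Lemma iter_bracket_fun (k i : nat) (f g : sequences) :
  iter i ((@bracket sequences)^~ g) f k = iter i ((@bracket A)^~ (g k)) (f k).
Proof. by elim: i => //= i <-. Qed.

Lemma basic_brackets_lift (R R' : pzRingType) (ev : R -> R') (s u : R) (w : seq R') :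
  (forall x y, ev (x - y) = ev x - ev y) ->
  (forall x y, ev (x * y) = ev x * ev y) -> ev 1 = 1 ->
  {subset w <= basic_brackets (ev s) (ev u)} ->
  exists v, [/\ size v = size w, {subset v <= basic_brackets s u} &
    \prod_(x <- w) x = ev (\prod_(x <- v) x)].
Proof.
move=> evB evM ev1; elim: w => [|x w IHw] ws.
  by exists [::]; rewrite !big_nil ev1.
have [|v [sv vs vE]] := IHw; first by move=> y yw; apply: ws; rewrite inE yw orbT.
have /allpairsP[[i j] /= [Ii Ij xE]] := ws x (mem_head _ _).
exists (iter j ((@bracket R)^~ u) (iter i ((@bracket R)^~ s) (bracket s u)) :: v).
split; first by rewrite /= sv.
  move=> y; rewrite inE => /predU1P[->|/vs //].
  by apply/allpairsP; exists (i, j).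
have evb y z : ev (bracket y z) = bracket (ev y) (ev z) by rewrite evB !evM.
rewrite !big_cons evM vE xE; congr (_ * _).
have evi m y z : ev (iter m ((@bracket R)^~ z) y) = iter m ((@bracket R')^~ (ev z)) (ev y).
  by elim: m => //= m <-.
by rewrite !evi evb.
Qed.

(* The bound is uniform because Engel identities pass to the ring of sequences. *)
Lemma engel_uniform_nilpotence :
  exists b, forall (s u : A) w, size w = b ->
    {subset w <= basic_brackets s u} -> \prod_(x <- w) x = 0.
Proof.
apply: NNPP => H.
(* For each length a pair with a nonzero word of that length is chosen; together the pairs form two
   elements of the ring of sequences. *)
have {}H b : exists suw : A * A * seq A, [/\ size suw.2 = b,
    {subset suw.2 <= basic_brackets suw.1.1 suw.1.2} & \prod_(x <- suw.2) x <> 0].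
  apply: NNPP => Hb; apply: H; exists b => s u w sw ws.
  by apply: NNPP => w0; apply: Hb; exists (s, u, w).
have [f Hf] := boolp.choice H.
pose s (i : nat) := (f i).1.1; pose u (i : nat) := (f i).1.2.
pose R : pzRingType := sequences.
have Rn : lie_engel R n.
  by move=> x y; apply: boolp.funext => i; rewrite iter_bracket_fun An.
have Rchar : (exists2 p, prime p & p%:R = 0 :> R) \/
    (forall m, (0 < m)%N -> exists v : R, m%:R * v = 1).
  have natE m i : (m%:R : R) i = m%:R by elim: m => // m; rewrite !mulrS => <-.
  case: (algebra_char_dichotomy A) => [[p p_pr p0]|A0]; [left|right].
    by exists p => //; apply: boolp.funext => i; rewrite natE.
  move=> m /A0[v mv]; exists (fun=> v); apply: boolp.funext => i.
  by rewrite -[LHS]/((m%:R : R) i * v) natE.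
have [iL nL] := lnil_levitzki_radical R.
have [|m Hm] := nL (basic_brackets (s : R) (u : R)).
  move=> _ /allpairsP[[i j] /= [_ _ ->]].
  do 2!apply: ideal_iter_bracket => //.
  apply: (completely_semiprime_bracket Rn iL) => // a.
  by apply: (engel_semiprime_sq0 Rn); apply: semiprime_levitzki_radical.
(* The length [m] valid for sequences is tested at component [m], where a nonzero word of that very
   length was stored. *)
have [sw ws []] := Hf m.
have [||||v [sv vs ->]] :=
  @basic_brackets_lift R A (fun x => x m) s u (f m).2 => //.
by rewrite Hm // sv.
Qed.
End UniformNilpotence.

(** * Commutators of units in a Lie Engel algebra *)

Section TwoGenerators.
Variables (F : fieldType) (A : unitAlgType F) (n : nat).
Hypothesis An : lie_engel A n.
Variables s u : A.
Implicit Types (a b g r x y z : A).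
Local Notation c := (bracket s u).
Local Notation ad y := ((@bracket A)^~ y).

Inductive subalg : A -> Prop :=
| SubalgScal k : subalg k%:A
| SubalgL : subalg s
| SubalgR : subalg u
| SubalgD x y of subalg x & subalg y : subalg (x + y)
| SubalgM x y of subalg x & subalg y : subalg (x * y).

Lemma subalgZ k x : subalg x -> subalg (k *: x).
Proof.
move=> Rx; rewrite -[X in k *: X]mul1r scalerAl.
by apply: SubalgM => //; apply: SubalgScal.
Qed.
Lemma subalg1 : subalg 1. Proof. by rewrite -(scale1r 1); apply: SubalgScal. Qed.
Lemma subalg0 : subalg 0. Proof. by rewrite -(scale0r 1); apply: SubalgScal. Qed.
Lemma subalgN x : subalg x -> subalg (- x).
Proof. by rewrite -scaleN1r; apply: subalgZ. Qed.
Lemma subalgB x y : subalg x -> subalg y -> subalg (x - y).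
Proof. by move=> Rx Ry; apply: SubalgD => //; apply: subalgN. Qed.
Lemma subalgX x k : subalg x -> subalg (x ^+ k).
Proof.
move=> Rx; elim: k => [|k IHk]; first exact: subalg1.
by rewrite exprS; apply: SubalgM.
Qed.

Lemma subalg_bracket x y : subalg x -> subalg y -> subalg (bracket x y).
Proof. by move=> Rx Ry; apply: subalgB; apply: SubalgM. Qed.

(** The [i]-th power of the ideal of [subalg] generated by [c], built by adjoining one factor [c] at
    a time on the right. *)
Fixpoint cpow i : A -> Prop :=
  if i is i'.+1 then
    subspace_gen (fun z => exists a r, [/\ cpow i' a, subalg r & z = a * c * r])
  else subalg.
Local Notation J := cpow.

Lemma cpowD i x y : J i x -> J i y -> J i (x + y).
Proof. by case: i => [|i] /=; [apply: SubalgD | apply: subspace_genD]. Qed.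
Lemma cpowZ i k x : J i x -> J i (k *: x).
Proof. by case: i => [|i] /=; [apply: subalgZ | apply: subspace_genZ]. Qed.
Lemma cpow0 i : J i 0.
Proof. by case: i => [|i] /=; [apply: subalg0 | apply: subspace_gen0]. Qed.
Lemma cpowN i x : J i x -> J i (- x).
Proof. by rewrite -scaleN1r; apply: cpowZ. Qed.
Lemma cpowB i x y : J i x -> J i y -> J i (x - y).
Proof. by move=> Jx Jy; apply: cpowD => //; apply: cpowN. Qed.

Lemma cpow_mem i a r : J i a -> subalg r -> J i.+1 (a * c * r).
Proof. by move=> Ja Rr; apply: subspace_gen_mem; exists a, r. Qed.

Lemma cpowMr i a r : J i a -> subalg r -> J i (a * r).
Proof.
case: i => [|i] Ja Rr; first exact: SubalgM.
apply: (subspace_gen_linear (f := *%R^~ r)) Ja => /=.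
- by rewrite mul0r.
- by move=> y z; rewrite mulrDl.
- by move=> k y; rewrite scalerAl.
by move=> _ [a' [r' [Ja' Rr' ->]]]; rewrite -(mulrA (a' * c));
    apply: (@cpow_mem i) => //; apply: SubalgM.
Qed.

Lemma cpowM i j a b : J i a -> J j b -> J (i + j) (a * b).
Proof.
move=> Ja; elim: j b => [|j IHj] b Jb; first by rewrite addn0; apply: cpowMr.
rewrite addnS; apply: (subspace_gen_linear (f := *%R a)) Jb => /=.
- by rewrite mulr0.
- by move=> y z; rewrite mulrDr.
- by move=> k y; rewrite scalerAr.
by move=> _ [b' [r [Jb' Rr ->]]]; rewrite !mulrA;
    apply: (@cpow_mem (i + j)) => //; apply: IHj.
Qed.

Lemma cpowMl i r a : subalg r -> J i a -> J i (r * a).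
Proof. by move=> Rr Ja; apply: (@cpowM 0 i). Qed.

Lemma cpowS i a : J i.+1 a -> J i a.
Proof.
elim: i a => [|i IHi] a /=.
  elim=> {a} [_ [a [r [Ra Rr ->]]]||x y _ Rx _ Ry|k x _ Rx].
  - by do 2!apply: SubalgM => //; apply: subalg_bracket; constructor.
  - exact: subalg0.
  - exact: SubalgD.
  - exact: subalgZ.
apply: subspace_gen_monotone => _ [a' [r [Ja' Rr ->]]].
by apply: (@cpow_mem i) => //; apply: IHi.
Qed.

Lemma cpow_leq i j a : (i <= j)%N -> J j a -> J i a.
Proof.
by move=> ij; rewrite -(subnK ij); elim: (j - i)%N => // k IHk /cpowS/IHk.
Qed.

Lemma cpow_bracket i a r : J i a -> subalg r -> J i (bracket a r).
Proof. by move=> Ja Rr; apply: cpowB; [apply: cpowMr|apply: cpowMl]. Qed.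

Lemma cpow1_bracket x y : subalg x -> subalg y -> J 1 (bracket x y).
Proof.
have Jc : J 1 c by rewrite -[c]mul1r -[1 * c]mulr1; apply: (@cpow_mem 0); apply: subalg1.
have Jcomm x' y' : x' * y' = y' * x' -> J 1 (bracket x' y').
  by move/bracket_eq0->; apply: cpow0.
have anti x' y' : bracket x' y' = - bracket y' x' by rewrite /bracket opprB.
move=> Rx; elim=> {y} [k|||y z _ Jy _ Jz|y z Ry Jy Rz Jz].
- by apply: Jcomm; rewrite -scalerAl -scalerAr mul1r mulr1.
- rewrite anti; apply: cpowN; elim: Rx => {x} [k|||x z _ Jx _ Jz|x z Rx Jx Rz Jz].
  + by apply: Jcomm; rewrite -scalerAl -scalerAr mul1r mulr1.
  + exact: Jcomm.
  + exact: Jc.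
  + by rewrite bracketDr; apply: cpowD.
  + by rewrite bracketMr; apply: cpowD; [apply: cpowMr|apply: cpowMl].
- rewrite anti; apply: cpowN; elim: Rx => {x} [k|||x z _ Jx _ Jz|x z Rx Jx Rz Jz].
  + by apply: Jcomm; rewrite -scalerAl -scalerAr mul1r mulr1.
  + by rewrite anti; apply: cpowN.
  + exact: Jcomm.
  + by rewrite bracketDr; apply: cpowD.
  + by rewrite bracketMr; apply: cpowD; [apply: cpowMr|apply: cpowMl].
- by rewrite bracketDr; apply: cpowD.
- by rewrite bracketMr; apply: cpowD; [apply: cpowMr|apply: cpowMl].
Qed.

Lemma cpow_bracket2 i a x y : J i a -> subalg x -> subalg y ->
  J i.+1 (bracket a (bracket x y)).
Proof.
move=> Ja Rx Ry; have Jxy := cpow1_bracket Rx Ry.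
apply: cpowB; last exact: (cpowM Jxy Ja).
by rewrite -addn1; apply: cpowM.
Qed.

Local Notation Gamma := (basic_brackets n s u).

(** The left [subalg]-span of words of length [i] in the basic brackets. Coefficients stand on the
    left only; that [cpow i] is still reached modulo [cpow i.+1] is shown in [cpow_gmod]. *)
Fixpoint gpow i : A -> Prop :=
  if i is i'.+1 then
    subspace_gen (fun z => exists a g, [/\ gpow i' a, g \in Gamma & z = a * g])
  else subalg.

Lemma gpowD i x y : gpow i x -> gpow i y -> gpow i (x + y).
Proof. by case: i => [|i] /=; [apply: SubalgD | apply: subspace_genD]. Qed.
Lemma gpowZ i k x : gpow i x -> gpow i (k *: x).
Proof. by case: i => [|i] /=; [apply: subalgZ | apply: subspace_genZ]. Qed.
Lemma gpow0 i : gpow i 0.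
Proof. by case: i => [|i] /=; [apply: subalg0 | apply: subspace_gen0]. Qed.

Lemma cpow1_iter x y i : subalg y -> J 1 x -> J 1 (iter i (ad y) x).
Proof. by move=> Ry Jx; elim: i => [//|i IHi]; exact: (@cpow_bracket 1). Qed.

Lemma basic_bracket_cpow1 i j : J 1 (iter j (ad u) (iter i (ad s) c)).
Proof.
by do 2![apply: cpow1_iter; first by constructor]; apply: cpow1_bracket; constructor.
Qed.

Lemma gpow_cpow i x : gpow i x -> J i x.
Proof.
elim: i x => [//|i IHi] x; elim=> {x} [_ [a [g [Ga Gg ->]]]||x y _ Jx _ Jy|k x _ Jx].
- have /allpairsP[[k l] /= [_ _ ->]] := Gg.
  by have := cpowM (IHi _ Ga) (basic_bracket_cpow1 k l); rewrite addn1.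
- exact: cpow0.
- exact: cpowD.
- exact: cpowZ.
Qed.

Definition gmod i x := exists2 g, gpow i g & J i.+1 (x - g).

Lemma gmodD i x y : gmod i x -> gmod i y -> gmod i (x + y).
Proof.
move=> [g Gg Jg] [h Gh Jh]; exists (g + h); first exact: gpowD.
by rewrite opprD addrACA; apply: cpowD.
Qed.
Lemma gmodZ i k x : gmod i x -> gmod i (k *: x).
Proof.
move=> [g Gg Jg]; exists (k *: g); first exact: gpowZ.
by rewrite -scalerBr; apply: cpowZ.
Qed.
Lemma gmodJ i x : J i.+1 x -> gmod i x.
Proof. by exists 0; [apply: gpow0 | rewrite subr0]. Qed.
Lemma gmod_gpow i x : gpow i x -> gmod i x.
Proof. by exists x => //; rewrite subrr; apply: cpow0. Qed.

Lemma gmod1Ml r x : subalg r -> gmod 1 x -> gmod 1 (r * x).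
Proof.
move=> Rr [g Gg Jg]; exists (r * g); last by rewrite -mulrBr; apply: cpowMl.
apply: (subspace_gen_linear (f := *%R r)) Gg => /=.
- by rewrite mulr0.
- by move=> y z; rewrite mulrDr.
- by move=> k y; rewrite scalerAr.
move=> _ [a [h [Ra Gh ->]]]; apply: subspace_gen_mem; exists (r * a), h.
by rewrite mulrA; split=> //; apply: SubalgM.
Qed.

Lemma gmod_basic_bracket i j : gmod 1 (iter j (ad u) (iter i (ad s) c)).
Proof.
have ad0 k y : iter k (ad y) 0 = 0 by elim: k => //= k ->; rewrite bracket0l.
have An' m x y : (n <= m)%N -> iter m (ad y) x = 0.
  by move=> nm; rewrite -(subnK nm) iterD An ad0.
have [ni|ni] := leqP n i; first by rewrite (An' i) // ad0; apply/gmodJ/cpow0.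
have [nj|nj] := leqP n j; first by rewrite An' //; apply/gmodJ/cpow0.
apply: gmod_gpow; apply: subspace_gen_mem.
exists 1, (iter j (ad u) (iter i (ad s) c)); rewrite mul1r; split=> //.
  exact: subalg1.
by apply/allpairsP; exists (i, j); rewrite !mem_iota /= !add0n.
Qed.

(** The derivations by [s] and [u] commute up to the derivation by [c], which raises the ideal
    power. So the list is stable under both modulo [cpow 2], although it applies [s] before [u]. *)
Lemma gmod_basic_bracket_s i j :
  gmod 1 (bracket (iter j (ad u) (iter i (ad s) c)) s).
Proof.
suff E : J 2 (bracket (iter j (ad u) (iter i (ad s) c)) s - iter j (ad u) (iter i.+1 (ad s) c)).
  rewrite -[X in gmod 1 X](subrK (iter j (ad u) (iter i.+1 (ad s) c))).
  by apply: gmodD; [apply: gmodJ|apply: gmod_basic_bracket].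
elim: j => [|j IHj]; first by rewrite subrr; apply: cpow0.
rewrite [iter j.+1 _ _]iterS [iter j.+1 _ _]iterS.
set x := iter j _ _ in IHj *; set y := iter j _ _ in IHj *.
have -> : bracket (bracket x u) s - bracket y u =
   bracket (bracket x s - y) u - bracket x c by rewrite /bracket; nc_ring.
apply: cpowB; first by apply: cpow_bracket => //; constructor.
by apply: cpow_bracket2; [apply: basic_bracket_cpow1|constructor|constructor].
Qed.

Lemma gmod1Mr r x : subalg r -> gmod 1 x -> gmod 1 (x * r).
Proof.
have step t : subalg t -> (forall i j, gmod 1 (bracket (iter j (ad u) (iter i (ad s) c)) t)) ->
    forall y, gmod 1 y -> gmod 1 (y * t).
  move=> Rt Gt y [g Gg Jg]; rewrite -(subrK g y) mulrDl.
  apply: gmodD; first by apply: gmodJ; apply: cpowMr.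
  elim: Gg => {g Jg} [_ [a [h [Ra Gh ->]]]||g h _ Gg _ Gh|k g _ Gg].
  - rewrite -mulrA; apply: gmod1Ml => //.
    have /allpairsP[[i j] /= [_ _ hE]] := Gh.
    rewrite -(subrK (t * h) (h * t)); apply: gmodD; first by rewrite hE; apply: Gt.
    by apply: gmod1Ml => //; rewrite hE; apply: gmod_basic_bracket.
  - by rewrite mul0r; apply/gmodJ/cpow0.
  - by rewrite mulrDl; apply: gmodD.
  - by rewrite -scalerAl; apply: gmodZ.
move=> Rr; elim: Rr x => {r} [k|||r t _ IHr _ IHt|r t _ IHr _ IHt] x Gx.
- by rewrite -scalerAr mulr1; apply: gmodZ.
- by apply: step Gx; [constructor|move=> i j; apply: gmod_basic_bracket_s].
- by apply: step Gx; [constructor|move=> i j; apply: (gmod_basic_bracket i j.+1)].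
- by rewrite mulrDr; apply: gmodD; [apply: IHr|apply: IHt].
- by rewrite mulrA; apply/IHt/IHr.
Qed.

(** Coefficients are moved to the left across the factors one by one; each move costs a bracket with
    a generator, which is again basic modulo a deeper power. *)
Lemma cpow_gmod i x : J i x -> gmod i x.
Proof.
elim: i x => [|i IHi] x; first exact: (@gmod_gpow 0).
elim=> {x} [_ [a [r [Ja Rr ->]]]||x y _ Gx _ Gy|k x _ Gx]; last 1 first.
- exact: gmodZ.
- have [g Gg Jg] := IHi _ Ja.
  have -> : a * c * r = (a - g) * c * r + g * (c * r) by move: (c) => d; nc_ring.
  apply: gmodD.
    apply: gmodJ; apply: (@cpowMr i.+2) => //; rewrite -[_ * c]mulr1.
    by apply: (@cpow_mem i.+1) => //; apply: subalg1.
  have [h Gh Jh] : gmod 1 (c * r).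
    by apply: gmod1Mr => //; apply: (gmod_basic_bracket 0 0).
  rewrite -(subrK h (c * r)) mulrDr; apply: gmodD.
    by apply: gmodJ; have := cpowM (gpow_cpow Gg) Jh; rewrite addn2.
  elim: Gh => {h Jh} [_ [b [h [Rb Gh ->]]]||h h' _ G1 _ G2|k h _ G1].
  + have [g' Gg' Jg'] : gmod i (g * b).
      by apply: IHi; apply: cpowMr => //; apply: gpow_cpow.
    rewrite mulrA -(subrK g' (g * b)) mulrDl; apply: gmodD.
      apply: gmodJ; have /allpairsP[[k l] /= [_ _ ->]] := Gh.
      by have := cpowM Jg' (basic_bracket_cpow1 k l); rewrite addn1.
    by apply: gmod_gpow; apply: subspace_gen_mem; exists g', h.
  + by rewrite mulr0; apply/gmodJ/cpow0.
  + by rewrite mulrDr; apply: gmodD.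
  + by rewrite -scalerAr; apply: gmodZ.
- exact/gmodJ/cpow0.
- exact: gmodD.
Qed.

Lemma gpow_words i x : gpow i x -> subspace_gen
  (fun z => exists r w, [/\ size w = i, {subset w <= Gamma} & z = r * \prod_(y <- w) y]) x.
Proof.
elim: i x => [|i IHi] x /=.
  move=> _; apply: subspace_gen_mem; exists x, [::]; rewrite big_nil mulr1; split=> //.
apply: subspace_gen_monotone => _ [a [g [/IHi Wa Gg ->]]].
apply: (subspace_gen_linear (f := *%R^~ g)) Wa => /=.
- by rewrite mul0r.
- by move=> y z; rewrite mulrDl.
- by move=> k y; rewrite scalerAl.
move=> _ [r [w [sw ws ->]]]; apply: subspace_gen_mem; exists r, (rcons w g).
split; first by rewrite size_rcons sw.
  by move=> y; rewrite mem_rcons inE => /predU1P[->|/ws].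
by rewrite -cats1 big_cat big_seq1 mulrA.
Qed.

Lemma cpow_word_span i x : J i x -> word_span [:: s; u] i x.
Proof.
have R0 r : subalg r -> word_span [:: s; u] 0 r.
  elim=> {r} [k|||x' y _ Wx _ Wy|x' y _ Wx _ Wy].
  - by apply: subspace_genZ; apply: word_span1.
  - by apply: (@word_span_leq _ _ _ 0 1) => //; apply: word_span_mem; rewrite inE eqxx.
  - by apply: (@word_span_leq _ _ _ 0 1) => //; apply: word_span_mem; rewrite !inE eqxx orbT.
  - exact: subspace_genD.
  - exact: (word_spanM Wx Wy).
elim: i x => [|i IHi] x; first exact: R0.
elim=> {x} [_ [a [r [/IHi Wa /R0 Wr ->]]]||x y _ Wx _ Wy|k x _ Wx].
- have Wc : word_span [:: s; u] 1 c.
    have ws : word_span [:: s; u] 1 s by apply: word_span_mem; rewrite inE eqxx.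
    have wu : word_span [:: s; u] 1 u by apply: word_span_mem; rewrite !inE eqxx orbT.
    apply: (@word_span_leq _ _ _ 1 (1 + 1)) => //.
    by apply: subspace_genD; [|apply: subspace_genN]; apply: word_spanM.
  by have := word_spanM (word_spanM Wa Wc) Wr; rewrite addn0 addn1.
- exact: subspace_gen0.
- exact: subspace_genD.
- exact: subspace_genZ.
Qed.

(** Since words of length [b] in the basic brackets vanish, [cpow b] is contained in all later
    powers, hence in spans of arbitrarily long words in [s] and [u]. The nilpotency bound of the
    pair does not enter the conclusion. *)
Lemma cpow_eq0 (b : nat) : nil_words [:: s; u] ->
  (forall w, size w = b -> {subset w <= Gamma} -> \prod_(x <- w) x = 0) ->
  forall x, J b x -> x = 0.
Proof.
move=> /nil_words_span[m su0] b0.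
have JbS x : J b x -> J b.+1 x.
  move=> /cpow_gmod[g /gpow_words Wg]; suff -> : g = 0 by rewrite subr0.
  elim: Wg => {x g} [_ [r [w [sw ws ->]]]|//|x y _ -> _ ->|k x _ ->].
  - by rewrite b0 // mulr0.
  - by rewrite addr0.
  - by rewrite scaler0.
have JbD k x : J b x -> J (b + k) x.
  elim: k x => [|k IHk] x; first by rewrite addn0.
  move=> /JbS; rewrite addnS; apply: subspace_gen_monotone => _ [a [r [/IHk Ja Rr ->]]].
  exact: (@cpow_mem (b + k)).
move=> x /(JbD m)/cpow_word_span Wx; apply: su0.
by apply: word_span_leq Wx; rewrite leq_addl.
Qed.

Section UnitCommutators.
Variable b : nat.
Hypothesis su0 : nil_words [:: s; u].
Hypothesis b0 : forall w, size w = b -> {subset w <= Gamma} -> \prod_(x <- w) x = 0.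
Variables X Y : units A.
Hypotheses (XE : uval X = 1 + s) (YE : uval Y = 1 + u).

Lemma subalg_inv_1D a : subalg a -> nilpotent_elt a -> subalg (1 + a)^-1.
Proof.
move=> Ra [m am]; have aU : 1 + a \is a GRing.unit by apply: unitr_1Dnil; exists m.
have -> : (1 + a)^-1 = \sum_(i < m) (- a) ^+ i.
  by rewrite -[RHS](mulKr aU) mulr_1Dnil // mulr1.
elim/big_ind: _ => [||i _]; [exact: subalg0|exact: SubalgD|].
exact/subalgX/subalgN.
Qed.

Lemma cpow1_nilpotent a : J 1 a -> nilpotent_elt a.
Proof.
move=> Ja; exists b; apply: (cpow_eq0 su0 b0).
elim: (b) => [|i IHi]; first exact: subalg1.
by have := cpowM IHi Ja; rewrite addn1 -exprSr.
Qed.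

Lemma generator_nilpotent x : x \in [:: s; u] -> nilpotent_elt x.
Proof.
have [m m0] := nil_words_span su0 => xsu; exists m; apply: m0.
elim: (m) => [|i IHi]; first exact: word_span1.
by have := word_spanM IHi (word_span_mem xsu); rewrite addn1 -exprSr.
Qed.

Lemma subalg_Vy : subalg (uval Y)^-1.
Proof.
rewrite YE; apply: subalg_inv_1D; first by constructor.
by apply: generator_nilpotent; rewrite !inE eqxx orbT.
Qed.

Local Notation f := (fun z : units A => [~ z, Y]%g).
Local Notation D := (fun a => (uval Y)^-1 * bracket a u).

Lemma commutator_1D h : uval (f h) - 1 = (uval h)^-1 * D (uval h - 1).
Proof.
rewrite uvalR; have -> : bracket (uval h - 1) u = uval h * uval Y - uval Y * uval h.
  by rewrite YE /bracket; nc_ring.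
by rewrite !mulrBr [(uval Y)^-1 * (uval Y * _)]mulrA uvalVK mul1r uvalVK.
Qed.

(** Commutation with [Y] differs from the linear operator [D] by a term quadratic in [uval h - 1],
    which lies at least one ideal power deeper. *)
Lemma commutator_cpow i h k : J i.+1 (uval h - 1) ->
  J i.+1 (uval (iter k f h) - 1) /\ J i.+2 (uval (iter k f h) - 1 - iter k D (uval h - 1)).
Proof.
move=> Jh; have JD j a : J j a -> J j (D a).
  by move=> Ja; apply: cpowMl; [apply: subalg_Vy|apply: cpow_bracket => //; constructor].
elim: k => [|k [IH1 IH2]]; first by split=> //; rewrite subrr; apply: cpow0.
rewrite !iterS; set hk := iter k f h in IH1 IH2 *; set a := uval hk - 1 in IH1 IH2.
have Rhk : subalg (uval hk)^-1.
  have Ja : J 1 a by apply: cpow_leq IH1.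
  rewrite -[uval hk](subrK 1) addrC -/a.
  by apply: subalg_inv_1D; [apply: (@cpowS 0)|apply: cpow1_nilpotent].
rewrite commutator_1D -/a; split; first by apply: cpowMl => //; apply: JD.
have -> : (uval hk)^-1 * D a - D (iter k D (uval h - 1)) =
   D (a - iter k D (uval h - 1)) - (uval hk)^-1 * (a * D a).
  have -> : (uval hk)^-1 * (a * D a) = D a - (uval hk)^-1 * D a.
    by rewrite {1}/a mulrA mulrBr uvalVK mulr1 mulrBl mul1r.
  by rewrite /bracket; nc_ring.
apply: cpowB; first exact: JD.
apply: cpowMl => //; have := cpowM IH1 (JD _ _ IH1).
by apply: cpow_leq; rewrite addSnnS leq_addl.
Qed.

(** [D] is the bracket with [u] times a unit commuting with [u], so its [n]-th iterate is zero and
    [n] commutators gain one power. The first commutator enters [cpow 1]; the other [n * b] reach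
    [cpow b.+1]. *)
Lemma commutator_engel : iter (n * b).+1 f X = 1%g.
Proof.
have iterDE k a : iter k D a = (uval Y)^-1 ^+ k * iter k (ad u) a.
  elim: k => [|k IHk]; first by rewrite mul1r.
  have Vyu : GRing.comm u ((uval Y)^-1 ^+ k).
    apply/commrX/commrV; rewrite YE; apply: commrD; [exact: commr1|by []].
  by rewrite !iterS IHk exprS -mulrA bracketMl (_ : bracket (_ ^+ _) u = 0) ?mul0r ?addr0 //;
     apply/bracket_eq0/esym.
have Jk k : J k.+1 (uval (iter (n * k).+1 f X) - 1).
  elim: k => [|k IHk].
    rewrite muln0 /= commutator_1D.
    have -> : bracket (uval X - 1) u = c by rewrite XE /bracket; nc_ring.
    apply: (@cpowMl 1); last apply: (@cpowMl 1 _ _ subalg_Vy).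
      rewrite XE; apply: subalg_inv_1D; first by constructor.
      by apply: generator_nilpotent; rewrite !inE eqxx.
    by apply: cpow1_bracket; constructor.
  have [_] := commutator_cpow n IHk.
  by rewrite iterDE An mulr0 subr0 -iterD mulnS addnS.
apply: uval_inj; apply/eqP; rewrite -subr_eq0; apply/eqP.
by apply: (cpow_eq0 su0 b0); apply: cpowS.
Qed.
End UnitCommutators.
End TwoGenerators.

(** Every unit is a central unit times [1 + s] with [s] nilpotent, and central factors disappear
    from commutators. What remains are pairs of nilpotent elements, which lie in the radical. *)
Lemma engel_unit_group (F : fieldType) (A : unitAlgType F) n :
  perfect_field F -> algebraic_algebra A -> lie_engel A n ->
  bounded_engel_group (units A).
Proof.
move=> F_perfect A_alg An'.
have An : lie_engel A n.+1 by apply: lie_engel_leq An'.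
have [b b0] := engel_uniform_nilpotence An.
exists (n.+1 * b).+1 => // x y.
have decomp (v : units A) : exists z (s : A) (w : units A),
    [/\ central z, nilpotent_elt s, uval w = 1 + s & uval v = z * uval w].
  have [z [zC [m vm]]] := engel_central_nilpotent (uval v) F_perfect A_alg An.
  pose e := uval v - z; have ve : GRing.comm (uval v) e.
    by apply: commrB => //; apply/esym/zC.
  have zU : z \is a GRing.unit.
    have -> : z = uval v * (1 + (uval v)^-1 * - e).
      by rewrite mulrDr mulr1 mulVKr ?uvalP // /e opprB addrCA subrr addr0.
    rewrite unitrMr ?uvalP //; apply: unitr_1Dnil; exists m.
    rewrite exprMn_comm; last by apply/commr_sym/commrV/commr_sym/commrN.
    by rewrite [(- e) ^+ m]exprNn vm !mulr0.
  have zeC : GRing.comm z^-1 e by apply/commr_sym/commrV/esym/zC.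
  have sN : nilpotent_elt (z^-1 * e) by exists m; rewrite exprMn_comm // vm mulr0.
  exists z, (z^-1 * e), (Units (unitr_1Dnil sN)); split=> //=.
  by rewrite mulrDr mulr1 mulVKr // addrC subrK.
have [z [s [x' [zC sN x'E xE]]]] := decomp x.
have [z' [u [y' [z'C uN y'E yE]]]] := decomp y.
have UC (v w v' : units A) z0 : central z0 -> uval v = z0 * uval w -> [~ v, v']%g = [~ w, v']%g.
  move=> z0C vE; have z0U : z0 \is a GRing.unit.
    by rewrite -[z0](mulrK (uvalP w)) -vE unitrMr ?unitrV ?uvalP.
  apply: uval_inj; rewrite !uvalR vE invrM ?uvalP //.
  rewrite -[z0 * _ * uval v']mulrA [(uval v')^-1 * (z0 * _)]mulrA -z0C -!mulrA mulKr //.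
have UCr (v w v' : units A) z0 : central z0 -> uval v = z0 * uval w -> [~ v', v]%g = [~ v', w]%g.
  move=> z0C vE; rewrite -[LHS]invgK -[RHS]invgK; congr (_^-1)%g.
  have invR (g h : units A) : [~ g, h]^-1%g = [~ h, g]%g.
    by rewrite /commg /conjg !invMg !invgK !mulgA.
  by rewrite !invR; apply: UC vE.
have -> : iter (n.+1 * b).+1 (fun z => [~ z, y]%g) x =
      iter (n.+1 * b).+1 (fun z => [~ z, y']%g) x'.
  rewrite !iterSr (UC _ _ _ _ zC xE) (UCr _ _ _ _ z'C yE).
  by apply: eq_iter => v; apply: UCr yE.
apply: (commutator_engel An _ (b0 s u) x'E y'E).
have [_ nL] := lnil_levitzki_radical A; apply: nL => v.
by rewrite !inE => /orP[] /eqP ->; apply/(engel_nilpotent_levitzki An).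
Qed.

(** * Engel unit groups over infinite fields *)

Section Evaluation.
Variables (F : fieldType) (A : unitAlgType F).
Implicit Types (c w : A) (t : F) (G g : {poly F}) (P Q H : {poly A}).
Local Notation "G ^A" := (map_poly (in_alg A) G) (at level 2, format "G ^A").

Lemma comm_poly_scalar P t : comm_poly P (t%:A).
Proof. by rewrite /comm_poly -scalerAl -scalerAr mul1r mulr1. Qed.

Lemma hornerM_scalar P Q t : (P * Q).[t%:A] = P.[t%:A] * Q.[t%:A].
Proof. exact/hornerM_comm/comm_poly_scalar. Qed.

Lemma horner_map_scalar G t : G^A.[t%:A] = G.[t]%:A.
Proof. exact: (horner_map (in_alg A)). Qed.

Lemma poly_eq0_infinitely_many_roots P (G : {poly F}) :
  (forall m, exists s : seq F, uniq s /\ (m <= size s)%N) -> G != 0 ->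
  (forall t, G.[t] != 0 -> P.[t%:A] = 0) -> P = 0.
Proof.
move=> F_inf G0 PG; apply/eqP/negPn/negP => P0.
have [s [Us sz_s]] := F_inf (size P + size G)%N.
pose r := [seq t <- s | G.[t] != 0].
have sz_r : (size P <= size r)%N.
  have : (size [seq t <- s | ~~ (G.[t] != 0%R)] < size G)%N.
    apply: max_poly_roots => //; last exact: filter_uniq.
    by apply/allP => t; rewrite mem_filter negbK => /andP[].
  have := count_predC (fun t : F => G.[t] != 0%R) s; rewrite -!size_filter.
  move=> E lt_G; rewrite -(leq_add2r (size G)).
  apply: leq_trans sz_s _; rewrite -E leq_add2l.
  exact: (ltnW lt_G).
suff : (size r < size P)%N by rewrite ltnNge sz_r.
rewrite -(size_map (in_alg A)); apply: max_ring_poly_roots => //.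
  apply/allP => x /mapP[t]; rewrite mem_filter => /andP[Gt _] ->.
  by rewrite /root PG.
have : uniq r by apply: filter_uniq.
clearbody r; elim: r {sz_r} => //= t r IHr /andP[tr /IHr ->]; rewrite andbT.
apply/allP => x /mapP[t' t'r ->]; apply/andP; split.
  by rewrite -!scalerAl !mul1r !scalerA mulrC.
rewrite -scalerBl; have tt' : t' - t != 0.
  by rewrite subr_eq0; apply: contraNneq tr => <-.
by rewrite scaler_unit ?unitfE // unitr1.
Qed.

(** The inverse of [1 + c 'X] is rational with scalar denominator [G], the reversal of [g] evaluated
    with alternating signs. Its constant coefficient is, up to sign, the leading coefficient of
    [g]. *)
Lemma algebraic_1D_inverse c : (exists2 g, g != 0 & horner_alg c g = 0) ->
  exists G H, [/\ G`_0 != 0, (1 + c%:P * 'X) * H = G^A & H * (1 + c%:P * 'X) = G^A].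
Proof.
case=> g g0 gc; pose D := (size g).-1.
have szg : size g = D.+1 by rewrite prednK // size_poly_gt0.
pose G := \sum_(i < D.+1) ((-1) ^+ i * g`_i)%:P * 'X^(D - i).
pose z : {poly A} := c%:P * 'X.
pose k i : {poly A} := (g`_i)%:A%:P * 'X^(D - i).
have zN1 : GRing.comm (-1) z by apply/commr_sym/commrN/commr1.
pose h i := \sum_(j < i) (-1) ^+ (i.-1 - j) * z ^+ j.
have hE i : (-1) ^+ i - z ^+ i = - ((1 + z) * h i).
  by rewrite (subrXX_comm i zN1) -[RHS]mulNr opprD.
have zh i : GRing.comm (1 + z) (h i).
  apply: commr_sum => j _; apply: commrM.
    by apply: commrX; apply: commrN; apply: commr1.
  by apply: commrX; apply/commr_sym/commrD; [apply: commr1|].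
have zk i : GRing.comm (1 + z) (k i).
  apply/commr_sym/commrD; first exact: commr1.
  apply/commr_sym/commrM; last exact: commr_polyXn.
  apply/commr_sym/commrM; last exact: commr_polyX.
  by rewrite /GRing.comm -!polyCM -scalerAl -scalerAr mul1r mulr1.
pose H := \sum_(i < D.+1) - (k i * h i).
have zH : GRing.comm (1 + z) H.
  by apply: commr_sum => i _; apply: commrN; apply: commrM.
have GA : G^A = \sum_(i < D.+1) k i * (-1) ^+ i.
  rewrite rmorph_sum /=; apply: eq_bigr => i _.
  rewrite rmorphM /= map_polyC map_polyXn /= -[_%:A]/(in_alg A _) rmorphM polyCM.
  by rewrite !rmorph_sign -mulrA -/(k i); apply/commr_sym/commr_sign.
have zHG : (1 + z) * H = G^A.
  (* This sum is [g(c)] times ['X^D]. Subtracting it from [G] leaves multiples of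
     [(-1) ^+ i - z ^+ i], hence of [1 + z]. *)
  have gz0 : \sum_(i < D.+1) k i * z ^+ i = 0.
    rewrite (eq_bigr (fun i : 'I_D.+1 => (g`_i *: c ^+ i)%:P * 'X^D)) => [|i _].
      rewrite -big_distrl -rmorph_sum /=.
      have -> : \sum_(i < D.+1) g`_i *: c ^+ i = horner_alg c g.
        rewrite /horner_alg /horner_morph horner_coef size_map_poly szg.
        by apply: eq_bigr => i _; rewrite coef_map /= -scalerAl mul1r.
      by rewrite gc mul0r.
    rewrite /z /k exprMn_comm; last exact: commr_polyX.
    rewrite -!mulrA (mulrA 'X^_) -commr_polyXn -(mulrA _ 'X^_) -exprD.
    rewrite subnK ?leq_ord // mulrA -rmorphXn -polyCM /=.
    by rewrite -scalerAl mul1r.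
  rewrite -[RHS]subr0 -gz0 GA -sumrB /H mulr_sumr; apply: eq_bigr => i _.
  by clearbody k z h; rewrite -mulrBr hE !mulrN !mulrA zk.
exists G, H; split=> //; last by rewrite -zH.
rewrite coef_sum (bigD1 ord_max) //= subnn mulr1 coefC /= big1 ?addr0.
  by rewrite mulf_neq0 ?signr_eq0 // -[D]/(size g).-1 lead_coef_eq0.
move=> i; rewrite -val_eqE /= => iD; rewrite coefCM coefXn.
by rewrite eq_sym subn_eq0 leqNgt ltn_neqAle iD leq_ord mulr0.
Qed.

Section Commutators.
Variables (n : nat) (y : units A) (c : A).
Hypothesis An : forall x z : units A, iter n (fun v : units A => [~ v, z]%g) x = 1%g.
Hypothesis F_inf : forall m, exists s : seq F, uniq s /\ (m <= size s)%N.
Variables (G : {poly F}) (H : {poly A}).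
Hypotheses (G0 : G`_0 != 0) (cH : (1 + c%:P * 'X) * H = G^A)
  (Hc : H * (1 + c%:P * 'X) = G^A).

(** Congruence of [P] with [G ^+ e] times [1 + w 'X] modulo ['X^2]. *)
Definition jet e w P := P`_0 = ((G ^+ e)`_0)%:A /\
  P`_1 = ((G ^+ e)`_1)%:A + (G ^+ e)`_0 *: w.

Lemma jetM e e' w w' P Q : jet e w P -> jet e' w' Q -> jet (e + e') (w + w') (P * Q).
Proof.
move=> [P0 P1] [Q0 Q1]; rewrite /jet exprD !coefM !big_ord_recr !big_ord0 /= !add0r.
rewrite P0 P1 Q0 Q1; split; first by rewrite -scalerAl mul1r scalerA.
rewrite mulrDr mulrDl -!scalerAl !mul1r -!scalerAr mulr1 !scalerA.
rewrite scalerDr scalerDl addrACA [_ *: w' + _]addrC.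
by congr (_ + _ + (_ + _)); congr (_ *: _); exact: mulrC.
Qed.

Lemma jet_conj e w P (v v' : A) : v * v' = 1 ->
  jet e w P -> jet e (v * w * v') (v%:P * P * v'%:P).
Proof.
move=> vv' [P0 P1]; rewrite /jet !coefMC !coefCM P0 P1 mulrDr mulrDl.
by rewrite -!scalerAr -!scalerAl mulr1 vv'.
Qed.

(** Along [x = 1 + t c] the function equals [P(t) / G(t)^e], with first-order expansion [1 + w t];
    denominators are cleared to stay within polynomials. *)
Definition represented w (phi : units A -> A) := exists e P, jet e w P /\
  forall t (x : units A), G.[t] != 0 -> uval x = 1 + t *: c ->
    (G.[t] ^+ e) *: phi x = P.[t%:A].

Lemma representedM w w' phi psi : represented w phi -> represented w' psi ->
  represented (w + w') (fun x => phi x * psi x).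
Proof.
move=> [e [P [jP PE]]] [e' [Q [jQ QE]]]; exists (e + e')%N, (P * Q); split.
  exact: jetM.
move=> t x Gt xE; rewrite hornerM_scalar -(PE t x) // -(QE t x) //.
by rewrite -scalerAl -scalerAr scalerA exprD.
Qed.

Lemma represented_conj w phi (v v' : A) : v * v' = 1 -> represented w phi ->
  represented (v * w * v') (fun x => v * phi x * v').
Proof.
move=> vv' [e [P [jP PE]]]; exists e, (v%:P * P * v'%:P); split.
  exact: jet_conj.
move=> t x Gt xE; rewrite !hornerM_scalar !hornerC -(PE t x) //.
by rewrite -!scalerAr -!scalerAl.
Qed.

Local Notation D w := ((uval y)^-1 * bracket w (uval y)).

(** To first order, commutation with [y] acts as [w |-> y^-1 w y - w]. The inverse is carried along
    because the next commutator contains it. *)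
Lemma iter_commutator_represented k :
  represented (iter k (fun w => D w) c)
    (fun x => uval (iter k (fun v : units A => [~ v, y]%g) x)) /\
  represented (- iter k (fun w => D w) c)
    (fun x => (uval (iter k (fun v : units A => [~ v, y]%g) x))^-1).
Proof.
have DE w : D w = - w + (uval y)^-1 * w * uval y.
  by rewrite /bracket mulrBr !mulrA uvalVK mul1r addrC.
elim: k => [|k [IH1 IH2]].
  split.
    exists 0, (1 + c%:P * 'X); split.
      rewrite /jet expr0 !coefD !coefCM !coefX !coef1 /= mulr0 mulr1 addr0 scale1r.
      by rewrite scale1r scale0r add0r.
    move=> t x Gt xE; rewrite expr0 scale1r hornerD hornerM_scalar !hornerC hornerX.
    by rewrite xE -scalerAr mulr1.
  exists 1%N, H; split.
    have := congr1 (fun P : {poly A} => P`_0) cH; have := congr1 (fun P : {poly A} => P`_1) cH.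
    rewrite /jet expr1 mulrDl mul1r -mulrA !coefD !coefCM !coefXM /= mulr0 addr0 !coef_map /=.
    move=> H1 H0; rewrite H0; split=> //; rewrite -H1 H0 -scalerAr mulr1 scalerN.
    by rewrite addrK.
  move=> t x Gt xE; have := congr1 (fun P : {poly A} => P.[t%:A]) cH.
  rewrite hornerM_scalar hornerD hornerM_scalar !hornerC hornerX horner_map_scalar.
  rewrite -scalerAr mulr1 -xE => /(congr1 ( *%R (uval x)^-1)).
  by rewrite mulKr ?uvalP // -scalerAr mulr1 expr1 => ->.
have yVy : (uval y)^-1 * uval y = 1 := uvalVK y.
split.
  rewrite iterS DE.
  have [e [P [jP PE]]] := representedM IH2 (represented_conj yVy IH1).
  exists e, P; split=> // t x Gt xE; rewrite -(PE t x) //.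
  by rewrite iterS uvalR !mulrA.
rewrite iterS DE opprD opprK addrC -mulNr -mulrN.
have [e [P [jP PE]]] := representedM (represented_conj yVy IH2) IH1.
exists e, P; split=> // t x Gt xE; rewrite -(PE t x) // iterS -uvalV.
have -> : ([~ iter k (fun v : units A => [~ v, y]) x, y]^-1 = 
  [~ y, iter k (fun v : units A => [~ v, y]) x])%g.
  by rewrite /commg /conjg !invMg !invgK !mulgA.
by rewrite uvalR !mulrA.
Qed.

(** The identity makes [P - G ^+ e] vanish at infinitely many scalars, hence identically; its
    degree-one coefficient is a nonzero scalar times the iterate in question. *)
Lemma engel_derivation_unit : iter n (fun w => D w) c = 0.
Proof.
have [[e [P [[P0 P1] PE]]] _] := iter_commutator_represented n.
have P_G : P - (G ^+ e)^A = 0.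
  apply: (poly_eq0_infinitely_many_roots F_inf (G := G)).
    by apply: contraNneq G0 => ->; rewrite coef0.
  move=> t Gt; have xU : 1 + t *: c \is a GRing.unit.
    have ev Q Q' : Q * Q' = G^A -> Q.[t%:A] * (G.[t]^-1 *: Q'.[t%:A]) = 1.
      move=> QQ; rewrite -scalerAr -hornerM_scalar QQ horner_map_scalar scalerA.
      by rewrite mulVf // scale1r.
    have cE : (1 + c%:P * 'X).[t%:A] = 1 + t *: c.
      by rewrite hornerD hornerM_scalar !hornerC hornerX -scalerAr mulr1.
    apply/unitrP; exists (G.[t]^-1 *: H.[t%:A]); rewrite -cE (ev _ _ cH).
    by rewrite -scalerAl scalerAr ev.
  rewrite hornerD hornerN horner_map_scalar -(PE t (Units xU)) // An uval1.
  by rewrite horner_exp subrr.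
have := congr1 (fun Q : {poly A} => Q`_1) P_G; rewrite coefB coef0 coef_map P1 /= addrAC.
rewrite subrr add0r => /(congr1 ( *:%R ((G ^+ e)`_0)^-1)); rewrite scalerA scaler0.
rewrite mulVf ?scale1r // -horner_coef0 horner_exp horner_coef0.
by rewrite expf_neq0.
Qed.
End Commutators.
End Evaluation.

Lemma iter_unit_derivation (A : unitRingType) (y a : A) k :
  iter k (fun w => y^-1 * bracket w y) a = y^-1 ^+ k * iter k (fun w => bracket w y) a.
Proof.
elim: k => [|k IHk]; first by rewrite mul1r.
rewrite !iterS IHk exprS -mulrA bracketMl (_ : bracket (_ ^+ _) y = 0).
  by rewrite mul0r addr0.
by apply/bracket_eq0/esym/commrX/commrV.
Qed.

(** Brackets do not see scalar shifts, so [y] may be replaced by a unit [y + t], for which the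
    iterates of [D] and of the bracket differ by a power of the inverse of that unit. *)
Lemma engel_group_infinite (F : fieldType) (A : unitAlgType F) n :
  algebraic_algebra A -> (forall m, exists s : seq F, uniq s /\ (m <= size s)%N) ->
  (forall x z : units A, iter n (fun v : units A => [~ v, z]%g) x = 1%g) ->
  lie_engel A n.
Proof.
move=> A_alg F_inf An c y.
suff [t tU] : exists t, y + t%:A \is a GRing.unit.
  have [G [H [G0 cH Hc]]] := algebraic_1D_inverse (A_alg c).
  have := engel_derivation_unit (Units tU) An F_inf G0 cH Hc; rewrite /= iter_unit_derivation.
  move=> /(congr1 ( *%R ((y + t%:A) ^+ n))); rewrite exprVn mulVKr ?unitrX // mulr0 => <-.
  apply: eq_iter => w; rewrite /bracket mulrDl mulrDr -scalerAl -scalerAr mul1r mulr1.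
  by rewrite opprD addrACA subrr addr0.
have [G [H [G0 yH Hy]]] := algebraic_1D_inverse (A_alg y).
have [t [t0 Gt]] : exists t : F, t != 0 /\ G.[t] != 0.
  have G0' : G * 'X != 0.
    by rewrite mulf_neq0 ?polyX_eq0 //; apply: contraNneq G0 => ->; rewrite coef0.
  have [s [Us ss]] := F_inf (size (G * 'X)); apply: NNPP => nt.
  have : (size s < size (G * 'X)%R)%N; last by rewrite ltnNge ss.
  apply: max_poly_roots => //; apply/allP => t _; apply/negPn/negP => rt; apply: nt.
  exists t; move: rt; rewrite /root hornerMX mulf_eq0 negb_or => /andP[] //.
exists t^-1.
have ev (Q Q' : {poly A}) : Q * Q' = map_poly (in_alg A) G ->
    Q.[t%:A] * (G.[t]^-1 *: Q'.[t%:A]) = 1.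
  move=> QQ; rewrite -scalerAr -hornerM_scalar QQ horner_map_scalar scalerA.
  by rewrite mulVf // scale1r.
have yE : (1 + y%:P * 'X).[t%:A] = t *: (y + t^-1%:A).
  rewrite hornerD hornerM_scalar !hornerC hornerX -scalerAr mulr1 scalerDr scalerA.
  by rewrite mulfV // scale1r addrC.
have : t *: (y + t^-1%:A) \is a GRing.unit.
  apply/unitrP; exists (G.[t]^-1 *: H.[t%:A]); rewrite -yE (ev _ _ yH).
  by rewrite -scalerAl scalerAr ev.
by rewrite scaler_unit ?unitfE.
Qed.

(** * Engel unit groups over finite fields *)

Lemma twisted_commute (R : pzRingType) (X Y d g w : R) :
  X * Y = Y * (X * d) -> g * Y = Y * g -> w * Y = Y * w -> d * w = w * d ->
  g * X * w * Y = Y * (g * X * w * d).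
Proof.
move=> xy gY wY dw; rewrite -(mulrA _ w Y) wY -(mulrA _ X) (mulrA X) xy -!mulrA dw.
by rewrite mulrA gY !mulrA.
Qed.

Lemma mulg_expg_twisted (G : groupType) (x y d : G) k :
  (x * y = y * x * d)%g -> commute d y -> (x * y ^+ k = y ^+ k * x * d ^+ k)%g.
Proof.
move=> xy dy; elim: k => [|k IHk]; first by rewrite !expg0 mul1g !mulg1.
have dky : (d ^+ k * y = y * d ^+ k)%g by apply/commute_sym/commuteX/commute_sym.
rewrite [(y ^+ _)%g]expgSr mulgA IHk -(mulgA _ (d ^+ k)%g) dky mulgA.
by rewrite -(mulgA _ x) xy !mulgA -(mulgA _ d) -expgS.
Qed.

Section EngelUnits.
Variables (A : unitRingType) (n : nat).
Hypothesis An : forall x z : units A, iter n (fun v : units A => [~ v, z]%g) x = 1%g.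
Implicit Types (x y h : units A) (a b v w e : A).

Lemma unitr_sq0 v : v * v = 0 -> 1 + v \is a GRing.unit.
Proof. by move=> vv; apply: unitr_1Dnil; exists 2. Qed.

Lemma invr_sq0 v : v * v = 0 -> (1 + v)^-1 = 1 - v.
Proof.
move=> vv; have E : (1 + v) * (1 - v) = 1 - v * v by nc_ring.
by rewrite -[RHS](mulKr (unitr_sq0 vv)) E vv subr0 mulr1.
Qed.

Lemma commutator_sq0 h y v v' : uval h = 1 + v -> v * v = 0 ->
  v * uval y = uval y * v' -> v * v' = 0 -> uval [~ h, y]%g = 1 + (v' - v).
Proof.
move=> hE vv vy vv'; rewrite uvalR hE invr_sq0 // [(1 + v) * _]mulrDl mul1r vy.
rewrite [(uval y)^-1 * _]mulrDr [(uval y)^-1 * (_ * v')]mulrA uvalVK mul1r.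
have -> : (1 - v) * (1 + v') = 1 + (v' - v) - v * v' by nc_ring.
by rewrite vv' subr0.
Qed.

Section IteratedCommutator.
Variables (x y : units A).
Local Notation X := (uval x).
Local Notation Y := (uval y).
Local Notation d := (uval [~ x, y]%g).
Local Notation f := (d - 1).
Hypothesis dy : d * Y = Y * d.

Let xy : X * Y = Y * (X * d).
Proof. by rewrite uvalR [X * (_ * _)]mulrA uvalK mul1r mulrA uvalK mul1r. Qed.

Let fy k : f ^+ k * Y = Y * f ^+ k.
Proof.
by apply/esym/commrX; rewrite /GRing.comm mulrBr mulrBl dy mulr1 mul1r.
Qed.

Let df k : d * f ^+ k = f ^+ k * d.
Proof. by apply/commrX/commrB => //; apply: commr1. Qed.

(** The elements [v k] square to zero, and commuting [1 + v k] with [y] multiplies [v k] on the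
    right by [f]; the identity therefore kills [v n]. *)
Lemma engel_commutator_nil_step i j : f ^+ (i + j) * X * f ^+ j = 0 ->
  f ^+ i * X * f ^+ (j + n) = 0.
Proof.
move=> fXf; pose v k := f ^+ i * X * f ^+ j * f ^+ k.
have fC k : f ^+ j * f ^+ k * f ^+ i = f ^+ k * f ^+ (i + j).
  by rewrite -!exprD addnC addnA [(i + j)%N]addnC addnC addnA.
have vv k : v k * v k = 0.
  have -> : v k * v k = f ^+ i * X * (f ^+ j * f ^+ k * f ^+ i) * (X * f ^+ j) * f ^+ k.
    by rewrite /v; nc_ring.
  have -> : f ^+ i * X * (f ^+ j * f ^+ k * f ^+ i) * (X * f ^+ j) * f ^+ k =
      f ^+ i * X * f ^+ k * (f ^+ (i + j) * X * f ^+ j) * f ^+ k by rewrite fC; nc_ring.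
  by rewrite fXf mulr0 mul0r.
have step k :
    uval (iter k (fun z : units A => [~ z, y]%g) (Units (unitr_sq0 (vv 0%N)))) = 1 + v k.
  elim: k => [//|k IHk]; rewrite iterS (commutator_sq0 IHk (vv k) (v' := v k * d)).
  - congr (1 + _); rewrite /v exprSr mulrA.
    by move: (f ^+ i * X * f ^+ j * f ^+ k) => u; nc_ring.
  - rewrite /v -(mulrA _ (f ^+ j)); set w := f ^+ j * f ^+ k.
    have wY : w * Y = Y * w by rewrite /w -mulrA fy mulrA fy mulrA.
    have dw : d * w = w * d by rewrite /w mulrA df -mulrA df mulrA.
    exact: twisted_commute.
  - by rewrite mulrA vv mul0r.
have := step n; rewrite An uval1 -[LHS]addr0 => /addrI v0.
by rewrite exprD mulrA; exact: esym v0.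
Qed.

(** Trades an unknown nilpotency exponent for one depending on [n] alone: two applications of the
    preceding step lower [m.+1] to [m] as long as [m] exceeds [3 * n]. *)
Lemma engel_commutator_nil m : f ^+ m = 0 -> f ^+ (3 * n).+1 = 0.
Proof.
elim: m => [|m IHm fm].
  by rewrite expr0 => f0; rewrite -[LHS]mulr1 f0 mulr0.
have [mn|nm] := leqP m (3 * n).
  by rewrite -(subnK (_ : m.+1 <= (3 * n).+1)%N) // exprD fm mulr0.
apply: IHm; pose j := (m - n)%N.
have nlem : (n <= m)%N by apply: leq_trans (ltnW nm); rewrite leq_pmull.
have jn : (j + n)%N = m by rewrite subnK.
have fjj : f ^+ j * X * f ^+ j = 0.
  have nj : (n <= j)%N.
    by lia.
  have := @engel_commutator_nil_step j (j - n); rewrite subnK //; apply.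
  suff -> : f ^+ (j + (j - n)) = 0 by rewrite !mul0r.
  (* With [j = m - n] the right side is [2 m - 3 n], which reaches [m.+1] exactly when [m > 3 n]. *)
  have le : (m.+1 <= j + (j - n))%N.
    by lia.
  by rewrite -(subnK le) exprD fm mulr0.
have := @engel_commutator_nil_step 0 j; rewrite add0n expr0 !mul1r => /(_ fjj).
by rewrite jn => /(congr1 ( *%R X^-1)); rewrite mulr0 mulKr // uvalP.
Qed.
End IteratedCommutator.

Lemma commute_uval x y : commute x y -> uval x * uval y = uval y * uval x.
Proof. by move/(congr1 (@uval A)). Qed.

Section PrimeCharacteristic.
Variables (p : nat) (p_pr : prime p) (pA0 : p%:R = 0 :> A).
Hypothesis A_comm_nil : forall x y : units A, exists m, (uval [~ x, y]%g - 1) ^+ m = 0.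
Let M := (p ^ (3 * n).+1)%N.

(** As [d] commutes with [y], moving [x] across [y ^+ M] costs [d ^+ M]. This is 1, since [d] is
    unipotent of exponent at most [(3 * n).+1], and [M] is a power of [p] at least that large. *)
Lemma commutator_commute_expg x y : commute [~ x, y]%g y -> commute x (y ^+ M)%g.
Proof.
move=> dy; set d := [~ x, y]%g in dy.
have E k := mulg_expg_twisted k (commgC x y) dy.
suff dM : (d ^+ M)%g = 1%g by rewrite /commute E dM mulg1.
have uvalX k : uval (d ^+ k)%g = uval d ^+ k.
  by elim: k => // k IHk; rewrite expgS exprS uvalM IHk.
have [m /(engel_commutator_nil (commute_uval dy)) f0] := A_comm_nil x y.
apply: uval_inj; rewrite uvalX uval1 -[uval d](subrK 1).
rewrite exprDn_pchar_iter ?mulr1 ?mul1r // expr1n -/d.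
have le : ((3 * n).+1 <= p ^ (3 * n).+1)%N by rewrite ltnW // ltn_expl // prime_gt1.
by rewrite -(subnK le) exprD f0 mulr0 add0r.
Qed.

(** Induction along the Engel chain: if [[~ x, y]] commutes with a power [y'] of [y], so does
    [[~ x, y']], a product of [y]-conjugates of [[~ x, y]]; the previous lemma then applies to [x]
    and [y']. *)
Lemma engel_commute_expg k x y :
  iter k (fun v : units A => [~ v, y]%g) x = 1%g -> commute x (y ^+ (M ^ k))%g.
Proof.
elim: k x => [x /= ->|k IHk x]; first exact/commute_sym/commute1.
rewrite iterSr => /IHk dy'; rewrite expnS mulnC expgnA.
apply: commutator_commute_expg; set y' := (y ^+ _)%g in dy' *.
have yy' : commute y y' by apply: commuteX.
suff E j : commute [~ x, (y ^+ j)%g]%g y' by apply: E.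
elim: j => [|j IHj]; first by rewrite expg0 commg1; apply/commute_sym/commute1.
have -> : [~ x, (y ^+ j.+1)%g]%g = ([~ x, y] * (y^-1 * ([~ x, y ^+ j] * y)))%g.
  by rewrite expgSr /commg /conjg !invMg !mulgA !mulgK.
apply: commute_sym; apply: commuteM; first exact: commute_sym.
apply: commuteM; first by apply/commuteV/commute_sym.
by apply: commuteM; apply: commute_sym.
Qed.
End PrimeCharacteristic.
End EngelUnits.

Lemma fitting_idempotent (R : pzRingType) (a : R) i m :
  (0 < m)%N -> a ^+ (i + m) = a ^+ i -> exists2 k, (0 < k)%N & a ^+ k * a ^+ k = a ^+ k.
Proof.
move=> m0 am; exists (m * i.+1)%N; first by rewrite muln_gt0 m0.
have am' j l : a ^+ (i + l + m * j) = a ^+ (i + l).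
  elim: j => [|j IHj]; first by rewrite muln0 addn0.
  have -> : (i + l + m * j.+1 = i + m + (l + m * j))%N by rewrite mulnS; lia.
  by rewrite exprD am -exprD addnA.
have le : (i <= m * i.+1)%N by rewrite (leq_trans (leqnSn i)) // leq_pmull.
by rewrite -exprD -{1}(subnKC le) am' subnKC.
Qed.

Section EngelUnitsAlgebra.
Variables (F : fieldType) (A : unitAlgType F) (n : nat).
Hypothesis An : forall x z : units A, iter n (fun v : units A => [~ v, z]%g) x = 1%g.
Variable t : F.
Hypotheses (t0 : t != 0) (t1 : t != 1).
Implicit Types (a c e v w : A).

(** Conjugation by the unit [t e + (1 - e)] has the square-zero element [v] as eigenvector. Each
    commutator multiplies [v] by [t^-1 - 1], which is nonzero. *)
Lemma engel_idempotent_peirce e (z : A) : e * e = e -> e * z * (1 - e) = 0.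
Proof.
move=> ee; set v := e * z * (1 - e).
have e1e : (1 - e) * e = 0 by rewrite mulrBl mul1r ee subrr.
have ev : e * v = v by rewrite /v !mulrA ee.
have ve : v * e = 0 by rewrite /v -mulrA e1e mulr0.
have vv : v * v = 0 by rewrite -{2}ev mulrA ve mul0r.
pose y r : A := r *: e + (1 - e).
have yM r r' : y r * y r' = y (r * r').
  have ef : e * (1 - e) = 0 by rewrite mulrBr mulr1 ee subrr.
  have ff : (1 - e) * (1 - e) = 1 - e by rewrite mulrBl mul1r ef subr0.
  rewrite /y; move: (1 - e) e1e ef ff => f fe ef ff.
  rewrite mulrDl !mulrDr -!scalerAl -!scalerAr ee ef fe ff.
  by rewrite !scaler0 addr0 add0r scalerA.
have y1 : y 1 = 1 by rewrite /y scale1r addrC subrK.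
have yU : y t \is a GRing.unit.
  by apply/unitrP; exists (y t^-1); rewrite !yM mulVf // mulfV.
pose Y := Units yU.
have vy : v * y t = v by rewrite /y mulrDr -scalerAr mulrBr ve scaler0 mulr1 subr0 add0r.
have yv : y t * v = t *: v by rewrite /y mulrDl -scalerAl mulrBl ev mul1r subrr addr0.
have step k : uval (iter k (fun z => [~ z, Y]%g) (Units (unitr_sq0 vv)))
    = 1 + (t^-1 - 1) ^+ k *: v.
  elim: k => [|k IHk]; first by rewrite expr0 scale1r.
  rewrite iterS (commutator_sq0 IHk (v' := t^-1 *: ((t^-1 - 1) ^+ k *: v))).
  - by rewrite exprS -scalerA scalerBl scale1r.
  - by rewrite -scalerAl -scalerAr vv !scaler0.
  - by rewrite /= -scalerAl vy -!scalerAr yv !scalerA mulrAC mulVf // mul1r.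
  - by rewrite -scalerAl -!scalerAr vv !scaler0.
have := step n; rewrite An uval1 -[LHS]addr0 => /addrI /esym/eqP.
rewrite scaler_eq0 expf_eq0 => /orP[/andP[_]|/eqP //].
by rewrite subr_eq0 invr_eq1 (negbTE t1).
Qed.

Lemma engel_idempotent_central e : e * e = e -> central e.
Proof.
move=> ee z; have := engel_idempotent_peirce z ee.
have f2 : (1 - e) * (1 - e) = 1 - e by rewrite mulrBr mulr1 mulrBl mul1r ee subrr subr0.
have := engel_idempotent_peirce z f2; rewrite (_ : 1 - (1 - e) = e) ?subKr //.
rewrite mulrBl mul1r mulrBl => /eqP; rewrite subr_eq0 => /eqP ->.
by rewrite mulrBr mulr1 => /eqP; rewrite subr_eq0 => /eqP.
Qed.

Hypothesis A_fin : forall a, exists i m, (0 < m)%N /\ a ^+ (i + m) = a ^+ i.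

Local Notation L := (@levitzki_radical A).
Let iL : ideal L. Proof. by have [] := @lnil_levitzki_radical A. Qed.

(** Some power [e] of [a * z] is idempotent, hence central. Moved next to [a] it produces the factor
    [a * a], so [e] lies in the radical, and a nilpotent idempotent is zero. *)
Lemma engel_group_nil_mul a (z : A) : L (a * a) -> exists m, (a * z) ^+ m = 0.
Proof.
move=> Laa; have [i [r [r0 ar]]] := A_fin (a * z).
have [[//|k] _ ee] := fitting_idempotent r0 ar.
set e := (a * z) ^+ k.+1 in ee; have eC := engel_idempotent_central ee.
suff /levitzki_radical_nil[m em] : L e.
  exists k.+1; rewrite -/e -em; case: m em => [|m _].
    by rewrite expr0 => e1; rewrite -[LHS]mulr1 e1 mulr0.
  by elim: m => [|m IHm]; rewrite ?expr1 // exprS -IHm.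
have -> : e = a * e * (z * (a * z) ^+ k).
  by rewrite -mulrA eC !mulrA -[a * z * _]exprS -/e ee.
apply: idealMr => //; rewrite /e exprS -(mulrA a z) mulrA.
exact: idealMr.
Qed.

(** Group version of [engel_semiprime_sq0]: modulo [L], commutators of [1 + a] with [1 + a z] are
    [1 + w ^+ k * a], where [w] is the inverse of [1 + a z] minus 1. Clearing units from
    [w ^+ n * a] bounds the index of [a A]. *)
Lemma engel_group_levitzki_sq0 a : L (a * a) -> L a.
Proof.
move=> Laa; have sL := @semiprime_levitzki_radical A.
have aU : 1 + a \is a GRing.unit.
  have [m am] := levitzki_radical_nil Laa.
  by apply: unitr_1Dnil; exists (2 * m)%N; rewrite exprM expr2.
suff anz (z : A) : L ((a * z) ^+ n * a).
  apply: (levitzki_bounded (S := fun w => exists x, w = a * x) (m := n) sL).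
  - split=> [_ _ [x ->] [x' ->]|_ x [x' ->]]; first by exists (x + x'); rewrite mulrDr.
    by exists (x' * x); rewrite mulrA.
  - by move=> _ _ [x ->] [x' ->]; rewrite mulrA; apply: idealMr.
  - by exists 1; rewrite mulr1.
have yU : 1 + a * z \is a GRing.unit by apply/unitr_1Dnil/engel_group_nil_mul.
pose y := Units yU; pose Y := uval y; pose w := Y^-1 - 1.
have YE : Y = 1 + a * z by [].
have YV : Y^-1 * Y = 1 := uvalVK y.
have YV' : Y * Y^-1 = 1 := uvalK y.
have LaY : L (a * Y - a).
  by rewrite YE mulrDr mulr1 addrC addKr mulrA; apply: idealMr.
have Lcy c : L (c * Y - c) -> L (c * Y^-1 - c).
  move=> Lc; have -> : c * Y^-1 - c = - ((c * Y - c) * Y^-1).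
    by rewrite mulrBl -mulrA YV' mulr1 opprB.
  by apply: (idealN iL); apply: idealMr.
have Law : L (a * w) by rewrite mulrBr mulr1; apply: Lcy.
pose c k := w ^+ k * a.
have LcY k : L (c k * Y - c k).
  by rewrite /c -mulrA -mulrBr; apply: idealMl.
have Lcc k : L (c k * c k).
  rewrite /c -mulrA; apply: idealMl => //; rewrite mulrA.
  by case: k => [|k]; rewrite ?mulr1 // exprS mulrA; do 2!(apply: idealMr => //).
have step k : L (uval (iter k (fun v : units A => [~ v, y]%g) (Units aU)) - (1 + c k)).
  elim: k => [|k]; first by rewrite /c mul1r subrr; apply: ideal0.
  rewrite iterS; set h := iter k _ _; rewrite uvalR -/Y.
  have hVK := uvalVK h; have hK := uvalK h; move: (uval h) hVK hK => H HV HK Lh.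
  have LH : L (H^-1 - (1 - c k)).
    have -> : H^-1 - (1 - c k) = (c k * c k - (1 - c k) * (H - (1 + c k))) * H^-1.
      move: (c k) (H^-1) HK => C V HK.
      rewrite mulrBl -!mulrA [(H - _) * _]mulrBl HK.
      by nc_ring.
    by apply: idealMr => //; apply: idealB => //; apply: idealMl.
  have LHY : L (Y^-1 * (H * Y) - (1 + Y^-1 * c k)).
    have -> : Y^-1 * (H * Y) - (1 + Y^-1 * c k) =
        Y^-1 * ((H - (1 + c k)) * Y + (c k * Y - c k)).
      by move: (c k) (Y^-1) YV => C V VY; rewrite -{1}VY; nc_ring.
    by apply: idealMl => //; apply: idealD => //; apply: idealMr.
  apply: (ideal_eqv_trans iL (ideal_eqvM iL LH LHY)).
  have -> : (1 - c k) * (1 + Y^-1 * c k) - (1 + c k.+1) =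
     - ((c k * Y^-1 - c k) * c k + c k * c k).
    have -> : c k.+1 = (Y^-1 - 1) * c k by rewrite /c exprS -mulrA.
    by move: (c k) => C; nc_ring.
  by apply: (idealN iL); apply: idealD => //; apply: idealMr => //; apply: Lcy.
have := step n; rewrite An uval1 opprD addrA subrr sub0r => /(idealN iL).
rewrite opprK /c => /(idealMl iL (Y ^+ n)).
have wE : w = Y^-1 * - (a * z).
  by rewrite /w -{1}[Y^-1]mulr1 -{2}YV -mulrBr YE opprD addrA subrr sub0r.
have Yaz : GRing.comm Y^-1 (- (a * z)).
  by apply/commrN/commr_sym/commrV; rewrite YE; apply: commrD; [apply: commr1|].
rewrite wE exprMn_comm // !mulrA -exprMn_comm ?YV' ?expr1n ?mul1r; last first.
  by rewrite /GRing.comm YV YV'.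
by rewrite exprNn -mulrA => /(idealMl iL ((-1) ^+ n)); rewrite signrMK.
Qed.

Lemma engel_group_nilpotent_levitzki a : nilpotent_elt a <-> L a.
Proof.
split=> [[k ak]|/levitzki_radical_nil //].
apply: (completely_semiprime_expr iL engel_group_levitzki_sq0 (k := k)).
by rewrite ak; apply: ideal0.
Qed.
End EngelUnitsAlgebra.

(** * Finite subrings modulo an ideal *)

Section FiniteDomain.
Variables (R : pzRingType) (N : R -> Prop) (s : seq R) (e : R).
Hypotheses (iN : ideal N) (se : e \in s).
Hypothesis sB : forall x y, x \in s -> y \in s -> x - y \in s.
Hypothesis sM : forall x y, x \in s -> y \in s -> x * y \in s.
Hypothesis ex : forall x, x \in s -> e * x = x.
Hypothesis xe : forall x, x \in s -> x * e = x.
Hypothesis Ne : ~ N e.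
Hypothesis Ndom : forall x y, x \in s -> y \in s -> N (x * y) -> N x \/ N y.

Let s0 : 0 \in s. Proof. by rewrite -(subrr e); apply: sB. Qed.
Let sN x : x \in s -> - x \in s. Proof. by rewrite -sub0r; apply: sB. Qed.
Let sD x y : x \in s -> y \in s -> x + y \in s.
Proof. by move=> sx sy; rewrite -[y]opprK; apply: sB => //; apply: sN. Qed.

(** The quotient is carried by first representatives in the list, which makes it a finite type to
    which Wedderburn's theorem applies. The default [e] is reached only outside the classes of
    [s]. *)
Definition residue_rep x := nth e s (find (fun y => boolp.asbool (N (x - y))) s).
Local Notation rep := residue_rep.

Let repP x : x \in s -> N (x - rep x) /\ rep x \in s.
Proof.
move=> sx; have Hs : has (fun y => boolp.asbool (N (x - y))) s.
  by apply/hasP; exists x => //; apply/boolp.asboolP; rewrite subrr; apply: ideal0.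
split; first by have /boolp.asboolP := nth_find e Hs.
by rewrite mem_nth // -has_find.
Qed.

Let rep_eq x y : N (x - y) -> rep x = rep y.
Proof.
move=> xy; rewrite /rep; congr nth; apply: eq_find => z.
apply/boolp.asboolP/boolp.asboolP => [xz|yz].
  by apply: ideal_eqv_trans xz => //; apply: ideal_eqv_sym.
exact: ideal_eqv_trans yz.
Qed.

Definition residues := undup (map rep s).
Definition residue : Type := seq_sub residues.
HB.instance Definition _ := Finite.copy residue (seq_sub residues).
Local Notation Q := residue.
Local Notation v := (fun u : Q => val (u : seq_sub residues)).

Let vP (u : Q) : v u \in s /\ rep (v u) = v u.
Proof.
have : v u \in residues := valP (u : seq_sub residues).
rewrite mem_undup => /mapP[x sx ->]; have [xr rs] := repP sx.
by split=> //; apply/esym/rep_eq.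
Qed.
Let vs u : v u \in s. Proof. by case: (vP u). Qed.

Let repe : rep e \in residues. Proof. by rewrite mem_undup map_f. Qed.
Definition to_residue x : Q := insubd (SeqSub repe) (rep x).
Local Notation mk := to_residue.

Let mkE x : x \in s -> N (v (mk x) - x).
Proof.
move=> sx; rewrite /mk val_insubd mem_undup map_f //.
by apply: ideal_eqv_sym => //; case: (repP sx).
Qed.

Let eqQ (u w : Q) : N (v u - v w) -> u = w.
Proof.
by move/rep_eq; case: (vP u) => _ ->; case: (vP w) => _ -> /val_inj.
Qed.

Definition residue_add u w := mk (v u + v w).
Definition residue_mul u w := mk (v u * v w).
Definition residue_opp u := mk (- v u).

Let addE u w : N (v (residue_add u w) - (v u + v w)).
Proof. exact/mkE/sD. Qed.
Let mulE u w : N (v (residue_mul u w) - (v u * v w)).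
Proof. exact/mkE/sM. Qed.
Let oppE u : N (v (residue_opp u) - - v u).
Proof. exact/mkE/sN. Qed.
Let eE : N (v (mk e) - e). Proof. exact: mkE. Qed.
Let zE : N (v (mk 0) - 0). Proof. exact: mkE. Qed.

Let eqvD a b c d : N (a - b) -> N (c - d) -> N (a + c - (b + d)).
Proof. by move=> ab cd; rewrite opprD addrACA; apply: idealD. Qed.
Let eqvr a : N (a - a). Proof. by rewrite subrr; apply: ideal0. Qed.

Let chain (u w : Q) a : N (v u - a) -> N (v w - a) -> u = w.
Proof.
move=> ua wa; apply: eqQ; apply: ideal_eqv_trans ua _ => //.
exact: ideal_eqv_sym.
Qed.
Let trans a b c : N (a - b) -> N (b - c) -> N (a - c).
Proof. exact: ideal_eqv_trans. Qed.

Fact residue_addA : associative residue_add.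
Proof.
move=> x y z; apply: (chain (a := v x + (v y + v z))).
  by apply: trans (addE _ _) _; apply: eqvD.
by apply: trans (addE _ _) _; rewrite addrA; apply: eqvD.
Qed.
Fact residue_addC : commutative residue_add.
Proof. by move=> x y; rewrite /residue_add addrC. Qed.
Fact residue_add0 : left_id (mk 0) residue_add.
Proof.
move=> x; apply: (chain (a := 0 + v x)); last by rewrite add0r.
by apply: trans (addE _ _) _; apply: eqvD.
Qed.
Fact residue_addN : left_inverse (mk 0) residue_opp residue_add.
Proof.
move=> x; apply: (chain (a := - v x + v x)); last by rewrite addNr.
by apply: trans (addE _ _) _; apply: eqvD.
Qed.
Fact residue_mulA : associative residue_mul.
Proof.
move=> x y z; apply: (chain (a := v x * (v y * v z))).
  by apply: trans (mulE _ _) _; apply: ideal_eqvM.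
by apply: trans (mulE _ _) _; rewrite mulrA; apply: ideal_eqvM.
Qed.
Fact residue_mul1 : left_id (mk e) residue_mul.
Proof.
move=> x; apply: (chain (a := e * v x)); last by rewrite ex.
by apply: trans (mulE _ _) _; apply: ideal_eqvM.
Qed.
Fact residue_mulr1 : right_id (mk e) residue_mul.
Proof.
move=> x; apply: (chain (a := v x * e)); last by rewrite xe.
by apply: trans (mulE _ _) _; apply: ideal_eqvM.
Qed.
Fact residue_mulDl : left_distributive residue_mul residue_add.
Proof.
move=> x y z; apply: (chain (a := (v x + v y) * v z)).
  by apply: trans (mulE _ _) _; apply: ideal_eqvM.
by rewrite mulrDl; apply: trans (addE _ _) _; apply: eqvD.
Qed.
Fact residue_mulDr : right_distributive residue_mul residue_add.
Proof.
move=> x y z; apply: (chain (a := v x * (v y + v z))).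
  by apply: trans (mulE _ _) _; apply: ideal_eqvM.
by rewrite mulrDr; apply: trans (addE _ _) _; apply: eqvD.
Qed.
Fact residue_1_neq0 : mk e != mk 0.
Proof.
apply/eqP => e0; apply: Ne; rewrite -[e]subr0; apply: trans zE; rewrite -e0.
exact: ideal_eqv_sym.
Qed.

HB.instance Definition _ := GRing.isNzRing.Build residue residue_addA residue_addC
  residue_add0 residue_addN residue_mulA residue_mul1 residue_mulr1 residue_mulDl
  residue_mulDr residue_1_neq0.

Definition residue_unit (x : Q) := [exists y, (y * x == 1) && (x * y == 1)].
Definition residue_inv (x : Q) :=
  if [pick y | (y * x == 1) && (x * y == 1)] is Some y then y else x.
Fact residue_mulV : {in residue_unit, left_inverse 1 residue_inv *%R}.
Proof.
move=> x /existsP[y xy]; rewrite /residue_inv; case: pickP => [z /andP[/eqP]//|/(_ y)].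
by rewrite xy.
Qed.
Fact residue_divV : {in residue_unit, right_inverse 1 residue_inv *%R}.
Proof.
move=> x /existsP[y xy]; rewrite /residue_inv; case: pickP => [z /andP[_ /eqP]//|/(_ y)].
by rewrite xy.
Qed.
Fact residue_unitP x y : y * x = 1 /\ x * y = 1 -> residue_unit x.
Proof. by case=> yx xy; apply/existsP; exists y; rewrite yx xy eqxx. Qed.
Fact residue_inv_out : {in [predC residue_unit], residue_inv =1 id}.
Proof.
move=> x; rewrite inE /= => /existsPn xU; rewrite /residue_inv.
by case: pickP => // y; rewrite (negbTE (xU y)).
Qed.
HB.instance Definition _ := GRing.NzRing_hasMulInverse.Build residue
  residue_mulV residue_divV residue_unitP residue_inv_out.

Fact residue_domain : GRing.integral_domain_axiom residue.
Proof.
move=> x y /eqP; rewrite -[x * y]/(residue_mul x y) -[0 : residue]/(mk 0).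
have N0 (z : Q) : N (v z) -> z = mk 0.
  by move=> Nz; apply: (chain (a := 0)) => //; rewrite subr0.
move/eqP => xy; have : N (v x * v y).
  have := mulE x y; rewrite xy => /(ideal_eqv_sym iN) H.
  by rewrite -[_ * _]subr0; apply: trans H zE.
by case/(Ndom (vs x) (vs y)) => /N0 ->; rewrite eqxx ?orbT.
Qed.

(* Wedderburn's little theorem in the residue ring [s / N]. *)
Lemma finite_domain_mod_commute x y : x \in s -> y \in s -> N (x * y - y * x).
Proof.
move=> sx sy; have Nm a b : a \in s -> b \in s -> N (v (mk a * mk b) - a * b).
  by move=> sa sb; apply: trans (mulE _ _) _; apply: ideal_eqvM => //; apply: mkE.
apply: trans (Nm y x sy sx); apply: ideal_eqv_sym => //.
by rewrite -(finDomain_mulrC residue_domain); apply: Nm.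
Qed.
End FiniteDomain.

Lemma count_ltn (T : eqType) (a b : pred T) (s : seq T) x :
  (forall y, a y -> b y) -> x \in s -> b x -> ~~ a x -> (count a s < count b s)%N.
Proof.
move=> ab xs bx ax.
rewrite -[count b s]size_filter -(count_predC a) count_filter (eq_count (a2 := a)).
  rewrite -[X in (X < _)%N]addn0 ltn_add2l -has_count.
  by apply/hasP; exists x; rewrite ?mem_filter ?bx.
by move=> y /=; case ay: (a y) => //=; apply: ab.
Qed.

Section FiniteSubring.
Variables (R : pzRingType) (N : R -> Prop).
Hypotheses (iN : ideal N) (N_nil : forall x k, x ^+ k = 0 -> N x).
Hypothesis fitting : forall x : R, exists2 k, (0 < k)%N & x ^+ k * x ^+ k = x ^+ k.
Hypothesis idemC : forall e z : R, e * e = e -> e * z = z * e.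
Variable s : seq R.
Hypothesis s1 : 1 \in s.
Hypothesis sB : forall x y, x \in s -> y \in s -> x - y \in s.
Hypothesis sM : forall x y, x \in s -> y \in s -> x * y \in s.

(** Descent on the number of elements of [s] fixed by [e]: a proper idempotent [f] below [e] splits
    [e * c] into [f * c] and [(e - f) * c], and one of them stays outside [N]. *)
Lemma primitive_idempotent c : ~ N c -> exists e, [/\ e \in s, e * e = e, ~ N (e * c) &
  forall f, f \in s -> f * f = f -> e * f = f -> f = 0 \/ f = e].
Proof.
move=> Nc; suff H (m : nat) (e : R) : e \in s -> e * e = e -> ~ N (e * c) ->
    (count (fun x : R => (e * x)%R == x) s <= m)%N ->
    exists e, [/\ e \in s, e * e = e, ~ N (e * c) &
      forall f, f \in s -> f * f = f -> e * f = f -> f = 0 \/ f = e].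
  by apply: (H (size s) 1) => //; rewrite ?mul1r // count_size.
elim: m e => [|m IHm] e se ee Nec le_m.
  by move: le_m; rewrite leqNgt -has_count => /negP[]; apply/hasP; exists e; rewrite ?ee.
have step f : f \in s -> f * f = f -> e * f = f -> f <> e ->
    (count (fun x : R => (f * x)%R == x) s <= m)%N.
  move=> sf ff ef fe; rewrite -ltnS; apply: leq_trans le_m.
  have fE : f * e = f by rewrite (idemC _ ff).
  apply: (count_ltn (x := e)) => //; last by rewrite fE; apply/eqP.
    by move=> x /eqP fx; rewrite -fx mulrA ef.
  by rewrite ee.
case: (classic (forall f, f \in s -> f * f = f -> e * f = f -> f = 0 \/ f = e)) => [H|H].
  by exists e.
have [f [sf ff ef f0 fe]] : exists f, [/\ f \in s, f * f = f, e * f = f, f <> 0 & f <> e].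
  apply: NNPP => H'; apply: H => f sf ff ef; apply: NNPP => /not_or_and[f0 fe].
  by apply: H'; exists f.
have [Nfc|Nfc] := classic (N (f * c)); last first.
  exact: (IHm f sf ff Nfc (step _ sf ff ef fe)).
have fE : f * e = f by rewrite (idemC _ ff).
have gg : (e - f) * (e - f) = e - f by rewrite mulrBr !mulrBl ee ef fE ff subrr subr0.
apply: (IHm (e - f)) => //; first exact: sB.
  by rewrite mulrBl => H'; apply: Nec; rewrite -(subrK (f * c) (e * c)); apply: idealD.
apply: step => //; first exact: sB.
  by rewrite mulrBr ee ef.
by move=> E; apply: f0; rewrite -(subKr e f) E subrr.
Qed.

(** In the corner of a primitive idempotent [e], each element has a power equal to 0 or [e], so it
    lies in [N] or is invertible: modulo [N] the corner is a finite domain. Its commutativity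
    contradicts the choice of [e]. *)
Lemma finite_subring_commute_mod x y : x \in s -> y \in s -> N (x * y - y * x).
Proof.
move=> sx sy; apply: NNPP => Nc; have [e [se ee Nec eP]] := primitive_idempotent Nc.
pose T := [seq u <- s | e * u == u].
have TP u : reflect (u \in s /\ e * u = u) (u \in T).
  by rewrite mem_filter; apply: (iffP andP) => [[/eqP]|[? /eqP]].
have eC z := idemC z ee.
have eT z : z \in s -> e * z \in T.
  by move=> sz; apply/TP; rewrite mulrA ee; split=> //; apply: sM.
have eN := Nec; apply: Nec.
have -> : e * (x * y - y * x) = e * x * (e * y) - e * y * (e * x).
  have H u w : e * u * (e * w) = e * (u * w).
    by rewrite -mulrA (mulrA u) -(eC u) -!mulrA mulrA ee.
  by rewrite !H mulrBr.
apply: (finite_domain_mod_commute (s := T) (e := e)) => //; try exact: eT.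
- by apply/TP.
- move=> a b /TP[sa ea] /TP[sb eb]; apply/TP; split; first exact: sB.
  by rewrite mulrBr ea eb.
- move=> a b /TP[sa ea] /TP[sb eb]; apply/TP; split; first exact: sM.
  by rewrite mulrA ea.
- by move=> a /TP[].
- by move=> a /TP[_ {2}<-]; rewrite eC.
- by move=> Ne; apply: eN; apply: idealMr.
move=> a b /TP[sa ea] /TP[sb eb] Nab.
have [[//|k] _ ff] := fitting a.
have sX j : a ^+ j \in s by elim: j => // j IHj; rewrite exprS; apply: sM.
have ef : e * a ^+ k.+1 = a ^+ k.+1 by rewrite exprS mulrA ea.
have [a0|fe] := eP _ (sX k.+1) ff ef; first by left; apply: N_nil a0.
by right; rewrite -eb -fe exprSr -mulrA; apply: idealMl.
Qed.
End FiniteSubring.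

Lemma expr_eventually_periodic (R : pzRingType) (x : R) k l :
  (0 < l)%N -> x ^+ (k + l) = x ^+ k ->
  forall u, exists v : 'I_(k + l), x ^+ u = x ^+ v.
Proof.
move=> l0 xl; elim/ltn_ind => u IHu.
have [lt|le] := ltnP u (k + l); first by exists (Ordinal lt).
have lt : (u - l < u)%N by rewrite ltn_subrL l0 (leq_trans _ le) // addn_gt0 l0 orbT.
have [v xv] := IHu _ lt; exists v; rewrite -xv.
have [le1 le2] : (l <= u)%N /\ (k <= u - l)%N by split; lia.
by rewrite -{1}(subnK le1) -{1}(subnK le2) -addnA exprD xl -exprD subnK.
Qed.

Section TwistedSubring.
Variables (R : pzRingType) (p : nat) (p_gt0 : (0 < p)%N) (pR0 : forall x : R, x *+ p = 0).
Variables (a b : R) (i m j n q : nat).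
Hypotheses (m0 : (0 < m)%N) (n0 : (0 < n)%N).
Hypotheses (am : a ^+ (i + m) = a ^+ i) (bn : b ^+ (j + n) = b ^+ j).
Hypothesis ba : b * a = a ^+ q * b.


Let X : finType := ('I_(i + m) * 'I_(j + n))%type.
Let mon (u : X) := a ^+ u.1 * b ^+ u.2.
Let comb (c : X -> nat) := \sum_u mon u *+ c u.

(** Periodicity leaves finitely many monomials and characteristic [p] finitely many coefficients;
    the relation [ba] closes the list under products. *)
Definition twisted_subring : seq R := [seq comb (fun u => f u) | f : {ffun X -> 'I_p}].
Local Notation s := twisted_subring.

Let mulrn_mod (x : R) c : x *+ (c %% p) = x *+ c.
Proof. by rewrite [in RHS](divn_eq c p) mulrnDr mulnC mulrnA pR0 mul0rn add0r. Qed.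

Let sP x : reflect (exists c, x = comb c) (x \in s).
Proof.
apply: (iffP mapP) => [[f _ ->]|[c ->]]; first by exists (fun u => nat_of_ord (f u)).
exists [ffun u => Ordinal (ltn_pmod (c u) p_gt0)]; first by rewrite mem_enum.
by apply: eq_bigr => u _; rewrite ffunE /= mulrn_mod.
Qed.

Let sD x y : x \in s -> y \in s -> x + y \in s.
Proof.
move=> /sP[c ->] /sP[d ->]; apply/sP; exists (fun u => (c u + d u)%N).
by rewrite -big_split; apply: eq_bigr => u _; rewrite mulrnDr.
Qed.

Let s0 : 0 \in s.
Proof. by apply/sP; exists (fun=> 0%N); rewrite /comb big1. Qed.

Let sMn x k : x \in s -> x *+ k \in s.
Proof. by move=> sx; elim: k => [|k IHk]; rewrite ?mulr0n // mulrS; apply: sD. Qed.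

Lemma twisted_subringB x y : x \in s -> y \in s -> x - y \in s.
Proof.
move=> sx sy; apply: sD => //; suff -> : - y = y *+ p.-1 by apply: sMn.
by apply/esym/eqP; rewrite -addr_eq0 -mulrSr prednK ?pR0.
Qed.

Let mon_s k l : a ^+ k * b ^+ l \in s.
Proof.
have [k' ->] := expr_eventually_periodic m0 am k.
have [l' ->] := expr_eventually_periodic n0 bn l.
apply/sP; exists (fun u => u == (k', l') : nat).
rewrite /comb (bigD1 (k', l')) //= eqxx big1 ?addr0 // => u /negbTE ->.
by [].
Qed.

Let ba_exp k l : exists k', b ^+ l * a ^+ k = a ^+ k' * b ^+ l.
Proof.
have E t : b * a ^+ t = a ^+ (q * t) * b.
  elim: t => [|t IHt]; first by rewrite muln0 !expr0 mul1r mulr1.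
  by rewrite exprS mulrA ba -mulrA IHt mulrA -exprD mulnS.
elim: l => [|l [k' IHl]]; first by exists k; rewrite !expr0 mul1r mulr1.
by exists (q * k')%N; rewrite exprS -mulrA IHl mulrA E -mulrA.
Qed.

Lemma twisted_subringM x y : x \in s -> y \in s -> x * y \in s.
Proof.
move=> /sP[c ->] /sP[d ->]; rewrite /comb mulr_suml.
elim/big_ind: _ => // u _; rewrite mulr_sumr; elim/big_ind: _ => // v _.
rewrite mulrnAr mulrnAl; do 2!apply: sMn; rewrite /mon mulrA -(mulrA (a ^+ _)).
have [k ->] := ba_exp v.1 u.2.
by rewrite !mulrA -exprD -mulrA -exprD.
Qed.

Lemma twisted_subring_gen : [/\ 1 \in s, a \in s & b \in s].
Proof.
split; first by have := mon_s 0 0; rewrite !expr0 mulr1.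
  by have := mon_s 1 0; rewrite expr0 mulr1.
by have := mon_s 0 1; rewrite expr0 mul1r.
Qed.
End TwistedSubring.

Lemma pigeonhole (T : finType) (f : nat -> T) :
  exists u w, (0 < w)%N /\ f (u + w)%N = f u.
Proof.
have /injectivePn[u [v uv fuv]] : ~~ injectiveb (fun i : 'I_#|T|.+1 => f i).
  by apply/negP => /injectiveP /leq_card; rewrite card_ord ltnn.
wlog lt_uv : u v uv fuv / (u < v)%N.
  move=> H; case: (ltngtP u v) => [|vu|/ord_inj uv']; first exact: H.
    by apply: (H v u) => //; rewrite eq_sym.
  by rewrite uv' eqxx in uv.
by exists u, (v - u)%N; rewrite subn_gt0 subnKC // ltnW.
Qed.

(** * Commutativity modulo the radical over a finite field *)

Section EngelUnitsCommutative.
Variables (F : fieldType) (A : unitAlgType F) (n : nat).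
Hypothesis An : forall x z : units A, iter n (fun v : units A => [~ v, z]%g) x = 1%g.
Variable t : F.
Hypotheses (t0 : t != 0) (t1 : t != 1).
Hypothesis A_fin : forall a : A, exists i m, (0 < m)%N /\ a ^+ (i + m) = a ^+ i.
Variable p : nat.
Hypothesis pF : p \in [pchar F].
Implicit Types (a b c x z : A).

Local Notation L := (@levitzki_radical A).
Let iL : ideal L. Proof. by have [] := @lnil_levitzki_radical A. Qed.
Let p_pr : prime p. Proof. exact: pcharf_prime pF. Qed.
Let pA0 : p%:R = 0 :> A. Proof. by rewrite -scaler_nat pcharf0 ?scale0r. Qed.
Let L_nil a k : a ^+ k = 0 -> L a.
Proof. by move=> ak; apply/(engel_group_nilpotent_levitzki An t0 t1 A_fin); exists k. Qed.
Let fit a : exists2 k, (0 < k)%N & a ^+ k * a ^+ k = a ^+ k.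
Proof. by have [i [m [m0 am]]] := A_fin a; apply: fitting_idempotent m0 am. Qed.
Let idemC (e z : A) (ee : e * e = e) : e * z = z * e :=
  engel_idempotent_central An t0 t1 ee z.

Lemma engel_twisted_commute_mod a b q : b * a = a ^+ q * b -> L (a * b - b * a).
Proof.
move=> ba; have [i [m [m0 am]]] := A_fin a; have [j [k [k0 bk]]] := A_fin b.
have pA x : x *+ p = 0 by rewrite -mulr_natr pA0 mulr0.
have pp := prime_gt0 p_pr; have [s1 sa sb] := twisted_subring_gen pp pA m0 k0 am bk.
apply: (finite_subring_commute_mod iL L_nil fit idemC s1 _ _ sa sb).
- exact: twisted_subringB.
- exact: twisted_subringM ba.
Qed.

(** The product of the [d i = c - i] is [c ^+ p - c = 0], and each [g i] is a central idempotent
    fixing [z]. Left multiplication by [d i] is injective on elements fixed by [g i], so the factors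
    can be cancelled one by one until [z = 0]. *)
Lemma frobenius_fixed_central c : c ^+ p = c -> central c.
Proof.
move=> cp x; pose d i : A := c - i%:R; pose g i := d i ^+ p.-1.
have dC i j : GRing.comm (d i) (d j).
  by apply/commrB; [apply/commr_sym/commrB; [|apply: commr_nat]|apply: commr_nat].
have iC i : GRing.comm (i%:R : A) x by apply/commr_sym/commr_nat.
have dp i : d i ^+ p = d i.
  rewrite -{1}(expn1 p) exprBn_pchar_iter ?expn1 ?cp //; last exact: commr_nat.
  congr (_ - _); rewrite -natrX; have := pFrobenius_aut_nat pF i.
  rewrite pFrobenius_autE -natrX => /(congr1 (fun u : F => u%:A : A)).
  by rewrite !scaler_nat.
have p1 : (1 < p)%N by apply: prime_gt1.
have gE i : g i = d i ^+ p.-2 * d i.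
  by rewrite /g -exprSr; congr (_ ^+ _); lia.
have dg i : d i * g i = d i by rewrite /g -exprS prednK ?dp // ltnW.
have gC i y : g i * y = y * g i.
  by apply: idemC; rewrite {1}gE -mulrA dg -gE.
pose z := c * x - x * c.
have zE i : z = d i * x - x * d i.
  by rewrite /z /d; move: (i%:R : A) (iC i) => I IC; rewrite mulrBl mulrBr IC; nc_ring.
have gz i : g i * z = z.
  by rewrite (zE i) mulrBr !mulrA (gC i x) gC dg -[x * g i * d i]mulrA gC dg.
have g0 i w : g i * w = w -> d i * w = 0 -> w = 0.
  by move=> gw dw; rewrite -gw gE -mulrA dw mulr0.
have prod0 r w : (forall i, g i * w = w) -> \prod_(i <- r) d i * w = 0 -> w = 0.
  elim: r w => [|i r IHr] w gw; first by rewrite big_nil mul1r.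
  have dr : GRing.comm (d i) (\prod_(i <- r) d i) by apply: commr_prod => j _; apply: dC.
  rewrite big_cons dr -mulrA => /IHr H; apply: (g0 i) => //; apply: H => j.
  by rewrite mulrA (gC j (d i)) -mulrA gw.
suff z0 : \prod_(i <- iota 0 p) d i = 0.
  have := prod0 (iota 0 p) z gz; rewrite z0 mul0r => /(_ erefl) /eqP.
  by rewrite subr_eq0 => /eqP.
pose rs := [seq i%:R : F | i <- iota 0 p].
have fermat : 'X^p - 'X = \prod_(r <- rs) ('X - r%:P) :> {poly F}.
  have sz : size ('X^p - 'X : {poly F}) = p.+1.
    by rewrite size_polyDl ?size_polyN ?size_polyXn ?size_polyX // ltnS.
  have lc : lead_coef ('X^p - 'X : {poly F}) = 1.
    by rewrite lead_coefDl ?lead_coefXn // size_polyN size_polyXn size_polyX ltnS.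
  rewrite -[RHS]scale1r -lc; apply: all_roots_prod_XsubC.
  - by rewrite sz size_map size_iota.
  - apply/allP => _ /mapP[i _ ->]; rewrite /root !hornerE.
    by rewrite -natrX -[i%:R](pFrobenius_aut_nat pF) pFrobenius_autE -natrX subrr.
  rewrite uniq_rootsE map_inj_in_uniq ?iota_uniq // => i j.
  rewrite !mem_iota /= add0n => ip jp /eqP.
  wlog le_ij : i j ip jp / (i <= j)%N.
    by move=> H; case/orP: (leq_total i j) => /H; [|rewrite eq_sym => H' /H' ->]; auto.
  rewrite eq_sym -subr_eq0 -natrB // -(dvdn_pcharf pF) => /dvdnP[[|k]]; last by nia.
  by move/eqP; rewrite subn_eq0 => le_ji; apply/eqP; rewrite eqn_leq le_ij.
have := congr1 (horner_alg c) fermat.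
rewrite rmorphB rmorphXn /= horner_algX cp subrr rmorph_prod big_map => /esym <-.
apply: eq_bigr => i _; rewrite rmorphB /= horner_algX horner_algC.
by rewrite scaler_nat.
Qed.

Section FrobeniusInvariant.
Variables (a : A) (k : nat).
Hypothesis ak : a ^+ (p ^ k.+1) = a.
Local Notation theta := (horner_alg a).
(** Its roots are the Frobenius images of the inner variable, which [theta] evaluates at [a]. *)
Let Phi m : {poly {poly F}} := \prod_(j < m) ('X - ('X^(p ^ j))%:P).

Let size_Phi m : size (Phi m) = m.+1.
Proof. by rewrite size_prod_XsubC [index_enum _]unlock -enumT size_enum_ord. Qed.

Let thetaX m : theta 'X^m = a ^+ m.
Proof. by rewrite rmorphXn /= horner_algX. Qed.

(* Frobenius permutes the factors of [Phi k.+1] modulo ['X^(p ^ k.+1) - 'X]. *)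
Let Phi_central i : central (theta (Phi k.+1)`_i).
Proof.
apply: frobenius_fixed_central.
have pP : p \in [pchar {poly F}] by rewrite pchar_poly.
have -> : theta (Phi k.+1)`_i ^+ p = theta (map_poly (pFrobenius_aut pP) (Phi k.+1))`_i.
  by rewrite coef_map /= pFrobenius_autE rmorphXn.
rewrite /Phi map_prod_XsubC.
under eq_bigr => j _ do rewrite /= pFrobenius_autE -exprM -expnSr.
rewrite big_ord_recr [in RHS]big_ord_recl /= expn0 expr1.
set Psi := \prod_(j < k) _.
apply/eqP; rewrite -subr_eq0 -rmorphB /= -coefB -/Psi.
have -> : Psi * ('X - ('X^(p ^ k.+1))%:P) - ('X - 'X%:P) * Psi =
    ('X - 'X^(p ^ k.+1))%:P * Psi.
  rewrite polyCB; move: ('X^(p ^ k.+1))%:P 'X%:P => u v.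
  by rewrite [RHS]mulrC [X in _ - X]mulrC -mulrBr; congr (_ * _); nc_ring.
by rewrite coefCM rmorphM rmorphB /= thetaX ak horner_algX subrr mul0r.
Qed.

Let step j z := z * a - a ^+ (p ^ j) * z.
Let step_iter x m := iteri m step x.

Let step_iterE x m : step_iter x m = \sum_(i < m.+1) theta (Phi m)`_i * x * a ^+ i.
Proof.
elim: m => [|m IHm].
  by rewrite /Phi big_ord0 big_ord1 coef1 rmorph1 mul1r mulr1.
rewrite [LHS]/= -/(step_iter x m) IHm.
have -> : Phi m.+1 = Phi m * 'X - ('X^(p ^ m))%:P * Phi m.
  by rewrite /Phi big_ord_recr /= mulrBr [in X in _ - X]mulrC.
under [RHS]eq_bigr => i _ do
  rewrite coefB coefMX coefCM rmorphB rmorphM /= thetaX !mulrBl -!mulrA.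
rewrite sumrB [in RHS]big_ord_recl /= rmorph0 mul0r add0r.
rewrite /step mulr_suml mulr_sumr; congr (_ - _).
  by apply: eq_bigr => i _; rewrite /bump /= add1n exprSr !mulrA.
rewrite [RHS]big_ord_recr /= [X in _ + X](_ : _ = 0) ?addr0.
  by apply: eq_bigr => i _; rewrite !mulrA.
rewrite (_ : (Phi m)`_m.+1 = 0) ?rmorph0 ?mul0r ?mulr0 //.
by apply: nth_default; rewrite size_Phi.
Qed.

(** The coefficients at [a] are central, so the composite operator multiplies [x] by the value of
    [Phi k.+1] at [a], a root through the factor [j = 0]. *)
Let step_iter_eq0 x : step_iter x k.+1 = 0.
Proof.
rewrite step_iterE (eq_bigr (fun i : 'I_k.+2 => x * (theta (Phi k.+1)`_i * a ^+ i))).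
  rewrite -mulr_sumr (_ : \sum_i _ = theta (Phi k.+1).['X]).
    by rewrite /Phi big_ord_recl hornerM !hornerE expn0 expr1 subrr mul0r rmorph0 mulr0.
  rewrite (@horner_coef_wide _ k.+2).
    rewrite rmorph_sum; apply: eq_bigr => i _.
    by rewrite rmorphM /= thetaX.
  by rewrite size_Phi.
by move=> i _; rewrite Phi_central -mulrA.
Qed.

Lemma engel_periodic_commute_mod x : L (a * x - x * a).
Proof.
pose D z := L (a * z - z * a).
have stepD j z : D z -> D (step j z).
  rewrite /D /step => Dz; have ac : GRing.comm a (a ^+ (p ^ j)) by apply: commrX.
  have -> : a * (z * a - a ^+ (p ^ j) * z) - (z * a - a ^+ (p ^ j) * z) * a =
      (a * z - z * a) * a - a ^+ (p ^ j) * (a * z - z * a).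
    by rewrite mulrBr [a * (a ^+ _ * z)]mulrA ac; nc_ring.
  by apply: idealB => //; [apply: idealMr | apply: idealMl].
(* As [a ^+ q = a], the [q]-th iterate of [step j] is [step j]. So [z] minus its [q.-1]-th iterate
   is killed by [step j], that is, forms a twisted pair with [a], while the iterate inherits [D]. *)
have Dstep j z : D (step j z) -> D z.
  move=> Dz; set q := (p ^ k.+1)%N.
  have q0 : (1 < q)%N by rewrite -{1}(exp1n k.+1) ltn_exp2r ?prime_gt1.
  have Dq : D (iter q.-1 (step j) z).
    rewrite -(subnK (_ : 0 < q.-1)%N) ?addn1 ?iterSr; last by lia.
    by elim: (_ - _)%N => // i IHi; apply: stepD.
  rewrite -(subrK (iter q.-1 (step j) z) z) /D.
  set w := iter _ _ _ in Dq *; set b := z - w.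
  have -> : a * (b + w) - (b + w) * a = (a * b - b * a) + (a * w - w * a) by nc_ring.
  apply: idealD => //; apply: (engel_twisted_commute_mod (q := (p ^ j)%N)).
  apply/eqP; rewrite -subr_eq0 -/(step j b).
  have -> : step j b = step j z - step j w by rewrite /step /b; nc_ring.
  rewrite /w -iterS prednK 1?ltnW // /step iter_twisted_pchar // -exprM mulnC exprM -/q.
  by rewrite /q ak subrr.
suff D_iter m : D (step_iter x m) -> D x.
  by apply: (D_iter k.+1); rewrite step_iter_eq0 /D mulr0 mul0r subrr; apply: ideal0.
by elim: m => // m IHm Dm; apply/IHm/(Dstep m).
Qed.
End FrobeniusInvariant.

(** Two of the powers [a ^+ (p ^ j)] agree, so modulo the radical [a] equals one of its powers [s]
    that is fixed by an iterated Frobenius. *)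
Lemma engel_commute_mod a x : L (a * x - x * a).
Proof.
have [i [m [m0 am]]] := A_fin a.
have [f fE] : exists f : nat -> 'I_(i + m), forall j, a ^+ (p ^ j) = a ^+ f j.
  have H j := expr_eventually_periodic m0 am (p ^ j).
  by have [f fP] := boolp.choice H; exists f.
have [u [[|w] [// _ fuw]]] := pigeonhole f.
have apu : a ^+ (p ^ (u + w.+1)) = a ^+ (p ^ u) by rewrite !fE fuw.
have Law : L (a ^+ (p ^ w.+1) - a).
  apply: (@L_nil _ (p ^ u)%N); rewrite exprBn_pchar_iter //; last exact/esym/commrX.
  by rewrite -exprM -expnD addnC apu subrr.
have Lawj j : L (a ^+ (p ^ (w.+1 * j)) - a).
  elim: j => [|j IHj]; first by rewrite muln0 expn0 expr1 subrr; apply: ideal0.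
  apply: ideal_eqv_trans Law => //; rewrite mulnS addnC expnD exprM.
  exact: ideal_eqvX.
set s := a ^+ (p ^ (w.+1 * u)) in Lawj *.
have sw : s ^+ (p ^ w.+1) = s.
  rewrite /s -exprM -expnD; have -> : (w.+1 * u + w.+1 = u + w.+1 + w * u)%N by lia.
  by rewrite expnD exprM apu -exprM -expnD mulSn.
have Las : L (a - s) by apply: ideal_eqv_sym => //; apply: Lawj.
have -> : a * x - x * a = (a - s) * x - x * (a - s) + (s * x - x * s) by nc_ring.
apply: idealD => //; last exact: engel_periodic_commute_mod sw x.
by apply: idealB => //; [apply: idealMr | apply: idealMl].
Qed.

Let commutator_nil (x y : units A) : exists m, (uval [~ x, y]%g - 1) ^+ m = 0.
Proof.
apply: levitzki_radical_nil; have xK := uvalVK x; have yK := uvalVK y.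
rewrite uvalR; move: (uval x) (uval y) xK yK => X Y xK yK.
have -> : X^-1 * (Y^-1 * (X * Y)) - 1 = X^-1 * Y^-1 * (X * Y - Y * X).
  rewrite mulrBr mulrA; congr (_ - _).
  by rewrite -mulrA (mulrA Y^-1) yK mul1r xK.
by apply: idealMl => //; apply: engel_commute_mod.
Qed.

(** Fitting decomposition: [a] is invertible on the part of an idempotent power [e] and nilpotent on
    that of [f = 1 - e], so [a + f = (a e + f) (1 + a f)] is a unit. *)
Let unit_sub_idempotent a : exists (u : units A) (e : A), central e /\ a = uval u - e.
Proof.
have [[//|k] _ ee] := fit a; set e := a ^+ k.+1 in ee.
have eC := engel_idempotent_central An t0 t1 ee.
pose f := 1 - e; have fC : central f by move=> z; rewrite mulrBl mulrBr eC mul1r mulr1.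
have ef : e * f = 0 by rewrite mulrBr mulr1 ee subrr.
have ff : f * f = f by rewrite {1}/f mulrBl mul1r ef subr0.
have e1f : e + f = 1 by rewrite addrC subrK.
clearbody f; pose v := a * e + f; pose w := a ^+ k * e + f.
have akC : a * a ^+ k = a ^+ k * a by rewrite -exprS exprSr.
have ve (b c : A) : b * c = e -> (b * e + f) * (c * e + f) = 1.
  move=> bc; have E1 : b * e * (c * e) = e.
    by rewrite -mulrA (mulrA e) eC -mulrA ee mulrA bc ee.
  have E2 : b * e * f = 0 by rewrite -mulrA ef mulr0.
  have E3 : f * (c * e) = 0 by rewrite fC -mulrA ef mulr0.
  by rewrite mulrDl !mulrDr E1 E2 E3 ff addr0 add0r.
have vU : v \is a GRing.unit by apply/unitrP; exists w; rewrite !ve // -?exprS -?exprSr.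
have afU : 1 + a * f \is a GRing.unit.
  apply: unitr_1Dnil; exists k.+1; rewrite exprMn_comm; last exact/commr_sym/fC.
  by rewrite -/e exprS mulrA ef mul0r.
have uE : v * (1 + a * f) = a + f.
  rewrite mulrDr mulr1 /v mulrDl -fC [a * e * _]mulrA -[a * e * f]mulrA ef.
  rewrite mulr0 mul0r add0r.
  rewrite mulrA ff fC -addrA [f + _]addrC addrA -mulrDr.
  by rewrite e1f mulr1.
have uU : a + f \is a GRing.unit by rewrite -uE unitrMl.
by exists (Units uU), f; split=> //; rewrite addrK.
Qed.

(** Central idempotents drop out of brackets, which leaves units. [p ^ K] is the [n]-th power of
    [p ^ (3 * n).+1], the exponent for which [engel_commute_expg] gives commutation after [n]
    steps. *)
Lemma engel_group_lie_engel_finite : exists k, lie_engel A k.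
Proof.
pose K := ((3 * n).+1 * n)%N; exists (p ^ K)%N => x y.
have [u [e [eC ->]]] := unit_sub_idempotent x.
have [v [f [fC ->]]] := unit_sub_idempotent y.
have E (z : A) : bracket z (uval v - f) = bracket z (uval v).
  by rewrite /bracket mulrBr mulrBl fC opprB addrA subrK.
rewrite (eq_iter E) iter_bracket_pchar //.
have /commute_uval uvC := engel_commute_expg An p_pr pA0 commutator_nil (An u v).
apply/bracket_eq0; rewrite mulrBl mulrBr eC; congr (_ - _).
have uvalX (h : units A) j : uval (h ^+ j)%g = uval h ^+ j.
  by elim: j => // j IHj; rewrite expgS exprS uvalM IHj.
by rewrite -uvalX /K expnM.
Qed.
End EngelUnitsCommutative.

Lemma exists_neq0_neq1 (F : fieldType) :
  ~ (exists f : {rmorphism F -> 'F_2}, bijective f) -> exists t : F, t != 0 /\ t != 1.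
Proof.
move=> F2; apply: NNPP => H; apply: F2.
have F01 (x : F) : x = 0 \/ x = 1.
  apply: NNPP => /not_or_and[/eqP x0 /eqP x1]; apply: H; exists x.
  by split.
pose f (x : F) : 'F_2 := if x == 0 then 0 else 1.
have f0 : f 0 = 0 by rewrite /f eqxx.
have f1 : f 1 = 1 by rewrite /f oner_eq0.
have fB : zmod_morphism f.
  move=> x y; case: (F01 x) => ->;
    case: (F01 y) => ->; rewrite ?subrr ?subr0 ?f0 ?f1 ?subrr ?subr0 //.
  by rewrite /f sub0r oppr_eq0 oner_eq0; apply/val_inj.
have fM : monoid_morphism f.
  split=> // x y; case: (F01 x) => ->; case: (F01 y) => ->;
  by rewrite ?mulr0 ?mul0r ?mulr1 ?f0 ?f1 ?mulr0 ?mul0r ?mulr1.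
pose m := GRing.isZmodMorphism.Build F 'F_2 f fB.
pose m' := GRing.isMonoidMorphism.Build F 'F_2 f fM.
pose g : {rmorphism F -> 'F_2} := HB.pack f m m'.
exists g; exists (fun y : 'F_2 => if y == 0 then 0 else 1).
  by move=> x; rewrite /g /=; case: (F01 x) => ->; rewrite ?f0 ?f1 ?eqxx // oner_eq0.
by case=> [[|[|//]] i]; rewrite /g /=; [rewrite f0|rewrite f1]; apply/val_inj.
Qed.

Section FiniteField.
Variables (F : fieldType) (s : seq F) (sF : forall x, x \in s).

Lemma finite_field_algebraic_periodic (A : unitAlgType F) : algebraic_algebra A ->
  forall a : A, exists i m, (0 < m)%N /\ a ^+ (i + m) = a ^+ i.
Proof.
move=> A_alg a; have [P P0 aP] := A_alg a.
pose f j : {ffun 'I_(size P) -> seq_sub s} :=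
  [ffun i : 'I_(size P) => SeqSub (sF ('X^j %% P)`_i)].
have [u [w [w0 fuw]]] := pigeonhole f; exists u, w; split=> //.
have aE j : a ^+ j = horner_alg a ('X^j %% P).
  rewrite -[in LHS](horner_algX a) -rmorphXn {1}(divp_eq 'X^j P).
  by rewrite rmorphD rmorphM /= aP mulr0 add0r.
rewrite !aE; congr horner_alg; apply/polyP => i.
have [lt|le] := ltnP i (size P).
  by move/ffunP/(_ (Ordinal lt)): fuw; rewrite !ffunE => -[].
have sm j : (size ('X^j %% P)%R <= i)%N by apply: leq_trans le; rewrite ltnW // ltn_modp.
by rewrite !nth_default.
Qed.

Lemma finite_field_pchar : exists p, p \in [pchar F].
Proof.
have [u [w [w0 [uw]]]] := pigeonhole (fun j => SeqSub (sF j%:R)).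
have [//||p] := @natf0_pchar F w; last by exists p.
by apply/eqP/(addrI u%:R); rewrite -natrD uw addr0.
Qed.
End FiniteField.

Lemma infinite_or_finite (T : eqType) :
  (forall m, exists s : seq T, uniq s /\ (m <= size s)%N) \/
  (exists s : seq T, forall x, x \in s).
Proof.
case: (classic (exists s : seq T, forall x, x \in s)) => [|H]; [by right | left].
elim=> [|m [s [us ms]]]; first by exists [::].
have [x xs] : exists x, x \notin s.
  apply: NNPP => H'; apply: H; exists s => x; apply/negPn/negP => xs.
  by apply: H'; exists x.
by exists (x :: s); rewrite /= xs us ltnS.
Qed.

Lemma engel_group_lie_engel (F : fieldType) (A : unitAlgType F) (t : F) n :
  t != 0 -> t != 1 -> algebraic_algebra A ->
  (forall x z : units A, iter n (fun v : units A => [~ v, z]%g) x = 1%g) ->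
  exists k, lie_engel A k.
Proof.
move=> t0 t1 A_alg An; have [F_inf|[s sF]] := infinite_or_finite F.
  by exists n; apply: engel_group_infinite.
have [p pF] := finite_field_pchar sF.
have A_fin := finite_field_algebraic_periodic sF A_alg.
exact: (engel_group_lie_engel_finite An t0 t1 A_fin pF).
Qed.

Lemma exists_least (P : nat -> Prop) c :
  P c -> exists m, P m /\ forall d, P d -> (m <= d)%N.
Proof.
elim/ltn_ind: c => c IHc Pc; case: (classic (exists2 d, (d < c)%N & P d)) => [[d dc]|H].
  exact: IHc.
exists c; split=> // d Pd; rewrite leqNgt; apply/negP => dc.
by apply: H; exists d.
Qed.

Theorem theorem2p2 (F : fieldType) (A : unitAlgType F)
    (F_perfect : perfect_field F)
    (F_neq_F2 : ~ exists f : {rmorphism F -> 'F_2}, bijective f)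
    (A_algebraic : algebraic_algebra A) :
  ((bounded_engel_group (units A) <-> bounded_engel_algebra A) /\
   (bounded_engel_algebra A ->
    [/\ two_sided_ideal (@nilpotent_elt F A),
        locally_nilpotent (@nilpotent_elt F A)
      & forall a : A, exists z, exists2 n,
          central z /\ nilpotent_elt n & a = z + n])) /\
  ((nilpotent_group (units A) <-> lie_nilpotent A) /\
   (lie_nilpotent A ->
    exists c, group_nilpotency_class (units A) c /\ lie_nilpotency_class A c)).
Proof.
have [t [t0 t1]] := exists_neq0_neq1 F_neq_F2.
have engelE : bounded_engel_group (units A) <-> bounded_engel_algebra A.
  split=> [[n _ An]|[n _ An]]; last exact: (@engel_unit_group F A n).
  have [k Ak] := engel_group_lie_engel t0 t1 A_algebraic An.
  by exists k.+1 => // x y; apply: (lie_engel_leq (leqnSn k) Ak).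
have structure : bounded_engel_algebra A -> [/\ two_sided_ideal (@nilpotent_elt F A),
        locally_nilpotent (@nilpotent_elt F A)
      & forall a : A, exists z, exists2 n, central z /\ nilpotent_elt n & a = z + n].
  case=> n _ An; have [N_ideal N_ln] := @engel_nilpotents F A n An; split=> // a.
  have [z [zC aN]] := engel_central_nilpotent a F_perfect A_algebraic An.
  by exists z, (a - z); rewrite // addrC subrK.
split; first by [].
have lie_group c : lie_class_le A c -> group_class_le (units A) c.
  by move/lie_class_le_ucs => Ac; apply/group_class_le_ucs => u; apply: group_ucs_of_lie.
have group_engel c : group_class_le (units A) c -> bounded_engel_group (units A).
  (* One commutator beyond the class, because the definition asks for a positive exponent. *)
  move/group_class_le_ucs => Gc; exists c.+1 => // x y.
  suff H k z : group_ucs k z -> iter k (fun v : units A => [~ v, y]%g) z = 1%g.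
    by rewrite iterS H // comm1g.
  by elim: k z => // k IHk z Zz; rewrite iterSr; apply/IHk/Zz.
have lie_engel_nilpotent c : lie_class_le A c -> bounded_engel_algebra A.
  move/lie_class_le_ucs => Ac; exists c.+1 => // x y.
  suff H k z : lie_ucs k z -> iter k (fun v => lie_bracket v y) z = 0.
    by rewrite iterS H // /lie_bracket mulr0 mul0r subrr.
  by elim: k z => // k IHk z Zz; rewrite iterSr; apply/IHk/Zz.
have group_lie c : group_class_le (units A) c -> lie_class_le A c.
  move=> Gc; have [[N0 ND _ NM] _ A_ZN] := structure (proj1 engelE (group_engel c Gc)).
  have tU : (t%:A : A) \is a GRing.unit.
    apply/unitrP; exists t^-1%:A.
    by rewrite -!scalerAl !mul1r !scalerA mulVf ?mulfV ?scale1r.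
  (* Central elements enter the upper series only at level 1, so class 0 is separate: it would make
     the unit [t] equal to 1. *)
  case: c Gc => [Gc|c /group_class_le_ucs Gc].
    have /(congr1 (@uval A))/eqP := Gc (Units tU) I.
    rewrite /= -subr_eq0 -[X in _ - X]scale1r -scalerBl.
    by rewrite scaler_eq0 oner_eq0 orbF subr_eq0 (negbTE t1).
  have iN : ideal (@nilpotent_elt F A) by split=> // [x a|a x] /(NM x)[].
  have NU (a : A) : nilpotent_elt a -> 1 + a \is a GRing.unit.
    by move=> aN; apply: unitr_1Dnil.
  have A_ZN' (a : A) : exists2 z, central z & nilpotent_elt (a - z).
    by have [z [v [zC vN] ->]] := A_ZN a; exists z; rewrite // addrC addKr.
  apply/lie_class_le_ucs => a; have [z zC aN] := A_ZN' a.
  rewrite -(subrK z a); apply: lie_ucsD; last exact: lie_ucs_central.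
  have := lie_ucs_of_group iN NU A_ZN' t0 t1 (Gc (Units (NU _ aN))).
  by rewrite /= addrC addKr.
split.
  by split=> [[c /group_lie]|[c /lie_group]]; exists c.
(* The same bounds [c] are valid on both sides, so a least one for the algebra is least for the
   group. *)
case=> c Ac; have [m [Am m_least]] := exists_least Ac; exists m.
by split; split=> //; [apply: lie_group | move=> d /group_lie /m_least].
Qed.
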